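(* Let $f(z)=\sum_{n\ge0} a_n z^{-n}\in\mathbb{C}[[z^{-1}]]$ be a Gevrey-1 formal series with Borel transform $\widetilde f(\zeta)=\sum_{n\ge1} \frac{a_n\zeta^{n-1}}{(n-1)!}$. Let $\lambda>0$ and assume that $\widetilde f$ extends holomorphically to $\Delta_\lambda$ and that there exist $A>0$, $B>0$ with $|\widetilde f(\zeta)|\le A e^{B|\zeta|}$ for all $\zeta\in\Delta_\lambda$. Put $a_n^{(\lambda)}=\lambda^{n-1}a_n$ and, for $n\ge0$, $$b_n^{(\lambda)}=\frac{1}{n!}\sum_{k=1}^{n+1}(-1)^{n-k+1}\mathfrak{s}(n,k-1)\,a_k^{(\lambda)}.$$ Then: (i) the factorial series $a_0+\lambda\sum_{n=0}^{+\infty}\frac{\Gamma(\lambda z)\Gamma(n+1)b_n^{(\lambda)}}{\Gamma(\lambda z+n+1)}$ converges absolutely for $\Re(z)>\max(B,1/\lambda)$, and its sum equals $\mathrm{S}_0 f(z)$ there; (ii) for every integer $N\ge0$ and every $z$ with $\Re(z)>B$, $$\Big|\mathrm{S}_0f(z)-\Big(a_0+\lambda\sum_{n=0}^{N}\frac{\Gamma(\lambda z)\Gamma(n+1)b_n^{(\lambda)}}{\Gamma(\lambda z+n+1)}\Big)\Big|\le R_{fact}(\lambda,A,B,N,z),$$ where $$R_{fact}(\lambda,A,B,N,z)=\frac{A}{(\lambda B)^{\lambda B}}\,\frac{(N+\lambda B+1)^{N+\lambda B+1}}{(N+1)^N}\left|\frac{\Gamma(\lambda z)\Gamma(N+1)}{\Gamma(\lambda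 z+N+1)(\Re(z)-B)}\right|.$$
   Context: $\Delta$ denotes the image of the open disc $D(1,1)=\{s:|s-1|<1\}$ under $s\mapsto-\ln s$ (principal logarithm), and $\Delta_\lambda=\{\lambda\zeta:\zeta\in\Delta\}$. A series $\sum a_n z^{-n}$ is Gevrey-1 if $|a_n|\le CK^n n!$ for some constants. The Borel sum is $\mathrm{S}_0 f(z)=a_0+\int_0^{+\infty}\widetilde f(\zeta)e^{-z\zeta}\,d\zeta$ ($\Re z>B$). Stirling numbers of the first kind: $\prod_{k=0}^{n-1}(x-k)=\sum_{k=0}^n\mathfrak{s}(n,k)x^k$. *)

(* Defs.v *)
From Stdlib Require Import Reals ZArith List.
From Coquelicot Require Import Coquelicot.
Open Scope R_scope.

Definition Cexp (z : C) : C :=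
  (exp (Re z) * cos (Im z), exp (Re z) * sin (Im z)).

Definition Carg (s : C) : R :=
  let x := Re s in let y := Im s in
  if Rlt_dec 0 x then atan (y / x)
  else if Rlt_dec x 0 then
         (if Rle_dec 0 y then atan (y / x) + PI else atan (y / x) - PI)
  else if Rlt_dec 0 y then PI / 2
  else if Rlt_dec y 0 then - (PI / 2) else 0.

Definition Clog (s : C) : C := (ln (Cmod s), Carg s).

Definition Delta (zeta : C) : Prop :=
  exists s : C, Cmod (s - 1)%C < 1 /\ zeta = Copp (Clog s).

Definition Delta_lam (lam : R) (zeta : C) : Prop :=
  exists xi : C, Delta xi /\ zeta = (RtoC lam * xi)%C.

Definition Gevrey1 (a : nat -> C) : Prop :=
  exists Cc K : R, forall n : nat, Cmod (a n) <= Cc * K ^ n * INR (fact n).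

(** Borel transform: tilde f (zeta) = sum_{n>=1} a_n zeta^(n-1)/(n-1)!  (reindexed) *)
Definition borel_term (a : nat -> C) (zeta : C) (n : nat) : C :=
  (a (S n) * Cpow zeta n / RtoC (INR (fact n)))%C.

(** Euler's Gamma function  Gamma(w) = int_0^oo t^(w-1) e^(-t) dt,
    (improper Riemann integral; used only for Re w > 0, where it converges). *)
Definition Cgamma (w : C) : C :=
  @RInt_gen C_R_CompleteNormedModule
    (fun t : R => (Cexp ((w - 1) * RtoC (ln t)) * RtoC (exp (- t)))%C)
    (at_right 0) (Rbar_locally p_infty).

(** Stirling numbers of the first kind (signed), as the coefficients of
    prod_{k=0}^{n-1} (x - k) = sum_k s(n,k) x^k.  Polynomials are coefficient
    lists (lowest degree first). *)
Fixpoint padd (p q : list Z) : list Z :=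
  match p, q with
  | nil, _ => q
  | _, nil => p
  | x :: p', y :: q' => (x + y)%Z :: padd p' q'
  end.

Definition mul_X_minus (c : Z) (p : list Z) : list Z :=
  padd (0%Z :: p) (map (fun x => (- c * x)%Z) p).

Fixpoint falling_poly (n : nat) : list Z :=
  match n with
  | O => 1%Z :: nil
  | S m => mul_X_minus (Z.of_nat m) (falling_poly m)
  end.

Definition stirling1 (n k : nat) : Z := nth k (falling_poly n) 0%Z.

Example stirling1_3 : map (stirling1 3) (seq 0 4) = (0 :: 2 :: -3 :: 1 :: nil)%Z.
Proof. reflexivity. Qed.
Example stirling1_4 : map (stirling1 4) (seq 0 5) = (0 :: -6 :: 11 :: -6 :: 1 :: nil)%Z.
Proof. reflexivity. Qed.

Fixpoint csum (f : nat -> C) (N : nat) : C :=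
  match N with
  | O => f O
  | S m => (csum f m + f (S m))%C
  end.

(** b_n^(lambda) = 1/n! sum_{k=1}^{n+1} (-1)^(n-k+1) s(n,k-1) lambda^(k-1) a_k ,
    reindexed with j = k-1 in 0..n: (-1)^(n-j) s(n,j) lambda^j a_(j+1) *)
Definition b_lam (lam : R) (a : nat -> C) (n : nat) : C :=
  (/ RtoC (INR (fact n)) *
   csum (fun j => RtoC ((-1) ^ (n - j) * IZR (stirling1 n j) * lam ^ j) * a (S j)) n)%C.

Definition fact_term (lam : R) (a : nat -> C) (z : C) (n : nat) : C :=
  (RtoC lam * (Cgamma (RtoC lam * z) * Cgamma (RtoC (INR (S n))) * b_lam lam a n)
     / Cgamma (RtoC lam * z + RtoC (INR (S n))))%C.

Definition laplace_integrand (F : C -> C) (z : C) (t : R) : C :=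
  (F (RtoC t) * Cexp (- (z * RtoC t)))%C.

Definition borel_sum (a : nat -> C) (F : C -> C) (z : C) : C :=
  (a O + @RInt_gen C_R_CompleteNormedModule (laplace_integrand F z)
                    (at_point 0) (Rbar_locally p_infty))%C.

Definition R_fact (lam A B : R) (N : nat) (z : C) : R :=
  A / Rpower (lam * B) (lam * B)
  * (Rpower (INR N + lam * B + 1) (INR N + lam * B + 1) / (INR N + 1) ^ N)
  * Cmod (Cgamma (RtoC lam * z) * Cgamma (RtoC (INR (S N)))
          / (Cgamma (RtoC lam * z + RtoC (INR (S N))) * RtoC (Re z - B)))%C.

(* Main.v *)
Require Import Defs.
From Stdlib Require Import Reals Lra Lia ZArith List ClassicalEpsilon.
From Coquelicot Require Import Coquelicot.
Open Scope R_scope.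

(** The substitution [s = exp(-t/lam)] turns [F] into [phi(s) = F(-lam log s)], holomorphic on the
    disc [|s - 1| < 1]. Put [E_n(t) = s^n phi^(n)(s)]; then [E_(n+1) = - lam E_n' - n E_n], so that
    integrating the Laplace integral of [E_n] by parts gives, with [w = lam z],
    [(w + n) L(E_n) + L(E_(n+1)) = lam phi^(n)(1)]. Since [phi^(n)(1) = (-1)^n n! b_n] (because
    [s^n (d/ds)^n = sum_k s(n,k) (s d/ds)^k]), iterating yields the factorial series with remainder
    [+- L(E_(N+1)) / (w (w+1) ... (w+N))].

    The remainder is controlled by Cauchy's estimate for [phi^(n)(s)] on the circle of radius
    [al s] about [s], where [|phi|] is at most [A exp(B t) exp(lam B |log(1 + v)|)], [|v| = al].
    Bounding [|log(1 + v)|] by [- ln (1 - al)] and taking [al = n / (n + lam B)] gives (ii).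
    For (i) this is too weak: one uses instead that [exp(lam B |log(1 + v)|)] is large only near
    [v = -1], so that its mean over the circle is [O((1 - al)^(1 - c))] for any
    [c > 1] with [c >= lam B]; with [al = (n+1)/(n+2)] this makes the series converge absolutely and
    the remainder vanish as soon as [Re w > max(lam B, 1)]. *)

(** * Complex-valued functions of a real variable *)

(** The two bounds differ by one power of [n]. The supremum in Cauchy's estimate makes
    [|phi^(n)(1)| / n!] of order [n^(lam B)], while [n! / (w (w+1) ... (w+n))] decays like
    [n^(- Re w - 1)] times [n!/(n-1)!]-type factors that leave [n^(- Re w)]: absolute convergence
    would require [Re w > lam B + 1]. The mean replaces the exponent [lam B] by [c - 1], so that
    [Re w > c] suffices. The condition [c > 1] is where [1/lam] enters the domain of convergence:
    the mean of [|t - PI|^(-c)], cut off at distance [1 - al], grows like [(1 - al)^(1 - c)] only in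
    that range. Two ingredients are derived from bare definitions. Holomorphy means complex
    differentiability at each point, with nothing assumed on the derivative, so Cauchy's formula has
    to come from Goursat's bisection argument. Gamma is an improper integral, and the quotient of
    Gamma values in a term reduces to a rising factorial only once [Gamma(w) <> 0] is known for
    [Re w > 0]. *)

Definition cder (f : R -> C) (t : R) (l : C) : Prop :=
  is_derive (fun u => Re (f u)) t (Re l) /\ is_derive (fun u => Im (f u)) t (Im l).

Definition ccont (f : R -> C) (t : R) : Prop :=
  continuous (fun u => Re (f u)) t /\ continuous (fun u => Im (f u)) t.

Definition CI (f : R -> C) (a b : R) (l : C) : Prop :=
  @is_RInt C_R_NormedModule f a b l.

(** Written without a quotient and with a non-strict bound, so that [y = z] need not be excluded and
    all rules become inequalities between moduli. *)
Definition Cdiff (f : C -> C) (z l : C) : Prop :=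
  forall e, 0 < e -> exists d, 0 < d /\ forall y, Cmod (y - z)%C < d ->
    Cmod (f y - f z - l * (y - z))%C <= e * Cmod (y - z)%C.

Lemma Re_le_Cmod (z : C) : Rabs (Re z) <= Cmod z.
Proof. apply re_le_Cmod. Qed.

Lemma Im_le_Cmod (z : C) : Rabs (Im z) <= Cmod z.
Proof. eapply Rle_trans; [apply Rmax_r | apply (Rmax_Cmod z)]. Qed.

Lemma Cmod_le_abs (z : C) : Cmod z <= Rabs (Re z) + Rabs (Im z).
Proof.
  unfold Cmod, Re, Im; destruct z as [x y]; cbn [fst snd].
  rewrite <- (sqrt_Rsqr (Rabs x + Rabs y)).
  2: { pose proof (Rabs_pos x); pose proof (Rabs_pos y); lra. }
  apply sqrt_le_1_alt. unfold Rsqr.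
  rewrite <- (pow2_abs x), <- (pow2_abs y).
  pose proof (Rabs_pos x); pose proof (Rabs_pos y); nra.
Qed.

Lemma Cmod_sub_sym (x y : C) : Cmod (x - y)%C = Cmod (y - x)%C.
Proof. rewrite <- Cmod_opp. f_equal. ring. Qed.

Lemma Cmod_reverse_triangle (x y : C) : Cmod x - Cmod y <= Cmod (x + y)%C.
Proof.
  pose proof (Cmod_triangle (x + y) (- y)). rewrite Cmod_opp in H.
  replace (x + y + - y)%C with x in H by ring. lra.
Qed.

Lemma is_derive_eps (f : R -> R) (x l : R) :
  is_derive f x l <->
  (forall e, 0 < e -> exists d, 0 < d /\ forall y, Rabs (y - x) < d ->
    Rabs (f y - f x - l * (y - x)) <= e * Rabs (y - x)).
Proof.
  split.
  - intros [_ H] e He.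
    destruct (H x (fun P H => H) (mkposreal e He)) as [d Hd].
    exists d. split; [apply cond_pos|]. intros y Hy.
    specialize (Hd y Hy). unfold norm, minus, plus, opp, scal in Hd; simpl in Hd.
    unfold abs, mult in Hd; simpl in Hd.
    replace (f y - f x - l * (y - x)) with (f y + - f x + - ((y + - x) * l)) by ring.
    exact Hd.
  - intros H. split; [apply is_linear_scal_l|].
    intros z Hz [e He].
    assert (Ez : x = z) by (apply (is_filter_lim_locally_unique (V := AbsRing_NormedModule R_AbsRing)); exact Hz).
    subst z.
    destruct (H e He) as [d [Hd H']]. exists (mkposreal d Hd). intros y Hy.
    unfold norm, minus, plus, opp, scal; simpl. unfold abs, mult; simpl.
    replace (f y + - f x + - ((y + - x) * l)) with (f y - f x - l * (y - x)) by ring.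
    apply H'. exact Hy.
Qed.

Lemma is_derive_Cdiff (f : C -> C) (z l : C) :
  @is_derive C_AbsRing C_NormedModule f z l -> Cdiff f z l.
Proof.
  intros [_ H] e He.
  destruct (H z (fun P H => H) (mkposreal e He)) as [d Hd].
  exists d. split; [apply cond_pos|]. intros y Hy.
  specialize (Hd y Hy).
  replace (f y - f z - l * (y - z))%C with (f y + - f z + - ((y + - z) * l))%C by ring.
  exact Hd.
Qed.

(** The componentwise form feeds the real integration lemmas, the modulus form is the one that
    composes with [Cdiff]. *)
Lemma cder_eps (f : R -> C) (x : R) (l : C) :
  cder f x l <->
  (forall e, 0 < e -> exists d, 0 < d /\ forall y, Rabs (y - x) < d ->
    Cmod (f y - f x - l * RtoC (y - x))%C <= e * Rabs (y - x)).
Proof.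
  assert (R1 : forall y, Re (f y - f x - l * RtoC (y - x))%C = Re (f y) - Re (f x) - Re l * (y - x)).
  { intros y. destruct (f y), (f x), l; simpl. ring. }
  assert (I1 : forall y, Im (f y - f x - l * RtoC (y - x))%C = Im (f y) - Im (f x) - Im l * (y - x)).
  { intros y. destruct (f y), (f x), l; simpl. ring. }
  unfold cder. rewrite !is_derive_eps. split.
  - intros [H1 H2] e He.
    destruct (H1 (e / 2)) as [d1 [P1 Q1]]; [lra|].
    destruct (H2 (e / 2)) as [d2 [P2 Q2]]; [lra|].
    exists (Rmin d1 d2). split; [apply Rmin_pos; assumption|]. intros y Hy.
    eapply Rle_trans; [apply Cmod_le_abs|]. rewrite R1, I1.
    pose proof (Q1 y (Rlt_le_trans _ _ _ Hy (Rmin_l _ _))).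
    pose proof (Q2 y (Rlt_le_trans _ _ _ Hy (Rmin_r _ _))). lra.
  - intros H. split; intros e He; destruct (H e He) as [d [Hd H']]; exists d; (split; [assumption|]);
    intros y Hy; (eapply Rle_trans; [|apply (H' y Hy)]).
    + rewrite <- R1. apply Re_le_Cmod.
    + rewrite <- I1. apply Im_le_Cmod.
Qed.

Lemma continuous_eps (f : R -> R) (x : R) :
  continuous f x <->
  (forall e, 0 < e -> exists d, 0 < d /\ forall y, Rabs (y - x) < d -> Rabs (f y - f x) < e).
Proof.
  unfold continuous. rewrite filterlim_locally. split.
  - intros H e He. destruct (H (mkposreal e He)) as [d Hd].
    exists d; split; [apply cond_pos|]. intros y Hy. apply (Hd y Hy).
  - intros H [e He]. destruct (H e He) as [d [Hd H']]. exists (mkposreal d Hd).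
    intros y Hy. apply (H' y Hy).
Qed.

Lemma ccont_eps (f : R -> C) (x : R) :
  ccont f x <->
  (forall e, 0 < e -> exists d, 0 < d /\ forall y, Rabs (y - x) < d -> Cmod (f y - f x)%C < e).
Proof.
  unfold ccont. rewrite !continuous_eps. split.
  - intros [H1 H2] e He.
    destruct (H1 (e / 2)) as [d1 [P1 Q1]]; [lra|].
    destruct (H2 (e / 2)) as [d2 [P2 Q2]]; [lra|].
    exists (Rmin d1 d2). split; [apply Rmin_pos; assumption|]. intros y Hy.
    eapply Rle_lt_trans; [apply Cmod_le_abs|].
    pose proof (Q1 y (Rlt_le_trans _ _ _ Hy (Rmin_l _ _))).
    pose proof (Q2 y (Rlt_le_trans _ _ _ Hy (Rmin_r _ _))).
    unfold Rminus in *. simpl (Re _). simpl (Im _). unfold Re, Im in *. lra.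
  - intros H. split; intros e He; destruct (H e He) as [d [Hd H']]; exists d; (split; [assumption|]);
    intros y Hy; (eapply Rle_lt_trans; [|apply (H' y Hy)]).
    + apply (Re_le_Cmod (f y - f x)).
    + apply (Im_le_Cmod (f y - f x)).
Qed.

Lemma cder_ccont (f : R -> C) (x : R) (l : C) : cder f x l -> ccont f x.
Proof.
  intros [H1 H2]; split; apply (ex_derive_continuous (V := R_NormedModule));
  [exists (Re l) | exists (Im l)]; assumption.
Qed.

Definition Ccont (f : C -> C) (z : C) : Prop :=
  forall e, 0 < e -> exists d, 0 < d /\ forall y, Cmod (y - z)%C < d -> Cmod (f y - f z)%C < e.

Lemma Cdiff_Ccont (f : C -> C) (z l : C) : Cdiff f z l -> Ccont f z.
Proof.
  intros H e He. destruct (H 1 Rlt_0_1) as [d [Hd H']].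
  set (M := 1 + Cmod l). assert (HM : 0 < M) by (unfold M; pose proof (Cmod_ge_0 l); lra).
  exists (Rmin d (e / M)). split.
  - apply Rmin_pos; [assumption|]. apply Rdiv_lt_0_compat; assumption.
  - intros y Hy. pose proof (H' y (Rlt_le_trans _ _ _ Hy (Rmin_l _ _))) as K.
    pose proof (Rlt_le_trans _ _ _ Hy (Rmin_r _ _)) as K2.
    replace (f y - f z)%C with ((f y - f z - l * (y - z)) + l * (y - z))%C by ring.
    eapply Rle_lt_trans; [apply Cmod_triangle|]. rewrite Cmod_mult.
    apply Rle_lt_trans with (M * Cmod (y - z)%C); [unfold M; lra|].
    apply Rmult_lt_compat_l with (r := M) in K2; [|assumption].
    replace (M * (e / M)) with e in K2 by (field; lra). exact K2.
Qed.

Lemma ccont_comp (k : C -> C) (g : R -> C) (t : R) :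
  Ccont k (g t) -> ccont g t -> ccont (fun u => k (g u)) t.
Proof.
  rewrite !ccont_eps. intros Hk Hg e He.
  destruct (Hk e He) as [d [Hd H1]]. destruct (Hg d Hd) as [d' [Hd' H2]].
  exists d'. split; [assumption|]. intros y Hy. apply H1, H2, Hy.
Qed.

Lemma cder_comp (k : C -> C) (g : R -> C) (t : R) (l dg : C) :
  Cdiff k (g t) l -> cder g t dg -> cder (fun u => k (g u)) t (l * dg)%C.
Proof.
  intros Hk Hg. rewrite cder_eps in *. intros e He.
  destruct (Hg 1 Rlt_0_1) as [d0 [Hd0 H0]].
  set (M := 1 + Cmod dg). assert (HM : 0 < M) by (unfold M; pose proof (Cmod_ge_0 dg); lra).
  assert (Hl := Cmod_ge_0 l).
  destruct (Hk (e / (2 * M))) as [d1 [Hd1 H1]].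
  { apply Rdiv_lt_0_compat; lra. }
  destruct (Hg (e / (2 * (1 + Cmod l)))) as [d2 [Hd2 H2]].
  { apply Rdiv_lt_0_compat; lra. }
  exists (Rmin (Rmin d0 d2) (d1 / M)). split.
  { repeat apply Rmin_pos; try assumption. apply Rdiv_lt_0_compat; assumption. }
  intros y Hy.
  assert (Y0 : Rabs (y - t) < d0).
  { eapply Rlt_le_trans; [apply Hy|]. eapply Rle_trans; [apply Rmin_l|apply Rmin_l]. }
  assert (Y2 : Rabs (y - t) < d2).
  { eapply Rlt_le_trans; [apply Hy|]. eapply Rle_trans; [apply Rmin_l|apply Rmin_r]. }
  assert (Y1 : Rabs (y - t) < d1 / M).
  { eapply Rlt_le_trans; [apply Hy|apply Rmin_r]. }
  specialize (H0 y Y0). specialize (H2 y Y2).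
  assert (G : Cmod (g y - g t)%C <= M * Rabs (y - t)).
  { replace (g y - g t)%C with ((g y - g t - dg * RtoC (y - t)) + dg * RtoC (y - t))%C by ring.
    eapply Rle_trans; [apply Cmod_triangle|]. rewrite Cmod_mult, Cmod_R. unfold M. lra. }
  assert (G1 : Cmod (g y - g t)%C < d1).
  { eapply Rle_lt_trans; [apply G|]. apply Rmult_lt_compat_l with (r := M) in Y1; [|assumption].
    replace (M * (d1 / M)) with d1 in Y1 by (field; lra). exact Y1. }
  specialize (H1 _ G1).
  replace (k (g y) - k (g t) - l * dg * RtoC (y - t))%C
    with ((k (g y) - k (g t) - l * (g y - g t)) + l * (g y - g t - dg * RtoC (y - t)))%C by ring.
  eapply Rle_trans; [apply Cmod_triangle|]. rewrite Cmod_mult.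
  pose proof (Rabs_pos (y - t)) as Hp.
  assert (E1 : e / (2 * M) * Cmod (g y - g t)%C <= e / 2 * Rabs (y - t)).
  { apply Rmult_le_compat_l with (r := e / (2 * M)) in G; [|apply Rlt_le, Rdiv_lt_0_compat; lra].
    replace (e / 2 * Rabs (y - t)) with (e / (2 * M) * (M * Rabs (y - t))) by (field; lra). exact G. }
  assert (E2 : Cmod l * Cmod (g y - g t - dg * RtoC (y - t))%C <= e / 2 * Rabs (y - t)).
  { apply Rle_trans with ((1 + Cmod l) * (e / (2 * (1 + Cmod l)) * Rabs (y - t))).
    - apply Rmult_le_compat; try apply Cmod_ge_0; lra.
    - right. field. lra. }
  lra.
Qed.

Lemma cder_unique (f : R -> C) t l1 l2 : cder f t l1 -> cder f t l2 -> l1 = l2.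
Proof.
  intros [A1 B1] [A2 B2].
  rewrite (surjective_pairing l1), (surjective_pairing l2). f_equal.
  - apply is_derive_unique in A1. apply is_derive_unique in A2. unfold Re in *. congruence.
  - apply is_derive_unique in B1. apply is_derive_unique in B2. unfold Im in *. congruence.
Qed.

Lemma cder_ext_loc (f g : R -> C) t l :
  locally t (fun u => f u = g u) -> cder f t l -> cder g t l.
Proof.
  intros H [A B]. split; (eapply is_derive_ext_loc; [|eassumption]);
  (eapply filter_imp; [|exact H]); intros u Hu; cbv beta in *; now rewrite Hu.
Qed.

Lemma cder_ext (f g : R -> C) t l : (forall u, f u = g u) -> cder f t l -> cder g t l.
Proof. intros H. apply cder_ext_loc. apply filter_forall. exact H. Qed.

Lemma cder_eq (f : R -> C) t l l' : cder f t l -> l = l' -> cder f t l'.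
Proof. now intros H <-. Qed.

Lemma cder_const (c : C) t : cder (fun _ => c) t 0.
Proof. split; apply @is_derive_const. Qed.

Lemma cder_plus f g t lf lg : cder f t lf -> cder g t lg -> cder (fun u => f u + g u)%C t (lf + lg)%C.
Proof. intros [A B] [A' B']. split; simpl; apply (@is_derive_plus R_AbsRing R_NormedModule); assumption. Qed.

Lemma cder_minus f g t lf lg : cder f t lf -> cder g t lg -> cder (fun u => f u - g u)%C t (lf - lg)%C.
Proof. intros [A B] [A' B']. split; simpl; apply (@is_derive_minus R_AbsRing R_NormedModule); assumption. Qed.

Lemma cder_mult f g t lf lg :
  cder f t lf -> cder g t lg -> cder (fun u => f u * g u)%C t (lf * g t + f t * lg)%C.
Proof.
  intros [A B] [A' B']. split; simpl.
  - replace (fst lf * fst (g t) - snd lf * snd (g t) + (fst (f t) * fst lg - snd (f t) * snd lg))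
     with ((fst lf * fst (g t) + fst (f t) * fst lg) - (snd lf * snd (g t) + snd (f t) * snd lg)) by ring.
    apply (@is_derive_minus R_AbsRing R_NormedModule).
    + apply (is_derive_mult (fun u => Re (f u)) (fun u => Re (g u))); try assumption. apply Rmult_comm.
    + apply (is_derive_mult (fun u => Im (f u)) (fun u => Im (g u))); try assumption. apply Rmult_comm.
  - replace (fst lf * snd (g t) + snd lf * fst (g t) + (fst (f t) * snd lg + snd (f t) * fst lg))
     with ((fst lf * snd (g t) + fst (f t) * snd lg) + (snd lf * fst (g t) + snd (f t) * fst lg)) by ring.
    apply (@is_derive_plus R_AbsRing R_NormedModule).
    + apply (is_derive_mult (fun u => Re (f u)) (fun u => Im (g u))); try assumption. apply Rmult_comm.
    + apply (is_derive_mult (fun u => Im (f u)) (fun u => Re (g u))); try assumption. apply Rmult_comm.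
Qed.

Lemma cder_scal c f t l : cder f t l -> cder (fun u => c * f u)%C t (c * l)%C.
Proof. intros H. eapply cder_eq; [apply cder_mult; [apply cder_const|exact H]|]. cbv beta. ring. Qed.

Lemma cder_RtoC f t l : is_derive f t l -> cder (fun u => RtoC (f u)) t (RtoC l).
Proof. intros H. split; simpl; [exact H|apply @is_derive_const]. Qed.

Lemma ccont_const c t : ccont (fun _ => c) t.
Proof. eapply cder_ccont, cder_const. Qed.

Lemma ccont_plus f g t : ccont f t -> ccont g t -> ccont (fun u => f u + g u)%C t.
Proof. intros [A B] [A' B']. split; simpl; apply (@continuous_plus _ R_AbsRing R_NormedModule); assumption. Qed.

Lemma ccont_minus f g t : ccont f t -> ccont g t -> ccont (fun u => f u - g u)%C t.
Proof. intros [A B] [A' B']. split; simpl; apply (@continuous_minus _ R_AbsRing R_NormedModule); assumption. Qed.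

Lemma ccont_mult f g t : ccont f t -> ccont g t -> ccont (fun u => f u * g u)%C t.
Proof.
  intros [A B] [A' B']. split; simpl.
  - apply (@continuous_minus _ R_AbsRing R_NormedModule); apply (@continuous_mult _ R_AbsRing); assumption.
  - apply (@continuous_plus _ R_AbsRing R_NormedModule); apply (@continuous_mult _ R_AbsRing); assumption.
Qed.

Lemma ccont_RtoC f t : continuous f t -> ccont (fun u => RtoC (f u)) t.
Proof. intros H. split; simpl; [exact H|apply continuous_const]. Qed.

Lemma CI_unique f a b l1 l2 : CI f a b l1 -> CI f a b l2 -> l1 = l2.
Proof.
  intros H1 H2.
  rewrite <- (@is_RInt_unique C_R_CompleteNormedModule f a b l1 H1).
  apply (@is_RInt_unique C_R_CompleteNormedModule f a b l2 H2).
Qed.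

Lemma CI_pair f a b l :
  is_RInt (fun t => Re (f t)) a b (Re l) -> is_RInt (fun t => Im (f t)) a b (Im l) -> CI f a b l.
Proof.
  intros H1 H2. unfold CI. rewrite (surjective_pairing l).
  apply (@is_RInt_fct_extend_pair R_NormedModule R_NormedModule f a b (fst l) (snd l)); assumption.
Qed.

Lemma CI_Re f a b l : CI f a b l -> is_RInt (fun t => Re (f t)) a b (Re l).
Proof. apply (@is_RInt_fct_extend_fst R_NormedModule R_NormedModule). Qed.

Lemma CI_Im f a b l : CI f a b l -> is_RInt (fun t => Im (f t)) a b (Im l).
Proof. apply (@is_RInt_fct_extend_snd R_NormedModule R_NormedModule). Qed.

Lemma CI_ex f a b : (forall t, Rmin a b <= t <= Rmax a b -> ccont f t) -> exists l, CI f a b l.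
Proof.
  intros H.
  destruct (@ex_RInt_continuous R_CompleteNormedModule (fun t => Re (f t)) a b) as [u Hu].
  { intros t Ht. apply (H t Ht). }
  destruct (@ex_RInt_continuous R_CompleteNormedModule (fun t => Im (f t)) a b) as [v Hv].
  { intros t Ht. apply (H t Ht). }
  exists (u, v). apply CI_pair; assumption.
Qed.

Lemma CI_FTC F f a b :
  (forall t, Rmin a b <= t <= Rmax a b -> cder F t (f t)) ->
  (forall t, Rmin a b <= t <= Rmax a b -> ccont f t) ->
  CI f a b (F b - F a)%C.
Proof.
  intros H1 H2. apply CI_pair.
  - apply (@is_RInt_derive R_CompleteNormedModule (fun t => Re (F t)) (fun t => Re (f t))).
    + intros t Ht. apply (H1 t Ht).
    + intros t Ht. apply (H2 t Ht).
  - apply (@is_RInt_derive R_CompleteNormedModule (fun t => Im (F t)) (fun t => Im (f t))).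
    + intros t Ht. apply (H1 t Ht).
    + intros t Ht. apply (H2 t Ht).
Qed.

Lemma CI_ext f g a b l :
  (forall t, Rmin a b < t < Rmax a b -> f t = g t) -> CI f a b l -> CI g a b l.
Proof. apply (@is_RInt_ext C_R_NormedModule). Qed.

Lemma CI_plus f g a b l m : CI f a b l -> CI g a b m -> CI (fun t => f t + g t)%C a b (l + m)%C.
Proof. apply (@is_RInt_plus C_R_NormedModule). Qed.

Lemma CI_minus f g a b l m : CI f a b l -> CI g a b m -> CI (fun t => f t - g t)%C a b (l - m)%C.
Proof. apply (@is_RInt_minus C_R_NormedModule). Qed.

Lemma CI_scal c f a b l : CI f a b l -> CI (fun t => c * f t)%C a b (c * l)%C.
Proof.
  intros H. pose proof (CI_Re _ _ _ _ H) as H1. pose proof (CI_Im _ _ _ _ H) as H2.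
  apply CI_pair; simpl.
  - apply (@is_RInt_minus R_NormedModule); apply (@is_RInt_scal R_NormedModule); assumption.
  - apply (@is_RInt_plus R_NormedModule); apply (@is_RInt_scal R_NormedModule); assumption.
Qed.

Lemma CI_Chasles f a b c l m : CI f a b l -> CI f b c m -> CI f a c (l + m)%C.
Proof. apply (@is_RInt_Chasles C_R_NormedModule). Qed.

Lemma CI_const c a b : CI (fun _ => c) a b (RtoC (b - a) * c)%C.
Proof.
  apply CI_pair.
  - replace (Re (RtoC (b - a) * c)%C) with (scal (b - a) (Re c)).
    + apply @is_RInt_const.
    + destruct c; unfold scal; simpl; unfold mult; simpl; ring.
  - replace (Im (RtoC (b - a) * c)%C) with (scal (b - a) (Im c)).
    + apply @is_RInt_const.
    + destruct c; unfold scal; simpl; unfold mult; simpl; ring.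
Qed.

(** The product norm on pairs is Euclidean, so integral estimates in the real module of complex
    numbers lose no constant. *)
Lemma C_R_norm (z : C) : @norm R_AbsRing C_R_NormedModule z = Cmod z.
Proof.
  unfold norm, Cmod; simpl. unfold prod_norm, norm; simpl. unfold abs; simpl.
  rewrite !Rmult_1_r. f_equal.
  pose proof (pow2_abs (fst z)); pose proof (pow2_abs (snd z)). simpl in *. lra.
Qed.

Lemma CI_bound f g a b l m : a <= b ->
  (forall t, a <= t <= b -> Cmod (f t) <= g t) -> CI f a b l -> is_RInt g a b m -> Cmod l <= m.
Proof.
  intros Hab H Hl Hm. rewrite <- C_R_norm.
  apply (@norm_RInt_le C_R_NormedModule f g a b l m Hab); try assumption.
  intros t Ht. rewrite C_R_norm. auto.
Qed.

Lemma CI_bound_const f M a b l : a <= b ->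
  (forall t, a <= t <= b -> Cmod (f t) <= M) -> CI f a b l -> Cmod l <= (b - a) * M.
Proof.
  intros Hab H Hl. rewrite <- C_R_norm.
  apply (@norm_RInt_le_const C_R_NormedModule f a b l M Hab); try assumption.
  intros t Ht. rewrite C_R_norm. auto.
Qed.

Lemma CI_bound_derive f H g a b l : a <= b ->
  (forall t, a <= t <= b -> Cmod (f t) <= g t) ->
  (forall t, a <= t <= b -> is_derive H t (g t) /\ continuous g t) ->
  CI f a b l -> Cmod l <= H b - H a.
Proof.
  intros Hab Hf Hg Hl. eapply CI_bound; [exact Hab|exact Hf|exact Hl|].
  apply (@is_RInt_derive R_CompleteNormedModule); rewrite Rmin_left, Rmax_right by assumption;
  intros t Ht; apply Hg; assumption.
Qed.

(** * Goursat's theorem *)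

Lemma nested_intervals (u v : nat -> R) :
  (forall n, u n <= u (S n)) -> (forall n, v (S n) <= v n) -> (forall n, u n <= v n) ->
  exists l, forall n, u n <= l <= v n.
Proof.
  intros Hu Hv Huv.
  assert (Mu : forall n m, (n <= m)%nat -> u n <= u m).
  { intros n m H. induction H; [lra|]. specialize (Hu m). lra. }
  assert (Mv : forall n m, (n <= m)%nat -> v m <= v n).
  { intros n m H. induction H; [lra|]. specialize (Hv m). lra. }
  assert (Muv : forall n m, u n <= v m).
  { intros n m. apply Rle_trans with (u (max n m)); [apply Mu; lia|].
    apply Rle_trans with (v (max n m)); [apply Huv|apply Mv; lia]. }
  destruct (completeness (fun x => exists n, x = u n)) as [l [H1 H2]].
  - exists (v 0%nat). intros x [n ->]. apply Muv.
  - exists (u 0%nat), 0%nat. reflexivity.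
  - exists l. intros n. split.
    + apply H1. now exists n.
    + apply H2. intros x [m ->]. apply Muv.
Qed.

(** Mean value inequality: complex values admit no intermediate point, so the derivative is
    integrated. With [L = 0] it proves constancy. *)
Lemma curve_lipschitz g dg a b L : a <= b ->
  (forall t, a <= t <= b -> cder g t (dg t)) -> (forall t, a <= t <= b -> ccont dg t) ->
  (forall t, a <= t <= b -> Cmod (dg t) <= L) -> Cmod (g b - g a)%C <= (b - a) * L.
Proof.
  intros Hab H1 H2 H3. eapply CI_bound_const; [exact Hab|exact H3|].
  apply CI_FTC; rewrite Rmin_left, Rmax_right by assumption; assumption.
Qed.

Lemma curve_lipschitz_abs g dg a b L u v :
  (forall t, a <= t <= b -> cder g t (dg t)) -> (forall t, a <= t <= b -> ccont dg t) ->
  (forall t, a <= t <= b -> Cmod (dg t) <= L) -> a <= u <= b -> a <= v <= b ->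
  Cmod (g v - g u)%C <= L * Rabs (v - u).
Proof.
  intros H1 H2 H3 Hu Hv. destruct (Rle_dec u v) as [H|H].
  - rewrite Rabs_pos_eq by lra. rewrite Rmult_comm.
    apply curve_lipschitz with dg; [lra|..]; intros t Ht; [apply H1|apply H2|apply H3]; lra.
  - rewrite Rabs_left1 by lra. rewrite Cmod_sub_sym, Rmult_comm.
    replace (- (v - u)) with (u - v) by ring.
    apply curve_lipschitz with dg; [lra|..]; intros t Ht; [apply H1|apply H2|apply H3]; lra.
Qed.

Lemma C_half_half (z : C) : (z / 2 + z / 2)%C = z.
Proof. destruct z; apply injective_projections; simpl; field. Qed.

(** The affine approximation of [k] at [p] has the primitive [P], so along one side only the
    approximation error contributes beyond a difference of values of [P]. These differences cancel
    around a closed rectangle. *)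
Lemma edge_estimate k g dg a b p k0 k1 e D L l :
  a <= b -> 0 <= e -> 0 <= L ->
  (forall t, a <= t <= b -> cder g t (dg t)) -> (forall t, a <= t <= b -> ccont dg t) ->
  (forall t, a <= t <= b -> Cmod (dg t) <= L) ->
  (forall t, a <= t <= b -> Cmod (g t - p)%C <= D) ->
  (forall t, a <= t <= b -> Cmod (k (g t) - k0 - k1 * (g t - p))%C <= e * Cmod (g t - p)%C) ->
  CI (fun t => k (g t) * dg t)%C a b l ->
  let P := fun x : C => (k0 * x + k1 * ((x - p) * (x - p)) / 2)%C in
  Cmod (l - (P (g b) - P (g a)))%C <= (b - a) * (e * D * L).
Proof.
  intros Hab He HL H1 H2 H3 H4 H5 Hl P.
  assert (Q : CI (fun t => (k0 + k1 * (g t - p)) * dg t)%C a b (P (g b) - P (g a))%C).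
  { apply (CI_FTC (fun t => P (g t))); rewrite Rmin_left, Rmax_right by assumption; intros t Ht.
    - assert (Z : cder (fun u => g u - p)%C t (dg t)).
      { eapply cder_eq; [apply cder_minus; [apply (H1 t Ht)|apply cder_const]|ring]. }
      unfold P. eapply cder_eq; [eapply cder_ext|].
      2: { apply cder_plus; [apply (cder_scal k0), (H1 t Ht)|].
           apply (cder_scal (k1 / 2)%C). apply cder_mult; apply Z. }
      + intros u. cbv beta. field.
      + cbv beta. transitivity ((k0 + (k1 / 2 + k1 / 2) * (g t - p)) * dg t)%C; [ring|]. now rewrite C_half_half.
    - assert (Z := cder_ccont _ _ _ (H1 t Ht)).
      apply ccont_mult; [|apply (H2 t Ht)]. apply ccont_plus; [apply ccont_const|].
      apply ccont_mult; [apply ccont_const|]. apply ccont_minus; [apply Z|apply ccont_const]. }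
  pose proof (CI_minus _ _ _ _ _ _ Hl Q) as K.
  eapply CI_bound_const; [exact Hab| |exact K].
  intros t Ht. cbv beta.
  replace (k (g t) * dg t - (k0 + k1 * (g t - p)) * dg t)%C
    with ((k (g t) - k0 - k1 * (g t - p)) * dg t)%C by ring.
  rewrite Cmod_mult. apply Rmult_le_compat; try apply Cmod_ge_0; [|apply (H3 t Ht)].
  eapply Rle_trans; [apply (H5 t Ht)|]. apply Rmult_le_compat_l; [assumption|apply (H4 t Ht)].
Qed.

Section Goursat.

Variables (h hx hy : R -> R -> C) (k : C -> C) (a b c d L : R).
Hypothesis Hab : a <= b.
Hypothesis Hcd : c <= d.
Hypothesis dhx : forall x y, a <= x <= b -> c <= y <= d -> cder (fun u => h u y) x (hx x y).
Hypothesis dhy : forall x y, a <= x <= b -> c <= y <= d -> cder (fun u => h x u) y (hy x y).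
Hypothesis chx : forall x y, a <= x <= b -> c <= y <= d -> ccont (fun u => hx u y) x.
Hypothesis chy : forall x y, a <= x <= b -> c <= y <= d -> ccont (fun u => hy x u) y.
Hypothesis bhx : forall x y, a <= x <= b -> c <= y <= d -> Cmod (hx x y) <= L.
Hypothesis bhy : forall x y, a <= x <= b -> c <= y <= d -> Cmod (hy x y) <= L.
Hypothesis holk : forall x y, a <= x <= b -> c <= y <= d -> exists l, Cdiff k (h x y) l.

Let IX (x1 x2 y : R) : C := @RInt C_R_CompleteNormedModule (fun x => k (h x y) * hx x y)%C x1 x2.
Let IY (x y1 y2 : R) : C := @RInt C_R_CompleteNormedModule (fun y => k (h x y) * hy x y)%C y1 y2.

Let IX_correct x1 x2 y : a <= x1 -> x1 <= x2 -> x2 <= b -> c <= y <= d ->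
  CI (fun x => k (h x y) * hx x y)%C x1 x2 (IX x1 x2 y).
Proof.
  intros H1 H2 H3 Hy. apply (@RInt_correct C_R_CompleteNormedModule).
  destruct (CI_ex (fun x => k (h x y) * hx x y)%C x1 x2) as [l Hl]; [|now exists l].
  rewrite Rmin_left, Rmax_right by assumption. intros t Ht.
  assert (T : a <= t <= b) by lra.
  apply ccont_mult; [|apply chx; assumption].
  destruct (holk t y T Hy) as [l Hl].
  apply (ccont_comp k (fun x => h x y)); [apply (Cdiff_Ccont _ _ _ Hl)|].
  apply (cder_ccont _ _ _ (dhx t y T Hy)).
Qed.

Let IY_correct x y1 y2 : c <= y1 -> y1 <= y2 -> y2 <= d -> a <= x <= b ->
  CI (fun y => k (h x y) * hy x y)%C y1 y2 (IY x y1 y2).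
Proof.
  intros H1 H2 H3 Hx. apply (@RInt_correct C_R_CompleteNormedModule).
  destruct (CI_ex (fun y => k (h x y) * hy x y)%C y1 y2) as [l Hl]; [|now exists l].
  rewrite Rmin_left, Rmax_right by assumption. intros t Ht.
  assert (T : c <= t <= d) by lra.
  apply ccont_mult; [|apply chy; assumption].
  destruct (holk x t Hx T) as [l Hl].
  apply (ccont_comp k (fun y => h x y)); [apply (Cdiff_Ccont _ _ _ Hl)|].
  apply (cder_ccont _ _ _ (dhy x t Hx T)).
Qed.

(** Integral of [k] along the image of the boundary, counterclockwise in the parameters: bottom and
    right, then top and left reversed. *)
Let Q (x1 x2 y1 y2 : R) : C := (IX x1 x2 y1 + IY x2 y1 y2 - IX x1 x2 y2 - IY x1 y1 y2)%C.

Let IX_Chasles x1 x2 x3 y : a <= x1 -> x1 <= x2 -> x2 <= x3 -> x3 <= b -> c <= y <= d ->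
  IX x1 x3 y = (IX x1 x2 y + IX x2 x3 y)%C.
Proof.
  intros. eapply CI_unique; [apply IX_correct; lra|].
  eapply CI_Chasles; apply IX_correct; lra.
Qed.

Let IY_Chasles x y1 y2 y3 : c <= y1 -> y1 <= y2 -> y2 <= y3 -> y3 <= d -> a <= x <= b ->
  IY x y1 y3 = (IY x y1 y2 + IY x y2 y3)%C.
Proof.
  intros. eapply CI_unique; [apply IY_correct; lra|].
  eapply CI_Chasles; apply IY_correct; lra.
Qed.

(** Lower left corner of a quarter rectangle that carries at least a quarter of the modulus of the
    boundary integral. *)
Let step (s : R * R) (w v : R) : R * R :=
  let (x, y) := s in
  let q := Cmod (Q x (x + w) y (y + v)) in
  if Rle_dec q (4 * Cmod (Q x (x + w / 2) y (y + v / 2))) then (x, y)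
  else if Rle_dec q (4 * Cmod (Q (x + w / 2) (x + w / 2 + w / 2) y (y + v / 2))) then (x + w / 2, y)
  else if Rle_dec q (4 * Cmod (Q x (x + w / 2) (y + v / 2) (y + v / 2 + v / 2))) then (x, y + v / 2)
  else (x + w / 2, y + v / 2).

Let step_spec x y w v : 0 <= w -> 0 <= v -> a <= x -> x + w <= b -> c <= y -> y + v <= d ->
  let (x', y') := step (x, y) w v in
  x <= x' /\ x' + w / 2 <= x + w /\ y <= y' /\ y' + v / 2 <= y + v /\
  Cmod (Q x (x + w) y (y + v)) <= 4 * Cmod (Q x' (x' + w / 2) y' (y' + v / 2)).
Proof.
  intros Hw Hv H1 H2 H3 H4. unfold step.
  destruct Rle_dec as [E1|E1]; [repeat split; lra|].
  destruct Rle_dec as [E2|E2]; [repeat split; lra|].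
  destruct Rle_dec as [E3|E3]; [repeat split; lra|].
  repeat split; try lra.
  (* The inner sides cancel, so the four quarters add up to the whole. If the first three each carry
     less than a quarter of the modulus, the fourth carries more. *)
  assert (E : Q x (x + w) y (y + v) =
    (Q x (x + w / 2) y (y + v / 2) + Q (x + w / 2) (x + w / 2 + w / 2) y (y + v / 2)
     + Q x (x + w / 2) (y + v / 2) (y + v / 2 + v / 2)
     + Q (x + w / 2) (x + w / 2 + w / 2) (y + v / 2) (y + v / 2 + v / 2))%C).
  { unfold Q. replace (x + w / 2 + w / 2) with (x + w) by field.
    replace (y + v / 2 + v / 2) with (y + v) by field.
    rewrite (IX_Chasles x (x + w / 2) (x + w) y), (IX_Chasles x (x + w / 2) (x + w) (y + v)) by lra.
    rewrite (IY_Chasles x y (y + v / 2) (y + v)), (IY_Chasles (x + w) y (y + v / 2) (y + v)) by lra.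
    ring. }
  rewrite E in *.
  pose proof (Cmod_triangle (Q x (x + w / 2) y (y + v / 2) + Q (x + w / 2) (x + w / 2 + w / 2) y (y + v / 2)
     + Q x (x + w / 2) (y + v / 2) (y + v / 2 + v / 2)) (Q (x + w / 2) (x + w / 2 + w / 2) (y + v / 2) (y + v / 2 + v / 2))).
  pose proof (Cmod_triangle (Q x (x + w / 2) y (y + v / 2) + Q (x + w / 2) (x + w / 2 + w / 2) y (y + v / 2))
     (Q x (x + w / 2) (y + v / 2) (y + v / 2 + v / 2))).
  pose proof (Cmod_triangle (Q x (x + w / 2) y (y + v / 2)) (Q (x + w / 2) (x + w / 2 + w / 2) y (y + v / 2))).
  lra.
Qed.

Let W := b - a.
Let V := d - c.

(** Corners of the nested rectangles of the bisection; level [n] has sides [W / 2^n] and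
    [V / 2^n]. *)
Let pt : nat -> R * R :=
  fix pt n := match n with O => (a, c) | S m => step (pt m) (W / 2 ^ m) (V / 2 ^ m) end.

Let pt_spec n :
  a <= fst (pt n) /\ fst (pt n) + W / 2 ^ n <= b /\ c <= snd (pt n) /\ snd (pt n) + V / 2 ^ n <= d
  /\ Cmod (Q a b c d) <= 4 ^ n * Cmod (Q (fst (pt n)) (fst (pt n) + W / 2 ^ n) (snd (pt n)) (snd (pt n) + V / 2 ^ n)).
Proof.
  assert (HW : forall n, 0 <= W / 2 ^ n).
  { intros m. apply Rdiv_le_0_compat; [unfold W; lra|apply pow_lt; lra]. }
  assert (HV : forall n, 0 <= V / 2 ^ n).
  { intros m. apply Rdiv_le_0_compat; [unfold V; lra|apply pow_lt; lra]. }
  induction n as [|n IH].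
  - simpl. unfold W, V. repeat split; try lra.
    replace (a + (b - a) / 1) with b by field. replace (c + (d - c) / 1) with d by field. lra.
  - destruct IH as (I1 & I2 & I3 & I4 & I5).
    assert (Hd : forall m X, X / 2 ^ S m = X / 2 ^ m / 2).
    { intros m X. simpl. field. apply pow_nonzero; lra. }
    rewrite !Hd.
    change (pt (S n)) with (step (pt n) (W / 2 ^ n) (V / 2 ^ n)).
    destruct (pt n) as [x y]. cbn [fst snd] in *.
    pose proof (step_spec x y (W / 2 ^ n) (V / 2 ^ n) (HW n) (HV n) I1 I2 I3 I4) as Sp.
    destruct (step (x, y) (W / 2 ^ n) (V / 2 ^ n)) as [x' y'].
    destruct Sp as (S1 & S2 & S3 & S4 & S5). cbn [fst snd].
    repeat split; try lra.
    eapply Rle_trans; [apply I5|]. simpl. rewrite (Rmult_comm 4), Rmult_assoc.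
    apply Rmult_le_compat_l; [apply pow_le; lra|exact S5].
Qed.

Lemma goursat_aux : Q a b c d = 0.
Proof.
  assert (HW : forall n, 0 <= W / 2 ^ n).
  { intros m. apply Rdiv_le_0_compat; [unfold W; lra|apply pow_lt; lra]. }
  assert (HV : forall n, 0 <= V / 2 ^ n).
  { intros m. apply Rdiv_le_0_compat; [unfold V; lra|apply pow_lt; lra]. }
  assert (Hd : forall m X, X / 2 ^ S m = X / 2 ^ m / 2).
  { intros m X. simpl. field. apply pow_nonzero; lra. }
  assert (Sp : forall n, fst (pt n) <= fst (pt (S n)) /\
     fst (pt (S n)) + W / 2 ^ (S n) <= fst (pt n) + W / 2 ^ n /\
     snd (pt n) <= snd (pt (S n)) /\ snd (pt (S n)) + V / 2 ^ (S n) <= snd (pt n) + V / 2 ^ n).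
  { intros n. destruct (pt_spec n) as (I1 & I2 & I3 & I4 & _). rewrite !Hd.
    change (pt (S n)) with (step (pt n) (W / 2 ^ n) (V / 2 ^ n)).
    destruct (pt n) as [x y]. cbn [fst snd] in *.
    pose proof (step_spec x y (W / 2 ^ n) (V / 2 ^ n) (HW n) (HV n) I1 I2 I3 I4) as Sp.
    destruct (step (x, y) (W / 2 ^ n) (V / 2 ^ n)) as [x' y'].
    cbn [fst snd]. tauto. }
  destruct (nested_intervals (fun n => fst (pt n)) (fun n => fst (pt n) + W / 2 ^ n)) as [xs Hxs];
    try (intros n; apply Sp).
  { intros n. specialize (HW n). lra. }
  destruct (nested_intervals (fun n => snd (pt n)) (fun n => snd (pt n) + V / 2 ^ n)) as [ys Hys];
    try (intros n; apply Sp).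
  { intros n. specialize (HV n). lra. }
  assert (Xs : a <= xs <= b).
  { specialize (Hxs 0%nat). simpl in Hxs. unfold W in Hxs. lra. }
  assert (Ys : c <= ys <= d).
  { specialize (Hys 0%nat). simpl in Hys. unfold V in Hys. lra. }
  assert (HL : 0 <= L) by (eapply Rle_trans; [apply Cmod_ge_0|apply (bhx xs ys Xs Ys)]).
  destruct (holk xs ys Xs Ys) as [k1 Hk]. set (p := h xs ys) in *. set (k0 := k p) in *.
  apply Cmod_eq_0. apply Rle_antisym; [|apply Cmod_ge_0].
  apply Rnot_lt_le. intros Hpos.
  (* [L] is a Lipschitz constant of [h] in each variable, so at level [n] the image has diameter at
     most [T / 2^n]. *)
  set (T := L * (W + V)).
  assert (HT : 0 <= T).
  { unfold T, W, V. apply Rmult_le_pos; lra. }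
  set (q := Cmod (Q a b c d)) in *.
  (* Chosen against the final estimate [q <= 2 e T^2], whose right side is then below [q / 2]; the
     [+ 1] covers [T = 0]. *)
  set (e := q / (4 * (T * T + 1))).
  assert (He : 0 < e) by (unfold e; apply Rdiv_lt_0_compat; nra).
  destruct (Hk e He) as [dl [Hdl Hk']].
  assert (exists n, T / 2 ^ n < dl) as [n Hn].
  { destruct (pow_lt_1_zero (1 / 2)) with (y := dl / (T + 1)) as [N HN].
    { rewrite Rabs_pos_eq; lra. }
    { apply Rdiv_lt_0_compat; lra. }
    exists N. specialize (HN N (Nat.le_refl _)).
    rewrite Rabs_pos_eq in HN by (apply pow_le; lra).
    apply Rmult_lt_compat_l with (r := T + 1) in HN; [|lra].
    replace ((T + 1) * (dl / (T + 1))) with dl in HN by (field; lra).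
    eapply Rle_lt_trans; [|apply HN]. unfold Rdiv. rewrite Rmult_1_l, pow_inv.
    apply Rmult_le_compat_r; [|lra]. apply Rlt_le, Rinv_0_lt_compat, pow_lt; lra. }
  destruct (pt_spec n) as (I1 & I2 & I3 & I4 & I5). specialize (Hxs n). specialize (Hys n).
  cbv beta in Hxs, Hys. fold q in I5.
  set (x1 := fst (pt n)) in *. set (y1 := snd (pt n)) in *.
  set (w := W / 2 ^ n) in *. set (v := V / 2 ^ n) in *.
  assert (Hw : 0 <= w) by apply HW. assert (Hv : 0 <= v) by apply HV.
  assert (Dxy : forall x y, x1 <= x <= x1 + w -> y1 <= y <= y1 + v -> Cmod (h x y - p)%C <= L * (w + v)).
  { intros x y Hx Hy. unfold p.
    replace (h x y - h xs ys)%C with ((h x y - h xs y) + (h xs y - h xs ys))%C by ring.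
    eapply Rle_trans; [apply Cmod_triangle|]. rewrite Rmult_plus_distr_l. apply Rplus_le_compat.
    - apply Rle_trans with (L * Rabs (x - xs)).
      + apply (curve_lipschitz_abs (fun u => h u y) (fun u => hx u y) a b); try lra;
        intros t Ht; [apply dhx|apply chx|apply bhx]; lra.
      + apply Rmult_le_compat_l; [assumption|]. apply Rabs_le; lra.
    - apply Rle_trans with (L * Rabs (y - ys)).
      + apply (curve_lipschitz_abs (fun u => h xs u) (fun u => hy xs u) c d); try lra;
        intros t Ht; [apply dhy|apply chy|apply bhy]; lra.
      + apply Rmult_le_compat_l; [assumption|]. apply Rabs_le; lra. }
  assert (Ewv : L * (w + v) = T / 2 ^ n).
  { unfold w, v, T. field. apply pow_nonzero; lra. }
  set (D := L * (w + v)) in *.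
  assert (Kxy : forall x y, x1 <= x <= x1 + w -> y1 <= y <= y1 + v ->
     Cmod (k (h x y) - k0 - k1 * (h x y - p))%C <= e * Cmod (h x y - p)%C).
  { intros x y Hx Hy. apply Hk'. eapply Rle_lt_trans; [apply Dxy; assumption|]. lra. }
  set (P := fun x : C => (k0 * x + k1 * ((x - p) * (x - p)) / 2)%C).
  assert (EX : forall y, y1 <= y <= y1 + v ->
    Cmod (IX x1 (x1 + w) y - (P (h (x1 + w) y) - P (h x1 y)))%C <= w * (e * D * L)).
  { intros y Hy. replace w with (x1 + w - x1) at 3 by ring.
    apply (edge_estimate k (fun x => h x y) (fun x => hx x y) x1 (x1 + w) p k0 k1 e D L); try lra;
    try (intros t Ht; try apply dhx; try apply chx; try apply bhx; try apply Dxy; try apply Kxy; lra).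
    apply IX_correct; lra. }
  assert (EY : forall x, x1 <= x <= x1 + w ->
    Cmod (IY x y1 (y1 + v) - (P (h x (y1 + v)) - P (h x y1)))%C <= v * (e * D * L)).
  { intros x Hx. replace v with (y1 + v - y1) at 3 by ring.
    apply (edge_estimate k (fun y => h x y) (fun y => hy x y) y1 (y1 + v) p k0 k1 e D L); try lra;
    try (intros t Ht; try apply dhy; try apply chy; try apply bhy; try apply Dxy; try apply Kxy; lra).
    apply IY_correct; lra. }
  assert (EQ : Cmod (Q x1 (x1 + w) y1 (y1 + v)) <= 2 * (w + v) * (e * D * L)).
  { unfold Q.
    pose proof (EX y1 ltac:(lra)) as A1. pose proof (EX (y1 + v) ltac:(lra)) as A2.
    pose proof (EY x1 ltac:(lra)) as A3. pose proof (EY (x1 + w) ltac:(lra)) as A4.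
    match type of A1 with Cmod ?t <= _ => set (t1 := t) in * end.
    match type of A2 with Cmod ?t <= _ => set (t2 := t) in * end.
    match type of A3 with Cmod ?t <= _ => set (t3 := t) in * end.
    match type of A4 with Cmod ?t <= _ => set (t4 := t) in * end.
    (* The values of [P] at the four corners cancel, so the boundary integral is a signed sum of the
       four edge errors. *)
    match goal with |- Cmod ?t <= _ => replace t with (((t1 + t4) + - t2) + - t3)%C end.
    2: { unfold t1, t2, t3, t4. ring. }
    pose proof (Cmod_triangle (t1 + t4 + - t2) (- t3)).
    pose proof (Cmod_triangle (t1 + t4) (- t2)). pose proof (Cmod_triangle t1 t4).
    rewrite Cmod_opp in *. lra. }
  (* The factor [4^n] lost by bisection is compensated by the perimeter and the diameter, each
     proportional to [2^(-n)]. *)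
  assert (F : q <= 2 * e * (T * T)).
  { eapply Rle_trans; [apply I5|].
    apply Rle_trans with (4 ^ n * (2 * (w + v) * (e * D * L))).
    - apply Rmult_le_compat_l; [apply pow_le; lra|exact EQ].
    - right. replace (4 ^ n * (2 * (w + v) * (e * D * L))) with (4 ^ n * 2 * e * D * (L * (w + v))) by ring.
      fold D. rewrite Ewv. replace 4 with (2 * 2) by ring. rewrite Rpow_mult_distr.
      field. apply pow_nonzero; lra. }
  assert (G : 4 * (T * T + 1) * e = q) by (unfold e; field; nra).
  nra.
Qed.

End Goursat.

(* The boundary integral is taken over the image under [h] of the boundary of a
   rectangle; [h] need not be injective. *)
Lemma goursat (h hx hy : R -> R -> C) (k : C -> C) (a b c d L : R) (i1 i2 i3 i4 : C) :
  a <= b -> c <= d ->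
  (forall x y, a <= x <= b -> c <= y <= d -> cder (fun u => h u y) x (hx x y)) ->
  (forall x y, a <= x <= b -> c <= y <= d -> cder (fun u => h x u) y (hy x y)) ->
  (forall x y, a <= x <= b -> c <= y <= d -> ccont (fun u => hx u y) x) ->
  (forall x y, a <= x <= b -> c <= y <= d -> ccont (fun u => hy x u) y) ->
  (forall x y, a <= x <= b -> c <= y <= d -> Cmod (hx x y) <= L) ->
  (forall x y, a <= x <= b -> c <= y <= d -> Cmod (hy x y) <= L) ->
  (forall x y, a <= x <= b -> c <= y <= d -> exists l, Cdiff k (h x y) l) ->
  CI (fun x => k (h x c) * hx x c)%C a b i1 ->
  CI (fun y => k (h b y) * hy b y)%C c d i2 ->
  CI (fun x => k (h x d) * hx x d)%C a b i3 ->
  CI (fun y => k (h a y) * hy a y)%C c d i4 ->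
  (i1 + i2)%C = (i3 + i4)%C.
Proof.
  intros Hab Hcd H1 H2 H3 H4 H5 H6 H7 J1 J2 J3 J4.
  pose proof (goursat_aux h hx hy k a b c d L Hab Hcd H1 H2 H3 H4 H5 H6 H7) as G.
  cbv beta zeta in G.
  rewrite (@is_RInt_unique C_R_CompleteNormedModule _ _ _ _ J1) in G.
  rewrite (@is_RInt_unique C_R_CompleteNormedModule _ _ _ _ J2) in G.
  rewrite (@is_RInt_unique C_R_CompleteNormedModule _ _ _ _ J3) in G.
  rewrite (@is_RInt_unique C_R_CompleteNormedModule _ _ _ _ J4) in G.
  replace (i1 + i2)%C with ((i1 + i2 - i3 - i4) + (i3 + i4))%C by ring. rewrite G. ring.
Qed.

(** * Cauchy integrals *)

Lemma Cdiff_quadratic (f : C -> C) (z l : C) (M d : R) : 0 < d ->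
  (forall y, Cmod (y - z)%C < d ->
    Cmod (f y - f z - l * (y - z))%C <= M * (Cmod (y - z)%C * Cmod (y - z)%C)) ->
  Cdiff f z l.
Proof.
  intros Hd H e He. set (N := Rabs M + 1).
  assert (HN : 0 < N) by (unfold N; pose proof (Rabs_pos M); lra).
  exists (Rmin d (e / N)). split; [apply Rmin_pos; [assumption|apply Rdiv_lt_0_compat; assumption]|].
  intros y Hy. pose proof (Rlt_le_trans _ _ _ Hy (Rmin_l _ _)) as Y1.
  pose proof (Rlt_le_trans _ _ _ Hy (Rmin_r _ _)) as Y2.
  eapply Rle_trans; [apply (H y Y1)|]. rewrite <- Rmult_assoc.
  pose proof (Cmod_ge_0 (y - z)%C) as P. apply Rmult_le_compat_r; [assumption|].
  apply Rmult_lt_compat_l with (r := N) in Y2; [|assumption].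
  replace (N * (e / N)) with e in Y2 by (field; lra).
  apply Rle_trans with (N * Cmod (y - z)%C); [|lra]. apply Rmult_le_compat_r; [assumption|].
  unfold N. pose proof (Rle_abs M). lra.
Qed.

(** Restriction to the horizontal line through [z] reduces this to uniqueness of real
    derivatives. *)
Lemma Cdiff_unique (f : C -> C) (z l1 l2 : C) : Cdiff f z l1 -> Cdiff f z l2 -> l1 = l2.
Proof.
  intros H1 H2.
  assert (G : cder (fun t => z + RtoC t)%C 0 1).
  { eapply cder_eq; [apply cder_plus; [apply cder_const|apply (cder_RtoC (fun t => t)), @is_derive_id]|].
    unfold one; simpl. ring. }
  assert (Z : (z + RtoC 0)%C = z) by ring.
  pose proof (cder_comp f (fun t => z + RtoC t)%C 0 l1 1) as K1.
  pose proof (cder_comp f (fun t => z + RtoC t)%C 0 l2 1) as K2.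
  cbv beta in *. rewrite Z in *.
  pose proof (cder_unique _ _ _ _ (K1 H1 G) (K2 H2 G)) as E.
  rewrite !Cmult_1_r in E. exact E.
Qed.

Lemma Cdiff_ext_loc (f g : C -> C) (z l : C) (r : R) : 0 < r ->
  (forall y, Cmod (y - z)%C < r -> f y = g y) -> Cdiff f z l -> Cdiff g z l.
Proof.
  intros Hr H Hf e He. destruct (Hf e He) as [d [Hd K]].
  exists (Rmin d r). split; [apply Rmin_pos; assumption|]. intros y Hy.
  pose proof (Rlt_le_trans _ _ _ Hy (Rmin_l _ _)) as Y1.
  pose proof (Rlt_le_trans _ _ _ Hy (Rmin_r _ _)) as Y2.
  rewrite <- (H y Y2), <- (H z); [apply K, Y1|].
  replace (z - z)%C with (RtoC 0) by ring. rewrite Cmod_0. assumption.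
Qed.

Lemma Cdiff_affine (a b z : C) : Cdiff (fun y => a + b * y)%C z b.
Proof.
  intros e He. exists 1. split; [lra|]. intros y _.
  replace (a + b * y - (a + b * z) - b * (y - z))%C with (RtoC 0) by ring.
  rewrite Cmod_0. apply Rmult_le_pos; [lra|apply Cmod_ge_0].
Qed.

Lemma Cdiff_scal (c : C) (f : C -> C) (z l : C) : Cdiff f z l -> Cdiff (fun y => c * f y)%C z (c * l)%C.
Proof.
  intros H e He. pose proof (Cmod_ge_0 c) as Hc.
  destruct (H (e / (Cmod c + 1))) as [d [Hd K]]; [apply Rdiv_lt_0_compat; lra|].
  exists d. split; [assumption|]. intros y Hy.
  replace (c * f y - c * f z - c * l * (y - z))%C with (c * (f y - f z - l * (y - z)))%C by ring.
  rewrite Cmod_mult. pose proof (Cmod_ge_0 (y - z)%C) as P.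
  apply Rle_trans with ((Cmod c + 1) * (e / (Cmod c + 1) * Cmod (y - z)%C)).
  - apply Rmult_le_compat; try apply Cmod_ge_0; [lra|apply (K y Hy)].
  - right. field. lra.
Qed.

Lemma Cdiff_comp (f g : C -> C) (z l m : C) :
  Cdiff f (g z) l -> Cdiff g z m -> Cdiff (fun y => f (g y)) z (l * m)%C.
Proof.
  intros Hf Hg e He.
  destruct (Hg 1 Rlt_0_1) as [d0 [Hd0 H0]].
  set (M := 1 + Cmod m). assert (HM : 0 < M) by (unfold M; pose proof (Cmod_ge_0 m); lra).
  assert (Hl := Cmod_ge_0 l).
  destruct (Hf (e / (2 * M))) as [d1 [Hd1 H1]].
  { apply Rdiv_lt_0_compat; lra. }
  destruct (Hg (e / (2 * (1 + Cmod l)))) as [d2 [Hd2 H2]].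
  { apply Rdiv_lt_0_compat; lra. }
  exists (Rmin (Rmin d0 d2) (d1 / M)). split.
  { repeat apply Rmin_pos; try assumption. apply Rdiv_lt_0_compat; assumption. }
  intros y Hy.
  assert (Y0 : Cmod (y - z)%C < d0).
  { eapply Rlt_le_trans; [apply Hy|]. eapply Rle_trans; [apply Rmin_l|apply Rmin_l]. }
  assert (Y2 : Cmod (y - z)%C < d2).
  { eapply Rlt_le_trans; [apply Hy|]. eapply Rle_trans; [apply Rmin_l|apply Rmin_r]. }
  assert (Y1 : Cmod (y - z)%C < d1 / M).
  { eapply Rlt_le_trans; [apply Hy|apply Rmin_r]. }
  specialize (H0 y Y0). specialize (H2 y Y2).
  assert (G : Cmod (g y - g z)%C <= M * Cmod (y - z)%C).
  { replace (g y - g z)%C with ((g y - g z - m * (y - z)) + m * (y - z))%C by ring.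
    eapply Rle_trans; [apply Cmod_triangle|]. rewrite Cmod_mult. unfold M. lra. }
  assert (G1 : Cmod (g y - g z)%C < d1).
  { eapply Rle_lt_trans; [apply G|]. apply Rmult_lt_compat_l with (r := M) in Y1; [|assumption].
    replace (M * (d1 / M)) with d1 in Y1 by (field; lra). exact Y1. }
  specialize (H1 _ G1).
  replace (f (g y) - f (g z) - l * m * (y - z))%C
    with ((f (g y) - f (g z) - l * (g y - g z)) + l * (g y - g z - m * (y - z)))%C by ring.
  eapply Rle_trans; [apply Cmod_triangle|]. rewrite Cmod_mult.
  pose proof (Cmod_ge_0 (y - z)%C) as Hp.
  assert (E1 : e / (2 * M) * Cmod (g y - g z)%C <= e / 2 * Cmod (y - z)%C).
  { apply Rmult_le_compat_l with (r := e / (2 * M)) in G; [|apply Rlt_le, Rdiv_lt_0_compat; lra].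
    replace (e / 2 * Cmod (y - z)%C) with (e / (2 * M) * (M * Cmod (y - z)%C)) by (field; lra). exact G. }
  assert (E2 : Cmod l * Cmod (g y - g z - m * (y - z))%C <= e / 2 * Cmod (y - z)%C).
  { apply Rle_trans with ((1 + Cmod l) * (e / (2 * (1 + Cmod l)) * Cmod (y - z)%C)).
    - apply Rmult_le_compat; try apply Cmod_ge_0; lra.
    - right. field. lra. }
  lra.
Qed.

Lemma Cdiff_mult (f g : C -> C) (z l m : C) :
  Cdiff f z l -> Cdiff g z m -> Cdiff (fun y => f y * g y)%C z (l * g z + f z * m)%C.
Proof.
  intros Hf Hg e He.
  pose proof (Cmod_ge_0 (f z)) as Pf. pose proof (Cmod_ge_0 (g z)) as Pg. pose proof (Cmod_ge_0 l) as Pl.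
  set (N := 3 * (Cmod (f z) + Cmod (g z) + Cmod l + 2)).
  assert (HN : 0 < N) by (unfold N; lra).
  assert (Q : 0 < e / N) by (apply Rdiv_lt_0_compat; assumption).
  destruct (Hf (Rmin 1 (e / N))) as [d1 [Hd1 H1]]; [apply Rmin_pos; [lra|assumption]|].
  destruct (Hg (e / N)) as [d2 [Hd2 H2]]; [assumption|].
  destruct (Cdiff_Ccont _ _ _ Hg (e / N)) as [d3 [Hd3 H3]]; [assumption|].
  destruct (Cdiff_Ccont _ _ _ Hg 1) as [d4 [Hd4 H4]]; [lra|].
  exists (Rmin (Rmin d1 d2) (Rmin d3 d4)). split; [repeat apply Rmin_pos; assumption|].
  intros y Hy.
  assert (Y12 := Rlt_le_trans _ _ _ Hy (Rmin_l _ _)). assert (Y34 := Rlt_le_trans _ _ _ Hy (Rmin_r _ _)).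
  specialize (H1 y (Rlt_le_trans _ _ _ Y12 (Rmin_l _ _))).
  specialize (H2 y (Rlt_le_trans _ _ _ Y12 (Rmin_r _ _))).
  specialize (H3 y (Rlt_le_trans _ _ _ Y34 (Rmin_l _ _))).
  specialize (H4 y (Rlt_le_trans _ _ _ Y34 (Rmin_r _ _))).
  replace (f y * g y - f z * g z - (l * g z + f z * m) * (y - z))%C with
    ((f y - f z - l * (y - z)) * g z + (f z * (g y - g z - m * (y - z))
      + ((f y - f z - l * (y - z)) * (g y - g z) + l * (y - z) * (g y - g z))))%C by ring.
  pose proof (Cmod_ge_0 (y - z)%C) as P. set (D := Cmod (y - z)%C) in *.
  set (u := (f y - f z - l * (y - z))%C) in *. set (v := (g y - g z - m * (y - z))%C) in *.
  set (w := (g y - g z)%C) in *.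
  assert (U1 : Cmod u <= e / N * D).
  { eapply Rle_trans; [apply H1|]. apply Rmult_le_compat_r; [assumption|apply Rmin_r]. }
  eapply Rle_trans; [apply Cmod_triangle|].
  eapply Rle_trans; [apply Rplus_le_compat_l, Cmod_triangle|].
  eapply Rle_trans; [apply Rplus_le_compat_l, Rplus_le_compat_l, Cmod_triangle|].
  rewrite !Cmod_mult. fold D.
  pose proof (Cmod_ge_0 u). pose proof (Cmod_ge_0 v). pose proof (Cmod_ge_0 w).
  assert (HED : 0 <= e / N * D) by (apply Rmult_le_pos; lra).
  assert (A1 : Cmod u * Cmod (g z) <= e / N * D * Cmod (g z)) by (apply Rmult_le_compat_r; assumption).
  assert (A2 : Cmod (f z) * Cmod v <= Cmod (f z) * (e / N * D)) by (apply Rmult_le_compat_l; assumption).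
  assert (A3 : Cmod u * Cmod w <= e / N * D * 1) by (apply Rmult_le_compat; lra).
  assert (A4 : Cmod l * D * Cmod w <= Cmod l * D * (e / N)).
  { apply Rmult_le_compat_l; [apply Rmult_le_pos; assumption|lra]. }
  replace (e * D) with (N * (e / N * D)) by (field; lra).
  replace (Cmod l * D * (e / N)) with (Cmod l * (e / N * D)) in A4 by ring.
  set (X := e / N * D) in *. unfold N.
  pose proof (Rmult_le_pos _ _ HED Pg). pose proof (Rmult_le_pos _ _ Pf HED).
  pose proof (Rmult_le_pos _ _ Pl HED). lra.
Qed.

Lemma Cdiff_inv (z : C) : z <> 0 -> Cdiff Cinv z (- / (z * z))%C.
Proof.
  intros Hz. assert (P : 0 < Cmod z) by (now apply Cmod_gt_0).
  apply (Cdiff_quadratic Cinv z _ (2 / (Cmod z * Cmod z * Cmod z)) (Cmod z / 2)); [lra|].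
  intros y Hy.
  assert (Y : Cmod z / 2 < Cmod y).
  { pose proof (Cmod_reverse_triangle z (y - z)). replace (z + (y - z))%C with y in H by ring. lra. }
  assert (Hy0 : y <> 0) by (apply Cmod_gt_0; lra).
  replace (/ y - / z - - / (z * z) * (y - z))%C with ((y - z) * (y - z) * / y * / (z * z))%C.
  2: { field. split; assumption. }
  rewrite !Cmod_mult, !Cmod_inv, Cmod_mult by (try apply Cmult_neq_0; assumption).
  rewrite Rmult_comm, <- Rmult_assoc, Rmult_comm.
  pose proof (Cmod_ge_0 (y - z)%C).
  apply Rle_trans with (/ (Cmod z / 2) * (/ (Cmod z * Cmod z) * (Cmod (y - z)%C * Cmod (y - z)%C))).
  - apply Rmult_le_compat_r.
    + apply Rmult_le_pos; [|nra]. apply Rlt_le, Rinv_0_lt_compat. nra.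
    + apply Rinv_le_contravar; lra.
  - right. field. lra.
Qed.

Lemma Cdiff_inv_sub (z y : C) : y <> z -> exists l, Cdiff (fun u => / (u - z))%C y l.
Proof.
  intros H. eexists. apply (Cdiff_comp Cinv (fun u => u - z)%C).
  - apply Cdiff_inv. intros E. apply H. replace y with ((y - z) + z)%C by ring. rewrite E. ring.
  - apply (Cdiff_ext_loc (fun u => - z + 1 * u)%C) with 1; [lra|intros; ring|apply Cdiff_affine].
Qed.

Lemma ccont_inv (g : R -> C) t : g t <> 0 -> ccont g t -> ccont (fun u => / g u)%C t.
Proof.
  intros H1 H2. apply (ccont_comp Cinv g); [|assumption]. eapply Cdiff_Ccont, Cdiff_inv, H1.
Qed.

Lemma cder_inv (g : R -> C) t dg : g t <> 0 -> cder g t dg ->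
  cder (fun u => / g u)%C t (- / (g t * g t) * dg)%C.
Proof. intros H1 H2. apply (cder_comp Cinv g); [|assumption]. apply Cdiff_inv, H1. Qed.

Lemma ccont_pow (g : R -> C) t n : ccont g t -> ccont (fun u => g u ^ n)%C t.
Proof.
  intros H. induction n as [|n IH]; [apply ccont_const|].
  apply (ccont_mult g (fun u => g u ^ n)%C); assumption.
Qed.

Definition circ (r t : R) : C := (r * cos t, r * sin t).

Lemma Cmod_circ r t : 0 <= r -> Cmod (circ r t) = r.
Proof.
  intros H. unfold Cmod, circ; cbn [fst snd].
  replace ((r * cos t) ^ 2 + (r * sin t) ^ 2) with (r * r * (Rsqr (sin t) + Rsqr (cos t))) by (unfold Rsqr; ring).
  rewrite sin2_cos2, Rmult_1_r. apply sqrt_square. assumption.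
Qed.

Lemma circ_periodic r : circ r (2 * PI) = circ r 0.
Proof. unfold circ. now rewrite cos_2PI, sin_2PI, cos_0, sin_0. Qed.

Lemma cder_circ r t : cder (circ r) t (Ci * circ r t)%C.
Proof. split; simpl; auto_derive; try exact I; ring. Qed.

Lemma ccont_circ r t : ccont (circ r) t.
Proof. eapply cder_ccont, cder_circ. Qed.

Lemma circ_sub_bound r z t : 0 <= r -> r - Cmod z <= Cmod (circ r t - z)%C.
Proof.
  intros H. pose proof (Cmod_reverse_triangle (circ r t) (- z)) as K.
  rewrite Cmod_circ, Cmod_opp in K by assumption. exact K.
Qed.

Lemma circ_sub_neq r z t : Cmod z < r -> (circ r t - z)%C <> 0.
Proof.
  intros H. pose proof (Cmod_ge_0 z). apply Cmod_gt_0. pose proof (circ_sub_bound r z t). lra.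
Qed.

(** The integration variable is the angle, not the point [rho] of the circle: in [d rho = i rho dt]
    the factor [rho] is put into [g] and the constant [i] is dropped, so that [2 PI] stands where
    [2 PI i] is usual. *)
Definition cauchy_kernel (g : R -> C) (r : R) (m : nat) (z : C) (t : R) : C :=
  (g t * (/ (circ r t - z)) ^ m)%C.

Definition cauchy_integral (g : R -> C) (r : R) (m : nat) (z : C) : C :=
  @RInt C_R_CompleteNormedModule (cauchy_kernel g r m z) 0 (2 * PI).

Lemma cauchy_integral_correct g r m z : (forall t, ccont g t) -> Cmod z < r ->
  CI (cauchy_kernel g r m z) 0 (2 * PI) (cauchy_integral g r m z).
Proof.
  intros Hg Hz. apply (@RInt_correct C_R_CompleteNormedModule).
  destruct (CI_ex (cauchy_kernel g r m z) 0 (2 * PI)) as [l Hl]; [|now exists l].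
  intros t _. apply ccont_mult; [apply Hg|]. apply ccont_pow.
  apply ccont_inv; [now apply circ_sub_neq|].
  apply ccont_minus; [apply ccont_circ|apply ccont_const].
Qed.

(* With [A = 1/(rho - z - h)] and [B = 1/(rho - z)] one has [A - B = h A B]. *)
Lemma kernel_pow_bound (q : R) (m : nat) : exists M, 0 <= M /\
  forall A B h : C, Cmod A <= q -> Cmod B <= q -> (A - B)%C = (h * A * B)%C ->
  Cmod (A ^ m - B ^ m - RtoC (INR m) * h * B ^ S m)%C <= M * (Cmod h * Cmod h).
Proof.
  destruct (Rle_dec 0 q) as [Hq|Hq].
  2: { exists 0. split; [lra|]. intros A B h HA. pose proof (Cmod_ge_0 A). lra. }
  induction m as [|m [M [HM IH]]].
  - exists 0. split; [lra|]. intros A B h _ _ _.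
    replace (A ^ 0 - B ^ 0 - RtoC (INR 0) * h * B ^ 1)%C with (RtoC 0) by (simpl; ring).
    rewrite Cmod_0. lra.
  - exists (q * M + INR (S m) * q ^ (m + 3)). split.
    { apply Rplus_le_le_0_compat; [nra|]. apply Rmult_le_pos; [apply pos_INR|apply pow_le; assumption]. }
    intros A B h HA HB E. specialize (IH A B h HA HB E).
    replace (A ^ S m - B ^ S m - RtoC (INR (S m)) * h * B ^ S (S m))%C with
      (A * (A ^ m - B ^ m - RtoC (INR m) * h * B ^ S m)
        + ((A - B) * B ^ m + RtoC (INR m) * h * B ^ S m * A - RtoC (INR (S m)) * h * B ^ S (S m)))%C
      by (rewrite !Cpow_S; ring).
    replace ((A - B) * B ^ m + RtoC (INR m) * h * B ^ S m * A - RtoC (INR (S m)) * h * B ^ S (S m))%C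
      with (RtoC (INR (S m)) * (h * h) * (A * B ^ (m + 2)))%C.
    2: { replace (m + 2)%nat with (S (S m)) by lia. rewrite S_INR, RtoC_plus, !Cpow_S, E.
         transitivity ((RtoC (INR m) + 1) * h * (h * A * B) * (B * B ^ m))%C; [ring|].
         rewrite <- E at 1. ring. }
    eapply Rle_trans; [apply Cmod_triangle|]. rewrite !Cmod_mult, Cmod_pow, Cmod_R, (Rabs_pos_eq (INR (S m))) by apply pos_INR.
    rewrite Rmult_plus_distr_r. apply Rplus_le_compat.
    + rewrite Rmult_assoc. apply Rmult_le_compat; try apply Cmod_ge_0; assumption.
    + pose proof (Cmod_ge_0 h).
      replace (INR (S m) * q ^ (m + 3) * (Cmod h * Cmod h))
        with (INR (S m) * (Cmod h * Cmod h) * q ^ (m + 3)) by ring.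
      apply Rmult_le_compat_l; [apply Rmult_le_pos; [apply pos_INR|nra]|].
      replace (m + 3)%nat with (S (m + 2)) by lia. rewrite <- tech_pow_Rmult.
      apply Rmult_le_compat; try apply Cmod_ge_0; [apply pow_le, Cmod_ge_0|assumption|].
      apply pow_incr. split; [apply Cmod_ge_0|assumption].
Qed.

(** Differentiation under the integral sign. Both [z] and the nearby [y] stay at distance at least
    [dl] from the circle, which makes the quadratic remainder of the kernel uniform in the angle. *)
Lemma cauchy_integral_diff g r m z G : (forall t, ccont g t) ->
  (forall t, 0 <= t <= 2 * PI -> Cmod (g t) <= G) -> Cmod z < r ->
  Cdiff (cauchy_integral g r m) z (RtoC (INR m) * cauchy_integral g r (S m) z)%C.
Proof.
  intros Hg HG Hz. pose proof (Cmod_ge_0 z) as Pz. set (dl := (r - Cmod z) / 2).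
  assert (Hdl : 0 < dl) by (unfold dl; lra).
  destruct (kernel_pow_bound (/ dl) m) as [M [HM K]].
  apply (Cdiff_quadratic _ _ _ (2 * PI * (G * M)) dl Hdl).
  intros y Hy.
  assert (Hyr : Cmod y < r).
  { pose proof (Cmod_triangle z (y - z)) as T. replace (z + (y - z))%C with y in T by ring. unfold dl in *. lra. }
  pose proof (cauchy_integral_correct g r m y Hg Hyr) as I1.
  pose proof (cauchy_integral_correct g r m z Hg Hz) as I2.
  pose proof (cauchy_integral_correct g r (S m) z Hg Hz) as I3.
  pose proof (CI_minus _ _ _ _ _ _ (CI_minus _ _ _ _ _ _ I1 I2)
     (CI_scal (RtoC (INR m) * (y - z))%C _ _ _ _ I3)) as I4.
  replace (cauchy_integral g r m y - cauchy_integral g r m z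
     - RtoC (INR m) * cauchy_integral g r (S m) z * (y - z))%C
   with (cauchy_integral g r m y - cauchy_integral g r m z
     - RtoC (INR m) * (y - z) * cauchy_integral g r (S m) z)%C by ring.
  pose proof PI_RGT_0 as Hpi.
  replace (2 * PI * (G * M) * (Cmod (y - z)%C * Cmod (y - z)%C))
    with ((2 * PI - 0) * (G * (M * (Cmod (y - z)%C * Cmod (y - z)%C)))) by ring.
  eapply CI_bound_const; [lra| |exact I4].
  intros t Ht. unfold cauchy_kernel.
  replace (g t * (/ (circ r t - y)) ^ m - g t * (/ (circ r t - z)) ^ m
     - RtoC (INR m) * (y - z) * (g t * (/ (circ r t - z)) ^ S m))%C
    with (g t * ((/ (circ r t - y)) ^ m - (/ (circ r t - z)) ^ m
     - RtoC (INR m) * (y - z) * (/ (circ r t - z)) ^ S m))%C by ring.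
  rewrite Cmod_mult. apply Rmult_le_compat; try apply Cmod_ge_0; [apply HG, Ht|].
  assert (N1 := circ_sub_neq r y t Hyr). assert (N2 := circ_sub_neq r z t Hz).
  apply K.
  - rewrite Cmod_inv by assumption. apply Rinv_le_contravar; [assumption|].
    pose proof (circ_sub_bound r y t ltac:(lra)).
    pose proof (Cmod_triangle z (y - z)) as T. replace (z + (y - z))%C with y in T by ring. unfold dl in *. lra.
  - rewrite Cmod_inv by assumption. apply Rinv_le_contravar; [assumption|].
    pose proof (circ_sub_bound r z t ltac:(lra)). unfold dl. lra.
  - field. split; assumption.
Qed.

(** The integrand [rho / (rho - z)^2] has the primitive [i / (rho - z)], which is periodic in the
    angle. *)
Lemma circ_integral_2 r z : Cmod z < r -> cauchy_integral (circ r) r 2 z = 0.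
Proof.
  intros Hz. eapply CI_unique.
  - apply cauchy_integral_correct; [intros; apply ccont_circ|assumption].
  - replace (RtoC 0) with (Ci * / (circ r (2 * PI) - z) - Ci * / (circ r 0 - z))%C
      by (rewrite circ_periodic; ring).
    apply (CI_FTC (fun t => Ci * / (circ r t - z))%C).
    + intros t _. eapply cder_eq; [apply cder_scal, cder_inv|].
      * now apply circ_sub_neq.
      * apply cder_minus; [apply cder_circ|apply cder_const].
      * unfold cauchy_kernel. rewrite !Cpow_S.
        replace (Ci * (- / ((circ r t - z) * (circ r t - z)) * (Ci * circ r t - 0)))%C
          with (- (Ci * Ci) * circ r t * / ((circ r t - z) * (circ r t - z)))%C by ring.
        replace (- (Ci * Ci))%C with (RtoC 1) by (apply injective_projections; simpl; ring).
        simpl. field. now apply circ_sub_neq.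
    + intros t _. apply ccont_mult; [apply ccont_circ|]. apply ccont_pow.
      apply ccont_inv; [now apply circ_sub_neq|].
      apply ccont_minus; [apply ccont_circ|apply ccont_const].
Qed.

(** The derivative in [z] is the integral of the previous lemma, hence zero; the value is therefore
    constant along the segment from 0 to [z], and at 0 the integrand is 1. *)
Lemma circ_integral_1 r z : Cmod z < r -> cauchy_integral (circ r) r 1 z = RtoC (2 * PI).
Proof.
  intros Hz. pose proof (Cmod_ge_0 z) as Pz.
  assert (Hr : 0 < r) by lra.
  assert (E0 : cauchy_integral (circ r) r 1 0 = RtoC (2 * PI)).
  { eapply CI_unique.
    - apply cauchy_integral_correct; [intros; apply ccont_circ|rewrite Cmod_0; assumption].
    - replace (RtoC (2 * PI)) with (RtoC (2 * PI - 0) * 1)%C by (rewrite Rminus_0_r; ring).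
      eapply CI_ext; [|apply CI_const]. intros t _. unfold cauchy_kernel.
      rewrite Cpow_1_r. field.
      replace (circ r t) with (circ r t - 0)%C by ring. apply circ_sub_neq. rewrite Cmod_0. lra. }
  rewrite <- E0.
  assert (Hs : forall t, 0 <= t <= 1 -> Cmod (RtoC t * z)%C < r).
  { intros t Ht. rewrite Cmod_mult, Cmod_R, Rabs_pos_eq by lra. nra. }
  assert (L : Cmod (cauchy_integral (circ r) r 1 (RtoC 1 * z) - cauchy_integral (circ r) r 1 (RtoC 0 * z))%C
    <= (1 - 0) * 0).
  { apply (curve_lipschitz (fun t => cauchy_integral (circ r) r 1 (RtoC t * z)%C) (fun _ => 0)); [lra|..].
    - intros t Ht. eapply cder_eq.
      + apply (cder_comp (cauchy_integral (circ r) r 1) (fun t => RtoC t * z)%C).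
        * apply (cauchy_integral_diff (circ r) r 1 _ r); [intros; apply ccont_circ| |apply (Hs t Ht)].
          intros u _. rewrite Cmod_circ; lra.
        * apply cder_mult; [apply (cder_RtoC (fun t => t)), @is_derive_id|apply cder_const].
      + cbv beta. rewrite circ_integral_2 by (apply (Hs t Ht)). ring.
    - intros; apply ccont_const.
    - intros. rewrite Cmod_0. lra. }
  rewrite Rmult_0_r in L.
  pose proof (Cmod_ge_0 (cauchy_integral (circ r) r 1 (RtoC 1 * z) - cauchy_integral (circ r) r 1 (RtoC 0 * z))%C).
  assert (E : (cauchy_integral (circ r) r 1 (RtoC 1 * z) - cauchy_integral (circ r) r 1 (RtoC 0 * z))%C = 0)
    by (apply Cmod_eq_0; lra).
  rewrite Cmult_1_l, Cmult_0_l in E.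
  replace (cauchy_integral (circ r) r 1 z) with
    ((cauchy_integral (circ r) r 1 z - cauchy_integral (circ r) r 1 0) + cauchy_integral (circ r) r 1 0)%C by ring.
  rewrite E. ring.
Qed.

(** * Cauchy's formula and its consequences *)

Lemma ccont_bounded (g : R -> C) a b : a <= b -> (forall t, ccont g t) ->
  exists M, forall t, a <= t <= b -> Cmod (g t) <= M.
Proof.
  intros Hab Hg.
  destruct (continuity_ab_maj (fun t => Rabs (Re (g t)) + Rabs (Im (g t))) a b Hab) as [m [Hm _]].
  - intros t _. apply continuity_pt_filterlim.
    apply (@continuous_plus _ R_AbsRing R_NormedModule (fun t => Rabs (Re (g t))) (fun t => Rabs (Im (g t)))).
    + apply (continuous_comp (fun t => Re (g t)) Rabs); [apply Hg|apply continuous_Rabs].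
    + apply (continuous_comp (fun t => Im (g t)) Rabs); [apply Hg|apply continuous_Rabs].
  - exists (Rabs (Re (g m)) + Rabs (Im (g m))). intros t Ht.
    eapply Rle_trans; [apply Cmod_le_abs|]. apply (Hm t Ht).
Qed.

Definition holo_on (f : C -> C) (U : C -> Prop) : Prop := forall z, U z -> exists l, Cdiff f z l.

(* Goursat for [f(y)/(y - z)] along [h(s,t) = z + s (rho(t) - z)], [e <= s <= 1], then [e -> 0]. *)
Lemma cauchy_formula f r : 0 < r -> holo_on f (fun y => Cmod y <= r) ->
  forall z, Cmod z < r ->
  cauchy_integral (fun t => f (circ r t) * circ r t)%C r 1 z = (RtoC (2 * PI) * f z)%C.
Proof.
  intros Hr Hf z Hz. pose proof (Cmod_ge_0 z) as Pz. pose proof PI_RGT_0 as Hpi.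
  assert (Fc : forall y, Cmod y <= r -> Ccont f y).
  { intros y Hy. destruct (Hf y Hy) as [l Hl]. apply (Cdiff_Ccont _ _ _ Hl). }
  assert (Fcirc : forall t, ccont (fun t => f (circ r t)) t).
  { intros t. apply (ccont_comp f (circ r)); [|apply ccont_circ]. apply Fc. rewrite Cmod_circ; lra. }
  assert (Gc : forall t, ccont (fun t => f (circ r t) * circ r t)%C t).
  { intros t. apply ccont_mult; [apply Fcirc|apply ccont_circ]. }
  set (K := cauchy_integral (fun t => f (circ r t) * circ r t)%C r 1 z).
  assert (HK : CI (cauchy_kernel (fun t => f (circ r t) * circ r t)%C r 1 z) 0 (2 * PI) K)
    by (apply cauchy_integral_correct; assumption).
  assert (HJ : CI (cauchy_kernel (circ r) r 1 z) 0 (2 * PI) (RtoC (2 * PI))).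
  { rewrite <- (circ_integral_1 r z Hz). apply cauchy_integral_correct; [apply ccont_circ|assumption]. }
  assert (Hseg : forall s t, 0 <= s <= 1 -> Cmod (z + RtoC s * (circ r t - z))%C <= r).
  { intros s t Hs. replace (z + RtoC s * (circ r t - z))%C with (RtoC (1 - s) * z + RtoC s * circ r t)%C
      by (rewrite RtoC_minus; ring).
    eapply Rle_trans; [apply Cmod_triangle|]. rewrite !Cmod_mult, !Cmod_R, Cmod_circ by lra.
    rewrite !Rabs_pos_eq by lra. nra. }
  (* The circle is contracted towards [z] by the factor [e]. The kernel is invariant under this
     contraction, and Goursat keeps the integral unchanged. *)
  assert (Main : forall e, 0 < e <= 1 ->
    CI (fun t => f (z + RtoC e * (circ r t - z)) * (circ r t * / (circ r t - z)))%C 0 (2 * PI) K).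
  { intros e He.
    set (h := fun s t : R => (z + RtoC s * (circ r t - z))%C).
    set (k := fun y : C => (f y * / (y - z))%C).
    assert (Hne : forall s t, 0 < s -> (h s t - z)%C <> 0).
    { intros s t Hs. unfold h. replace (z + RtoC s * (circ r t - z) - z)%C with (RtoC s * (circ r t - z))%C by ring.
      apply Cmult_neq_0; [|now apply circ_sub_neq]. intros E; apply RtoC_inj in E; lra. }
    assert (Dx : forall s t, cder (fun u => h u t) s (circ r t - z)%C).
    { intros s t. unfold h. eapply cder_eq.
      - apply cder_plus; [apply cder_const|]. apply cder_mult; [apply (cder_RtoC (fun t => t)), @is_derive_id|apply cder_const].
      - unfold one; simpl. ring. }
    assert (Dy : forall s t, cder (fun u => h s u) t (RtoC s * (Ci * circ r t))%C).
    { intros s t. unfold h. eapply cder_eq.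
      - apply cder_plus; [apply cder_const|]. apply cder_scal. apply cder_minus; [apply cder_circ|apply cder_const].
      - ring. }
    assert (Hk : forall s t, e <= s <= 1 -> exists l, Cdiff k (h s t) l).
    { intros s t Hs. unfold k.
      destruct (Hf (h s t)) as [l Hl]; [apply Hseg; lra|].
      destruct (Cdiff_inv_sub z (h s t)) as [m Hm].
      { intros E. apply (Hne s t); [lra|]. rewrite E. ring. }
      eexists. apply (Cdiff_mult f (fun y => / (y - z))%C); eassumption. }
    assert (Ck : forall s t, e <= s <= 1 -> ccont (fun u => k (h u t)) s).
    { intros s t Hs. destruct (Hk s t Hs) as [l Hl].
      apply (ccont_comp k (fun u => h u t)); [apply (Cdiff_Ccont _ _ _ Hl)|apply (cder_ccont _ _ _ (Dx s t))]. }
    assert (Cky : forall s t, e <= s <= 1 -> ccont (fun u => k (h s u)) t).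
    { intros s t Hs. destruct (Hk s t Hs) as [l Hl].
      apply (ccont_comp k (fun u => h s u)); [apply (Cdiff_Ccont _ _ _ Hl)|apply (cder_ccont _ _ _ (Dy s t))]. }
    assert (Chy : forall s t, ccont (fun u => RtoC s * (Ci * circ r u))%C t).
    { intros s t. apply ccont_mult; [apply ccont_const|].
      apply ccont_mult; [apply ccont_const|apply ccont_circ]. }
    destruct (CI_ex (fun x => k (h x 0) * (circ r 0 - z))%C e 1) as [i1 J1].
    { rewrite Rmin_left, Rmax_right by lra. intros s Hs. apply ccont_mult; [apply Ck; lra|apply ccont_const]. }
    destruct (CI_ex (fun t => k (h 1 t) * (RtoC 1 * (Ci * circ r t)))%C 0 (2 * PI)) as [i2 J2].
    { intros t _. apply ccont_mult; [apply Cky; lra|apply Chy]. }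
    destruct (CI_ex (fun t => k (h e t) * (RtoC e * (Ci * circ r t)))%C 0 (2 * PI)) as [i4 J4].
    { intros t _. apply ccont_mult; [apply Cky; lra|apply Chy]. }
    (* The sides at angles 0 and [2 PI] are the same segment, so they cancel and only the arcs
       [s = 1] and [s = e] remain. *)
    assert (J3 : CI (fun x => k (h x (2 * PI)%R) * (circ r (2 * PI)%R - z))%C e 1 i1).
    { eapply CI_ext; [|exact J1]. intros s _. unfold h. now rewrite circ_periodic. }
    assert (E : (i1 + i2)%C = (i1 + i4)%C).
    { apply (goursat h (fun _ t => circ r t - z)%C (fun s t => RtoC s * (Ci * circ r t))%C k
        e 1 0 (2 * PI) (2 * r)); [lra|lra|..]; [| | | | | | |exact J1|exact J2|exact J3|exact J4].
      - intros; apply Dx.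
      - intros; apply Dy.
      - intros; apply ccont_const.
      - intros; apply Chy.
      - intros x y _ _. eapply Rle_trans; [apply Cmod_triangle|]. rewrite Cmod_opp, Cmod_circ; lra.
      - intros x y Hx _. rewrite !Cmod_mult, Cmod_R, Cmod_Ci, Cmod_circ, Rabs_pos_eq by lra. nra.
      - intros; apply Hk; assumption. }
    assert (E24 : i2 = i4).
    { replace i2 with (i1 + i2 - i1)%C by ring. rewrite E. ring. }
    assert (Ei : i2 = (Ci * K)%C).
    { eapply CI_unique; [exact J2|]. eapply CI_ext; [|apply CI_scal, HK].
      intros t _. unfold cauchy_kernel, k, h. rewrite Cpow_1_r.
      replace (z + RtoC 1 * (circ r t - z))%C with (circ r t) by ring. ring. }
    assert (EK : K = (- Ci * i4)%C).
    { rewrite <- E24, Ei. replace (- Ci * (Ci * K))%C with (- (Ci * Ci) * K)%C by ring.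
      replace (- (Ci * Ci))%C with (RtoC 1) by (apply injective_projections; simpl; ring). ring. }
    rewrite EK. eapply CI_ext; [|apply CI_scal, J4].
    intros t _. cbv beta. unfold k. unfold h at 2.
    replace (z + RtoC e * (circ r t - z) - z)%C with (RtoC e * (circ r t - z))%C by ring.
    replace (- Ci * (f (h e t) * / (RtoC e * (circ r t - z)) * (RtoC e * (Ci * circ r t))))%C
      with (- (Ci * Ci) * (f (h e t) * / (RtoC e * (circ r t - z)) * (RtoC e * circ r t)))%C by ring.
    replace (- (Ci * Ci))%C with (RtoC 1) by (apply injective_projections; simpl; ring).
    unfold h. field. split; [now apply circ_sub_neq|]. intros E0; apply RtoC_inj in E0; lra. }
  set (D := (K - f z * RtoC (2 * PI))%C).
  (* For small [e] the argument of [f] is close to [z] uniformly in the angle, by continuity at [z],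
     while the kernel is bounded by [r / (r - |z|)]. *)
  assert (HD : forall eta, 0 < eta -> Cmod D <= 2 * PI * (eta * (r / (r - Cmod z)))).
  { intros eta Heta. destruct (Fc z ltac:(lra) eta Heta) as [dl [Hdl Hc]].
    set (e := Rmin 1 (dl / (4 * r))).
    assert (He : 0 < e <= 1).
    { split; [apply Rmin_pos; [lra|apply Rdiv_lt_0_compat; lra]|apply Rmin_l]. }
    pose proof (CI_minus _ _ _ _ _ _ (Main e He) (CI_scal (f z) _ _ _ _ HJ)) as Q.
    fold D in Q. replace (2 * PI) with (2 * PI - 0) by ring.
    eapply CI_bound_const; [lra| |exact Q]. intros t _. cbv beta. unfold cauchy_kernel. rewrite Cpow_1_r.
    replace (f (z + RtoC e * (circ r t - z)) * (circ r t * / (circ r t - z)) - f z * (circ r t * / (circ r t - z)))%C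
      with ((f (z + RtoC e * (circ r t - z)) - f z) * (circ r t * / (circ r t - z)))%C by ring.
    rewrite !Cmod_mult, Cmod_inv, Cmod_circ by (lra || now apply circ_sub_neq).
    apply Rmult_le_compat; [apply Cmod_ge_0| | |].
    - apply Rmult_le_pos; [lra|]. apply Rlt_le, Rinv_0_lt_compat. apply Cmod_gt_0. now apply circ_sub_neq.
    - apply Rlt_le, Hc.
      replace (z + RtoC e * (circ r t - z) - z)%C with (RtoC e * (circ r t - z))%C by ring.
      rewrite Cmod_mult, Cmod_R, Rabs_pos_eq by lra.
      assert (Cmod (circ r t - z)%C <= 2 * r).
      { eapply Rle_trans; [apply Cmod_triangle|]. rewrite Cmod_opp, Cmod_circ; lra. }
      apply Rle_lt_trans with (dl / (4 * r) * (2 * r)).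
      + apply Rmult_le_compat; try apply Cmod_ge_0; try lra. apply Rmin_r.
      + replace (dl / (4 * r) * (2 * r)) with (dl / 2) by (field; lra). lra.
    - apply Rmult_le_compat_l; [lra|]. apply Rinv_le_contravar; [lra|]. apply circ_sub_bound; lra. }
  assert (D0 : D = 0).
  { apply Cmod_eq_0. apply Rle_antisym; [|apply Cmod_ge_0]. apply Rnot_lt_le. intros Hp.
    set (q := 2 * PI * (r / (r - Cmod z))).
    assert (Hq : 0 < q).
    { unfold q. apply Rmult_lt_0_compat; [lra|]. apply Rdiv_lt_0_compat; lra. }
    pose proof (HD (Cmod D / (2 * q)) ltac:(apply Rdiv_lt_0_compat; lra)) as B.
    replace (2 * PI * (Cmod D / (2 * q) * (r / (r - Cmod z)))) with (Cmod D / (2 * q) * q) in B by (unfold q; ring).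
    replace (Cmod D / (2 * q) * q) with (Cmod D / 2) in B by (field; lra). lra. }
  replace K with (D + f z * RtoC (2 * PI))%C by (unfold D; ring). rewrite D0. ring.
Qed.

(** A choice operator makes differentiation total, so it can be iterated without carrying existence
    proofs; its value means something only where a derivative exists. *)
Definition Cderiv (f : C -> C) (z : C) : C := epsilon (inhabits (RtoC 0)) (fun l => Cdiff f z l).

Fixpoint Cderiv_n (n : nat) (f : C -> C) : C -> C :=
  match n with O => f | S m => Cderiv (Cderiv_n m f) end.

Lemma Cderiv_eq f z l : Cdiff f z l -> Cderiv f z = l.
Proof.
  intros H. apply (Cdiff_unique f z); [|assumption].
  unfold Cderiv. apply epsilon_spec. now exists l.
Qed.

Lemma INR_fact_neq_C n : RtoC (INR (fact n)) <> 0.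
Proof. intros E. apply RtoC_inj in E. now apply INR_fact_neq_0 in E. Qed.

(** The two conclusions feed each other: the integral formula at order [n] holds on the whole open
    disc, so it can be differentiated, and uniqueness of the derivative gives the formula at order
    [n + 1]. *)
Lemma Cderiv_n_cauchy f c r n : 0 < r -> holo_on f (fun y => Cmod (y - c)%C <= r) ->
  forall z, Cmod (z - c)%C < r ->
  Cderiv_n n f z = (RtoC (INR (fact n) / (2 * PI)) *
     cauchy_integral (fun t => f (c + circ r t) * circ r t) r (S n) (z - c))%C
  /\ Cdiff (Cderiv_n n f) z (Cderiv_n (S n) f z).
Proof.
  intros Hr Hf. pose proof PI_RGT_0 as Hpi.
  assert (Hf0 : holo_on (fun y => f (c + y)%C) (fun y => Cmod y <= r)).
  { intros y Hy. destruct (Hf (c + y)%C) as [l Hl]; [now replace (c + y - c)%C with y by ring|].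
    exists (l * 1)%C. apply (Cdiff_comp f (fun y => c + y)%C); [assumption|].
    apply (Cdiff_ext_loc (fun y => c + 1 * y)%C) with 1; [lra|intros; ring|apply Cdiff_affine]. }
  set (g := fun t => (f (c + circ r t) * circ r t)%C).
  assert (Hg : forall t, ccont g t).
  { intros t. apply ccont_mult; [|apply ccont_circ].
    destruct (Hf0 (circ r t)) as [l Hl]; [rewrite Cmod_circ; lra|].
    apply (ccont_comp (fun y => f (c + y)%C) (circ r)); [apply (Cdiff_Ccont _ _ _ Hl)|apply ccont_circ]. }
  destruct (ccont_bounded g 0 (2 * PI)) as [G HG]; [lra|assumption|].
  assert (Step : forall m z, Cmod (z - c)%C < r ->
    Cdiff (fun y => RtoC (INR (fact m) / (2 * PI)) * cauchy_integral g r (S m) (y - c))%C z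
     (RtoC (INR (fact (S m)) / (2 * PI)) * cauchy_integral g r (S (S m)) (z - c))%C).
  { intros m z Hz.
    replace (RtoC (INR (fact (S m)) / (2 * PI)) * cauchy_integral g r (S (S m)) (z - c))%C with
      (RtoC (INR (fact m) / (2 * PI)) * (RtoC (INR (S m)) * cauchy_integral g r (S (S m)) (z - c) * 1))%C.
    2: { rewrite fact_simpl, mult_INR.
         replace (INR (S m) * INR (fact m) / (2 * PI)) with (INR (fact m) / (2 * PI) * INR (S m)) by (field; lra).
         rewrite RtoC_mult. ring. }
    apply Cdiff_scal. apply (Cdiff_comp (cauchy_integral g r (S m)) (fun y => y - c)%C).
    - apply cauchy_integral_diff with G; assumption.
    - apply (Cdiff_ext_loc (fun u => - c + 1 * u)%C) with 1; [lra|intros; ring|apply Cdiff_affine]. }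
  assert (Val : forall m z, Cmod (z - c)%C < r ->
    Cderiv_n m f z = (RtoC (INR (fact m) / (2 * PI)) * cauchy_integral g r (S m) (z - c))%C).
  { induction m as [|m IH]; intros z Hz.
    - simpl Cderiv_n. unfold g. rewrite (cauchy_formula (fun y => f (c + y)%C) r Hr Hf0 (z - c)%C Hz).
      replace (c + (z - c))%C with z by ring.
      rewrite Cmult_assoc, <- RtoC_mult. simpl fact. simpl INR.
      replace (1 / (2 * PI) * (2 * PI)) with 1 by (field; lra). ring.
    - simpl Cderiv_n. apply Cderiv_eq.
      apply (Cdiff_ext_loc (fun y => RtoC (INR (fact m) / (2 * PI)) * cauchy_integral g r (S m) (y - c))%C)
        with (r - Cmod (z - c)%C); [lra| |apply Step, Hz].
      intros y Hy. symmetry. apply IH.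
      pose proof (Cmod_triangle (y - z) (z - c)) as T. replace (y - z + (z - c))%C with (y - c)%C in T by ring. lra. }
  intros z Hz. split; [apply Val, Hz|].
  rewrite (Val (S n) z Hz).
  apply (Cdiff_ext_loc (fun y => RtoC (INR (fact n) / (2 * PI)) * cauchy_integral g r (S n) (y - c))%C)
    with (r - Cmod (z - c)%C); [lra| |apply Step, Hz].
  intros y Hy. symmetry. apply Val.
  pose proof (Cmod_triangle (y - z) (z - c)) as T. replace (y - z + (z - c))%C with (y - c)%C in T by ring. lra.
Qed.

Lemma Cderiv_n_diff f c R n z : holo_on f (fun y => Cmod (y - c)%C < R) -> Cmod (z - c)%C < R ->
  Cdiff (Cderiv_n n f) z (Cderiv_n (S n) f z).
Proof.
  intros Hf Hz. pose proof (Cmod_ge_0 (z - c)%C).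
  apply (Cderiv_n_cauchy f c ((R + Cmod (z - c)%C) / 2) n); [lra| |lra].
  intros y Hy. apply Hf. lra.
Qed.

(** At the centre the kernel reduces to a power of [rho] of constant modulus, which is the form
    needed for estimates by a supremum or by a mean. *)
Lemma cauchy_coefficient f c r n : 0 < r -> holo_on f (fun y => Cmod (y - c)%C <= r) ->
  CI (fun t => f (c + circ r t) * (/ circ r t) ^ n)%C 0 (2 * PI)
     (RtoC (2 * PI / INR (fact n)) * Cderiv_n n f c)%C.
Proof.
  intros Hr Hf. pose proof PI_RGT_0 as Hpi. pose proof (INR_fact_neq_0 n) as Hn.
  assert (Hc : Cmod (c - c)%C < r) by (replace (c - c)%C with (RtoC 0) by ring; rewrite Cmod_0; assumption).
  rewrite (proj1 (Cderiv_n_cauchy f c r n Hr Hf c Hc)).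
  rewrite Cmult_assoc, <- RtoC_mult.
  replace (2 * PI / INR (fact n) * (INR (fact n) / (2 * PI))) with 1 by (field; split; [lra|assumption]).
  rewrite Cmult_1_l.
  eapply CI_ext; [|apply cauchy_integral_correct; [|exact Hc]].
  - intros t _. unfold cauchy_kernel. replace (circ r t - (c - c))%C with (circ r t) by ring.
    rewrite Cpow_S. field. apply Cmod_gt_0. rewrite Cmod_circ; lra.
  - intros t. apply ccont_mult; [|apply ccont_circ].
    destruct (Hf (c + circ r t)%C) as [l Hl].
    { replace (c + circ r t - c)%C with (circ r t) by ring. rewrite Cmod_circ; lra. }
    apply (ccont_comp f (fun t => c + circ r t)%C); [apply (Cdiff_Ccont _ _ _ Hl)|].
    apply ccont_plus; [apply ccont_const|apply ccont_circ].
Qed.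

(** * The function [phi(s) = F(-lam log s)] *)

Lemma Carg_right (s : C) : 0 < Re s -> Carg s = atan (Im s / Re s).
Proof. intros H. unfold Carg. destruct (Rlt_dec 0 (Re s)); [reflexivity|contradiction]. Qed.

Lemma Re_pos_disc (s : C) : Cmod (s - 1)%C < 1 -> 0 < Re s.
Proof.
  intros H. pose proof (Re_le_Cmod (s - 1)%C) as K. simpl in K. unfold Re.
  apply Rabs_le_between in K. lra.
Qed.

(** Only derivatives along straight lines are computed from [ln] and [atan]; integrating them over
    segments of the convex half-plane [Re > 0] gives both the complex derivative and the growth of
    the logarithm. *)
Lemma cder_Clog_line (s h : C) (t : R) : 0 < Re (s + RtoC t * h)%C ->
  cder (fun u => Clog (s + RtoC u * h)%C) t (h / (s + RtoC t * h))%C.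
Proof.
  intros Ht. destruct s as [x y], h as [a b].
  assert (Ht' : 0 < x + t * a) by (simpl in Ht; lra).
  apply (cder_ext_loc (fun u : R => (ln (sqrt ((x + u * a) ^ 2 + (y + u * b) ^ 2)),
     atan ((y + u * b) / (x + u * a))) : C)).
  - assert (L : locally t (fun u => 0 < x + u * a)).
    { assert (K : continuous (fun u => x + u * a) t).
      { apply (@ex_derive_continuous R_AbsRing R_NormedModule). auto_derive. exact I. }
      apply (K (fun v => 0 < v)). apply open_gt. exact Ht'. }
    eapply filter_imp; [|exact L]. intros u Hu. cbv beta in Hu |- *.
    unfold Clog. rewrite Carg_right by (simpl; lra).
    f_equal.
    + f_equal. unfold Cmod. simpl. f_equal. ring.
    + simpl. f_equal. f_equal; ring.
  - assert (P : 0 < (x + t * a) ^ 2 + (y + t * b) ^ 2).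
    { pose proof (pow_lt _ 2 Ht'). pose proof (pow2_ge_0 (y + t * b)). lra. }
    split; cbn [Re Im fst snd].
    + auto_derive.
      * repeat split; try apply sqrt_lt_R0; nra.
      * replace ((x + t * a) * ((x + t * a) * 1) + (y + t * b) * ((y + t * b) * 1))
          with ((x + t * a) ^ 2 + (y + t * b) ^ 2) by ring.
        set (q := (x + t * a) ^ 2 + (y + t * b) ^ 2) in *.
        assert (Hs : sqrt q * sqrt q = q) by (apply sqrt_sqrt; lra).
        assert (Hp : 0 < sqrt q) by (apply sqrt_lt_R0; lra).
        assert (E : / sqrt q * / (2 * sqrt q) = / (2 * q)).
        { rewrite <- Hs at 3. field. lra. }
        transitivity ((2 * (a * (x + t * a) + b * (y + t * b))) * (/ sqrt q * / (2 * sqrt q))); [field; lra|].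
        rewrite E. unfold q. simpl.
        replace (0 * b + t * 0) with 0 by ring. field. unfold q in P; simpl in P; lra.
    + auto_derive.
      * lra.
      * simpl. field. simpl in P. repeat split; lra.
Qed.

Lemma Re_le (z : C) : Re z <= Cmod z.
Proof. eapply Rle_trans; [apply Rle_abs|apply Re_le_Cmod]. Qed.

Lemma Re_neq_0 (z : C) : 0 < Re z -> z <> 0.
Proof. intros H E. rewrite E in H. simpl in H. lra. Qed.

Lemma Re_segment (s h : C) (t : R) : 0 <= t <= 1 -> Re s - Cmod h <= Re (s + RtoC t * h)%C.
Proof.
  intros Ht. pose proof (Re_le_Cmod h) as K. apply Rabs_le_between in K.
  destruct s, h; simpl in *. nra.
Qed.

Lemma ccont_line (s h : C) (t : R) : ccont (fun u => s + RtoC u * h)%C t.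
Proof.
  apply ccont_plus; [apply ccont_const|]. apply ccont_mult; [|apply ccont_const].
  apply ccont_RtoC, continuous_id.
Qed.

(** Along the segment from [s] to [s + h] the derivative of the remainder is [h/(s + t h) - h/s = -
    t h^2 / (s (s + t h))], quadratic in [h]. The constant comes from [|s| >= Re s] and
    [|s + t h| >= Re s / 2]. *)
Lemma Clog_diff (s : C) : 0 < Re s -> Cdiff Clog s (/ s)%C.
Proof.
  intros Hs. assert (Hs0 := Re_neq_0 s Hs).
  apply (Cdiff_quadratic Clog s (/ s)%C (2 / (Re s * Re s)) (Re s / 2)); [lra|].
  intros y Hy. set (h := (y - s)%C) in *.
  assert (Hseg : forall t, 0 <= t <= 1 -> Re s / 2 < Re (s + RtoC t * h)%C).
  { intros t Ht. pose proof (Re_segment s h t Ht). lra. }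
  pose proof (curve_lipschitz (fun t => Clog (s + RtoC t * h) - RtoC t * (/ s * h))%C
    (fun t => h * / (s + RtoC t * h) - / s * h)%C 0 1 (2 / (Re s * Re s) * (Cmod h * Cmod h))) as K.
  cbv beta in K. rewrite Cmult_0_l, !Cmult_1_l, Cmult_0_l in K.
  replace (s + 0)%C with s in K by ring. replace (s + h)%C with y in K by (unfold h; ring).
  replace (Clog y - / s * h - (Clog s - 0))%C with (Clog y - Clog s - / s * h)%C in K by ring.
  rewrite Rminus_0_r, Rmult_1_l in K. apply K; clear K; [lra|..].
  - intros t Ht. apply cder_minus.
    + apply (cder_Clog_line s h t). specialize (Hseg t Ht). lra.
    + eapply cder_eq; [apply cder_mult; [apply (cder_RtoC (fun t => t)), @is_derive_id|apply cder_const]|].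
      unfold one; simpl. ring.
  - intros t Ht. apply ccont_minus; [|apply ccont_const].
    apply ccont_mult; [apply ccont_const|]. apply ccont_inv; [|apply ccont_line].
    apply Re_neq_0. specialize (Hseg t Ht). lra.
  - intros t Ht. specialize (Hseg t Ht).
    assert (N : (s + RtoC t * h)%C <> 0) by (apply Re_neq_0; lra).
    replace (h * / (s + RtoC t * h) - / s * h)%C with (- RtoC t * (h * h) * / s * / (s + RtoC t * h))%C
      by (field; split; assumption).
    rewrite !Cmod_mult, !Cmod_inv, Cmod_opp, Cmod_R, Rabs_pos_eq by (assumption || lra).
    pose proof (Cmod_ge_0 h) as Ph.
    assert (A1 : / Cmod s <= / Re s) by (apply Rinv_le_contravar; [assumption|apply Re_le]).
    assert (A2 : / Cmod (s + RtoC t * h)%C <= 2 / Re s).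
    { replace (2 / Re s) with (/ (Re s / 2)) by (field; lra).
      apply Rinv_le_contravar; [lra|]. pose proof (Re_le (s + RtoC t * h)%C). lra. }
    assert (A3 : 0 < / Cmod s) by (apply Rinv_0_lt_compat, Cmod_gt_0, Hs0).
    assert (A4 : 0 < / Cmod (s + RtoC t * h)%C) by (apply Rinv_0_lt_compat, Cmod_gt_0, N).
    apply Rle_trans with (1 * (Cmod h * Cmod h) * / Re s * (2 / Re s)).
    + assert (0 <= Cmod h * Cmod h) by nra.
      assert (0 <= t * (Cmod h * Cmod h)) by nra.
      apply Rmult_le_compat; try lra; [apply Rmult_le_pos; lra|].
      apply Rmult_le_compat; try lra. apply Rmult_le_compat; lra.
    + right. field. lra.
Qed.

Lemma Clog_1 : Clog 1 = 0.
Proof.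
  unfold Clog. rewrite Cmod_1, ln_1, Carg_right by (simpl; lra).
  simpl. replace (0 / 1) with 0 by field. now rewrite atan_0.
Qed.

(** [log(1 + v)] is the integral of [v / (1 + t v)] over [[0, 1]], dominated by [|v| / (1 - t |v|)],
    which has an explicit primitive. *)
Lemma Clog_1p_bound (v : C) : Cmod v < 1 -> Cmod (Clog (1 + v)%C) <= - ln (1 - Cmod v).
Proof.
  intros Hv. pose proof (Cmod_ge_0 v) as Pv.
  assert (Hseg : forall t, 0 <= t <= 1 -> 0 < Re (1 + RtoC t * v)%C).
  { intros t Ht. pose proof (Re_segment 1 v t Ht). simpl (Re 1) in H. lra. }
  assert (Pt : forall t, 0 <= t <= 1 -> 0 < 1 - t * Cmod v) by (intros; nra).
  pose proof (CI_bound_derive (fun t => v * / (1 + RtoC t * v))%C (fun t => - ln (1 - t * Cmod v))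
    (fun t => Cmod v / (1 - t * Cmod v)) 0 1 (Clog (1 + RtoC 1 * v) - Clog (1 + RtoC 0 * v))%C) as K.
  replace (1 + RtoC 0 * v)%C with (RtoC 1) in K by ring. rewrite Clog_1 in K.
  replace (1 + RtoC 1 * v)%C with (1 + v)%C in K by ring.
  replace (Clog (1 + v) - 0)%C with (Clog (1 + v)%C) in K by ring.
  rewrite Rmult_0_l, Rminus_0_r, ln_1, Rmult_1_l, Ropp_0, Rminus_0_r in K.
  apply K; clear K; [lra|..].
  - intros t Ht. rewrite Cmod_mult, Cmod_inv by (apply Re_neq_0, Hseg, Ht).
    apply Rmult_le_compat_l; [assumption|]. apply Rinv_le_contravar; [apply Pt, Ht|].
    pose proof (Cmod_reverse_triangle 1 (RtoC t * v)) as Q.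
    rewrite Cmod_1, Cmod_mult, Cmod_R, Rabs_pos_eq in Q by lra. exact Q.
  - intros t Ht. specialize (Pt t Ht). split.
    + auto_derive; [lra|]. field. lra.
    + apply (@ex_derive_continuous R_AbsRing R_NormedModule). auto_derive. lra.
  - apply (CI_ext (fun t => v / (1 + RtoC t * v))%C); [reflexivity|].
    replace (Clog (1 + v)%C) with (Clog (1 + RtoC 1 * v) - Clog (1 + RtoC 0 * v))%C.
    2: { replace (1 + RtoC 0 * v)%C with (RtoC 1) by ring. rewrite Clog_1.
         replace (1 + RtoC 1 * v)%C with (1 + v)%C by ring. ring. }
    apply (CI_FTC (fun t => Clog (1 + RtoC t * v)%C)); rewrite Rmin_left, Rmax_right by lra; intros t Ht.
    + apply cder_Clog_line, Hseg, Ht.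
    + apply ccont_mult; [apply ccont_const|]. apply ccont_inv; [apply Re_neq_0, Hseg, Ht|apply ccont_line].
Qed.

(** Positive scaling stays in the right half-plane, where the argument is the arctangent of a ratio
    that scaling leaves alone; no multiple of [2 PI] can appear. *)
Lemma Clog_scal (s : R) (u : C) : 0 < s -> 0 < Re u -> Clog (RtoC s * u)%C = (RtoC (ln s) + Clog u)%C.
Proof.
  intros Hs Hu. assert (Hm : 0 < Cmod u) by (apply Cmod_gt_0, Re_neq_0, Hu).
  unfold Clog. rewrite Cmod_mult, Cmod_R, Rabs_pos_eq by lra. rewrite ln_mult by assumption.
  assert (Re (RtoC s * u)%C = s * Re u) as E1 by (destruct u; simpl; ring).
  assert (Im (RtoC s * u)%C = s * Im u) as E2 by (destruct u; simpl; ring).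
  rewrite !Carg_right by (try rewrite E1; try apply Rmult_lt_0_compat; assumption).
  rewrite E1, E2. replace (s * Im u / (s * Re u)) with (Im u / Re u) by (field; split; lra).
  apply injective_projections; simpl; ring.
Qed.

Lemma Clog_RtoC (s : R) : 0 < s -> Clog (RtoC s) = RtoC (ln s).
Proof.
  intros Hs. replace (RtoC s) with (RtoC s * 1)%C by ring.
  rewrite Clog_scal, Clog_1 by (simpl; lra). ring.
Qed.

(** The disc of centre [s] and radius [s] touches the disc [|u - 1| < 1] from inside at 0. Circles
    about [s] of any relative radius below 1 are thus admissible, which makes the estimates uniform
    in [s]. *)
Lemma scaled_disc (s : R) (v : C) : 0 < s <= 1 -> Cmod v < 1 -> Cmod (RtoC s * (1 + v) - 1)%C < 1.
Proof.
  intros Hs Hv. replace (RtoC s * (1 + v) - 1)%C with (RtoC (s - 1) + RtoC s * v)%C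
    by (rewrite RtoC_minus; ring).
  eapply Rle_lt_trans; [apply Cmod_triangle|]. rewrite Cmod_mult, !Cmod_R.
  rewrite (Rabs_left1 (s - 1)), (Rabs_pos_eq s) by lra. nra.
Qed.

Definition phi (F : C -> C) (lam : R) (s : C) : C := F (RtoC lam * - Clog s)%C.

Lemma phi_domain (lam : R) (s : C) : Cmod (s - 1)%C < 1 -> Delta_lam lam (RtoC lam * - Clog s)%C.
Proof. intros H. exists (- Clog s)%C. split; [|reflexivity]. now exists s. Qed.

Lemma phi_holo (F : C -> C) (lam : R) :
  (forall zeta : C, Delta_lam lam zeta -> @ex_derive C_AbsRing C_NormedModule F zeta) ->
  holo_on (phi F lam) (fun s => Cmod (s - 1)%C < 1).
Proof.
  intros HF s Hs. destruct (HF _ (phi_domain lam s Hs)) as [l Hl].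
  apply is_derive_Cdiff in Hl. exists (l * (- RtoC lam * / s))%C.
  apply (Cdiff_comp F (fun s => RtoC lam * - Clog s)%C s l); [exact Hl|].
  apply (Cdiff_ext_loc (fun y => - RtoC lam * Clog y)%C) with 1; [lra|intros; ring|].
  apply Cdiff_scal, Clog_diff, Re_pos_disc, Hs.
Qed.

Lemma phi_bound (F : C -> C) (lam A B s : R) (v : C) :
  0 < lam -> 0 < A -> 0 < B ->
  (forall zeta : C, Delta_lam lam zeta -> Cmod (F zeta) <= A * exp (B * Cmod zeta)) ->
  0 < s <= 1 -> Cmod v < 1 ->
  Cmod (phi F lam (RtoC s * (1 + v))%C) <= A * exp (- (lam * B) * ln s) * exp (lam * B * Cmod (Clog (1 + v)%C)).
Proof.
  intros Hl HA HB HF Hs Hv. unfold phi.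
  eapply Rle_trans; [apply HF, phi_domain, scaled_disc; assumption|].
  assert (Hre : 0 < Re (1 + v)%C).
  { pose proof (Re_le_Cmod v) as K. apply Rabs_le_between in K. destruct v; simpl in *. lra. }
  rewrite Clog_scal by (assumption || lra).
  rewrite Cmod_mult, Cmod_R, Cmod_opp, Rabs_pos_eq by lra.
  rewrite Rmult_assoc, <- exp_plus. apply Rmult_le_compat_l; [lra|].
  assert (Hln : ln s <= 0) by (rewrite <- ln_1; apply ln_le; lra).
  pose proof (Cmod_triangle (RtoC (ln s)) (Clog (1 + v)%C)) as T.
  rewrite Cmod_R, Rabs_left1 in T by assumption.
  assert (E : B * (lam * Cmod (RtoC (ln s) + Clog (1 + v))%C) <=
    - (lam * B) * ln s + lam * B * Cmod (Clog (1 + v)%C)).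
  { replace (- (lam * B) * ln s + lam * B * Cmod (Clog (1 + v)%C)) with
      (lam * B * (- ln s + Cmod (Clog (1 + v)%C))) by ring.
    replace (B * (lam * Cmod (RtoC (ln s) + Clog (1 + v))%C)) with
      (lam * B * Cmod (RtoC (ln s) + Clog (1 + v))%C) by ring.
    apply Rmult_le_compat_l; [apply Rlt_le, Rmult_lt_0_compat; assumption|assumption]. }
  destruct E as [E|E]; [left; now apply exp_increasing|right; now rewrite E].
Qed.

(** The majorant [g] on the circle is left free: a constant gives the supremum estimate behind (ii),
    a function peaked at [t = PI] the mean estimate behind (i). The powers of [s] from the radius
    [al s] cancel against [s ^ n]. *)
Lemma phi_derivative_bound (F : C -> C) (lam A B s al m : R) (g : R -> R) (n : nat) :
  0 < lam -> 0 < A -> 0 < B ->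
  (forall zeta : C, Delta_lam lam zeta -> @ex_derive C_AbsRing C_NormedModule F zeta) ->
  (forall zeta : C, Delta_lam lam zeta -> Cmod (F zeta) <= A * exp (B * Cmod zeta)) ->
  0 < s <= 1 -> 0 < al < 1 ->
  (forall t, 0 <= t <= 2 * PI -> exp (lam * B * Cmod (Clog (1 + circ al t)%C)) <= g t) ->
  is_RInt g 0 (2 * PI) m ->
  s ^ n * Cmod (Cderiv_n n (phi F lam) (RtoC s)) <=
    INR (fact n) * (/ al) ^ n * (A * exp (- (lam * B) * ln s)) * (m / (2 * PI)).
Proof.
  intros Hl HA HB HF HF2 Hs Hal Hg Hm. pose proof PI_RGT_0 as Hpi.
  assert (Hr : 0 < s * al) by (apply Rmult_lt_0_compat; lra).
  assert (Ecirc : forall t, (RtoC s + circ (s * al) t)%C = (RtoC s * (1 + circ al t))%C).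
  { intros t. apply injective_projections; simpl; ring. }
  assert (Hol : holo_on (phi F lam) (fun y => Cmod (y - RtoC s)%C <= s * al)).
  { intros y Hy. apply phi_holo; [assumption|].
    replace (y - 1)%C with ((y - RtoC s) + RtoC (s - 1))%C by (rewrite RtoC_minus; ring).
    eapply Rle_lt_trans; [apply Cmod_triangle|]. rewrite Cmod_R, Rabs_left1 by lra. nra. }
  pose proof (cauchy_coefficient (phi F lam) (RtoC s) (s * al) n Hr Hol) as K.
  set (D := Cderiv_n n (phi F lam) (RtoC s)) in *.
  pose proof (INR_fact_lt_0 n) as Hn.
  set (Q := A * exp (- (lam * B) * ln s)).
  assert (HQ : 0 <= Q) by (apply Rmult_le_pos; [lra|apply Rlt_le, exp_pos]).
  assert (Hp : 0 < (/ (s * al)) ^ n) by (apply pow_lt, Rinv_0_lt_compat, Hr).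
  assert (Bd : Cmod (RtoC (2 * PI / INR (fact n)) * D)%C <= Q * (/ (s * al)) ^ n * m).
  { eapply CI_bound with (g := fun t => scal (Q * (/ (s * al)) ^ n) (g t)); [| |exact K|]; [lra| |].
    - intros t Ht. cbv beta. rewrite Cmod_mult, Cmod_pow, Cmod_inv, Cmod_circ by (lra || (apply Cmod_gt_0; rewrite Cmod_circ; lra)).
      unfold scal; simpl; unfold mult; simpl.
      replace (Q * (/ (s * al)) ^ n * g t) with (Q * g t * (/ (s * al)) ^ n) by ring.
      apply Rmult_le_compat_r; [lra|]. rewrite Ecirc.
      eapply Rle_trans; [apply (phi_bound F lam A B); try assumption; rewrite Cmod_circ; lra|].
      apply Rmult_le_compat_l; [assumption|apply (Hg t Ht)].
    - apply @is_RInt_scal. exact Hm. }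
  rewrite Cmod_mult, Cmod_R, Rabs_pos_eq in Bd by (apply Rlt_le, Rdiv_lt_0_compat; lra).
  apply Rmult_le_compat_l with (r := s ^ n * INR (fact n) / (2 * PI)) in Bd.
  2: { apply Rdiv_le_0_compat; [|lra]. apply Rmult_le_pos; [apply pow_le; lra|lra]. }
  replace (s ^ n * INR (fact n) / (2 * PI) * (2 * PI / INR (fact n) * Cmod D)) with (s ^ n * Cmod D) in Bd
    by (field; split; lra).
  eapply Rle_trans; [exact Bd|]. right.
  rewrite Rinv_mult, Rpow_mult_distr, (pow_inv s). field. split; [lra|]. apply pow_nonzero; lra.
Qed.

Lemma exp_le_compat x y : x <= y -> exp x <= exp y.
Proof. intros [H|H]; [left; now apply exp_increasing|right; now rewrite H]. Qed.

Lemma ln_le_compat x y : 0 < x -> x <= y -> ln x <= ln y.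
Proof. intros H [K|K]; [left; now apply ln_increasing|right; now rewrite K]. Qed.

Lemma exp_pow_INR x n : exp x ^ n = exp (INR n * x).
Proof.
  induction n as [|n IH]; [simpl; now rewrite Rmult_0_l, exp_0|].
  rewrite S_INR, <- tech_pow_Rmult, IH, <- exp_plus. f_equal. ring.
Qed.

Lemma phi_derivative_sup (F : C -> C) (lam A B s al : R) (n : nat) :
  0 < lam -> 0 < A -> 0 < B ->
  (forall zeta : C, Delta_lam lam zeta -> @ex_derive C_AbsRing C_NormedModule F zeta) ->
  (forall zeta : C, Delta_lam lam zeta -> Cmod (F zeta) <= A * exp (B * Cmod zeta)) ->
  0 < s <= 1 -> 0 < al < 1 ->
  s ^ n * Cmod (Cderiv_n n (phi F lam) (RtoC s)) <=
    INR (fact n) * (/ al) ^ n * (A * exp (- (lam * B) * ln s)) * exp (- (lam * B) * ln (1 - al)).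
Proof.
  intros Hl HA HB HF HF2 Hs Hal. pose proof PI_RGT_0 as Hpi.
  eapply Rle_trans.
  - apply (phi_derivative_bound F lam A B s al (scal (2 * PI - 0) (exp (- (lam * B) * ln (1 - al))))
      (fun _ => exp (- (lam * B) * ln (1 - al)))); try assumption; [|apply @is_RInt_const].
    intros t _. apply exp_le_compat.
    assert (K : Cmod (Clog (1 + circ al t)%C) <= - ln (1 - al)).
    { rewrite <- (Cmod_circ al t) at 2 by lra. apply Clog_1p_bound. rewrite Cmod_circ; lra. }
    assert (0 < lam * B) by (apply Rmult_lt_0_compat; assumption). nra.
  - right. unfold scal; simpl; unfold mult; simpl. field. lra.
Qed.

(** From [w - w^3/6 <= sin w] and [w^2 <= 4]. The constant is not sharp; only a linear lower bound
    matters. *)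
Lemma sin_ge_third w : 0 <= w <= PI / 2 -> w / 3 <= sin w.
Proof.
  intros Hw. pose proof PI_4. pose proof PI_RGT_0.
  destruct (sin_bound w 0) as [K _]; [lra|lra|].
  unfold sin_approx, sin_term in K. simpl in K.
  assert (E : w - w * w * w / 6 <= sin w) by (eapply Rle_trans; [|exact K]; right; field).
  assert (w * w <= 4) by nra. nra.
Qed.

(** With [w = |t - PI| / 2] the squared modulus is [(1 - al)^2 + 4 al sin^2 w], so the distance to
    the singular point is comparable to [1 - al] plus the angular distance. *)
Lemma circ_distance al t : 1 / 2 <= al < 1 -> 0 <= t <= 2 * PI ->
  (1 - al + Rabs (t - PI)) / 6 <= Cmod (1 + circ al t)%C.
Proof.
  intros Hal Ht. set (w := Rabs (t - PI) / 2).
  assert (Hw : 0 <= w <= PI / 2).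
  { unfold w. pose proof (Rabs_pos (t - PI)). split; [lra|].
    assert (Rabs (t - PI) <= PI) by (apply Rabs_le; lra). lra. }
  pose proof (sin_ge_third w Hw) as S.
  assert (Ec : 1 + cos t = 2 * (sin w * sin w)).
  { assert (cos (2 * w) = - cos t) as E.
    { replace (2 * w) with (Rabs (t - PI)) by (unfold w; field).
      unfold Rabs. destruct Rcase_abs.
      - replace (- (t - PI)) with (- t + PI) by ring. rewrite neg_cos, cos_neg. reflexivity.
      - rewrite <- (cos_neg (t - PI)). replace (- (t - PI)) with (- t + PI) by ring. rewrite neg_cos, cos_neg. reflexivity. }
    rewrite cos_2a_sin in E. lra. }
  assert (Em : Cmod (1 + circ al t)%C * Cmod (1 + circ al t)%C = (1 - al) * (1 - al) + 4 * al * (sin w * sin w)).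
  { pose proof (Cmod2_alt (1 + circ al t)%C) as K. simpl in K. rewrite Rmult_1_r in K. rewrite K.
    replace ((1 - al) * (1 - al) + 4 * al * (sin w * sin w)) with ((1 - al) * (1 - al) + 2 * al * (1 + cos t)) by (rewrite Ec; ring).
    pose proof (sin2_cos2 t) as SC. unfold Rsqr in SC. nra. }
  pose proof (Cmod_ge_0 (1 + circ al t)%C) as P.
  (* Origin of the 6: since [al >= 1/2], the sine term is at least [2 w^2 / 9], and [(1 - al + 2
     w)^2 / 36 <= (1 - al)^2 / 18 + 2 w^2 / 9]. *)
  apply Rnot_lt_le. intros Hlt.
  replace (Rabs (t - PI)) with (2 * w) in Hlt by (unfold w; field).
  set (M := Cmod (1 + circ al t)%C) in *.
  assert (S2 : w * w / 9 <= sin w * sin w) by nra.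
  assert (M2 : M * M < (1 - al + 2 * w) / 6 * ((1 - al + 2 * w) / 6)) by nra.
  assert (al * (w * w / 9) <= al * (sin w * sin w)) by (apply Rmult_le_compat_l; lra).
  assert (1 / 2 * (w * w / 9) <= al * (w * w / 9)) by (apply Rmult_le_compat_r; nra).
  pose proof (Rle_0_sqr (1 - al - 2 * w)) as Q1. pose proof (Rle_0_sqr (1 - al)) as Q2. unfold Rsqr in Q1, Q2.
  lra.
Qed.

(** The logarithm is within a constant of [- ln |u|], and [|u|] is bounded below by [circ_distance].
    The exponent is raised from [b] to [c] because the mean is computed below for an exponent
    greater than 1. *)
Lemma exp_Clog_bound b c al t : 0 < b <= c -> 1 / 2 <= al < 1 -> 0 <= t <= 2 * PI ->
  exp (b * Cmod (Clog (1 + circ al t)%C)) <=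
  exp (c * (2 * ln 2 + ln 6 + 2)) * exp (- c * ln (1 - al + Rabs (t - PI))).
Proof.
  intros Hb Hal Ht. rewrite <- exp_plus. apply exp_le_compat.
  pose proof (circ_distance al t Hal Ht) as K.
  set (q := 1 - al + Rabs (t - PI)) in *.
  assert (Hq : 0 < q) by (unfold q; pose proof (Rabs_pos (t - PI)); lra).
  set (u := (1 + circ al t)%C) in *.
  assert (Hu : 0 < Cmod u) by lra.
  assert (Hu2 : Cmod u <= 2).
  { unfold u. eapply Rle_trans; [apply Cmod_triangle|]. rewrite Cmod_1, Cmod_circ; lra. }
  assert (Hre : 0 < Re u).
  { pose proof (Re_le_Cmod (circ al t)) as J. rewrite Cmod_circ in J by lra. apply Rabs_le_between in J.
    unfold u. change (Re (1 + circ al t)%C) with (1 + Re (circ al t)). lra. }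
  assert (L2 : 0 < ln 2) by (rewrite <- ln_1; apply ln_increasing; lra).
  assert (Lu : ln q - ln 6 <= ln (Cmod u)).
  { rewrite <- ln_div by lra. apply ln_le_compat; [lra|exact K]. }
  assert (Lu2 : ln (Cmod u) <= ln 2) by (apply ln_le_compat; assumption).
  (* Since [|u| <= 2], the absolute value of [ln |u|] is at most [2 ln 2 - ln |u|]; the final 2
     bounds the argument, which is below [PI / 2]. *)
  assert (Cl : Cmod (Clog u) <= 2 * ln 2 - ln (Cmod u) + 2).
  { eapply Rle_trans; [apply Cmod_le_abs|]. unfold Clog; cbn [Re Im fst snd].
    apply Rplus_le_compat.
    - apply Rabs_le; lra.
    - rewrite Carg_right by assumption. pose proof (atan_bound (Im u / Re u)). pose proof PI_4.
      apply Rabs_le; lra. }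
  pose proof (Cmod_ge_0 (Clog u)).
  apply Rle_trans with (c * Cmod (Clog u)); [apply Rmult_le_compat_r; lra|].
  apply Rle_trans with (c * (2 * ln 2 + ln 6 + 2 - ln q)); [apply Rmult_le_compat_l; lra|]. right; ring.
Qed.

(** The power is integrated explicitly on each side of [PI]. As [c > 1], the contributions of the
    far ends have a favourable sign and are dropped, which leaves twice the value of the primitive
    at the peak. *)
Lemma mean_bound c K al : 1 < c -> 0 <= K -> 0 < al < 1 ->
  exists m, is_RInt (fun t => K * exp (- c * ln (1 - al + Rabs (t - PI)))) 0 (2 * PI) m /\
    m <= 2 * K / (c - 1) * exp ((1 - c) * ln (1 - al)).
Proof.
  intros Hc HK Hal. pose proof PI_RGT_0 as Hpi. set (d := 1 - al).
  assert (Hd : 0 < d) by (unfold d; lra).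
  set (H1 := fun t => K / (c - 1) * exp ((1 - c) * ln (d + (PI - t)))).
  set (H2 := fun t => - (K / (c - 1)) * exp ((1 - c) * ln (d + (t - PI)))).
  assert (E : forall y, 0 < y -> exp ((1 - c) * ln y) / y = exp (- c * ln y)).
  { intros y Hy. rewrite <- (exp_ln y) at 2 by assumption. unfold Rdiv. rewrite <- exp_Ropp, <- exp_plus. f_equal. ring. }
  assert (I1 : is_RInt (fun t => K * exp (- c * ln (d + Rabs (t - PI)))) 0 PI (H1 PI - H1 0)).
  { apply (is_RInt_ext (fun t => K * exp (- c * ln (d + (PI - t))))).
    - intros t Ht. rewrite Rmin_left, Rmax_right in Ht by lra. rewrite Rabs_left1 by lra. do 4 f_equal. ring.
    - apply (@is_RInt_derive R_CompleteNormedModule H1); rewrite Rmin_left, Rmax_right by lra; intros t Ht.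
      + unfold H1. auto_derive; [lra|]. rewrite <- E by lra. unfold Rminus. field. lra.
      + apply (@ex_derive_continuous R_AbsRing R_NormedModule). auto_derive. lra. }
  assert (I2 : is_RInt (fun t => K * exp (- c * ln (d + Rabs (t - PI)))) PI (2 * PI) (H2 (2 * PI) - H2 PI)).
  { apply (is_RInt_ext (fun t => K * exp (- c * ln (d + (t - PI))))).
    - intros t Ht. rewrite Rmin_left, Rmax_right in Ht by lra. rewrite Rabs_pos_eq by lra. reflexivity.
    - apply (@is_RInt_derive R_CompleteNormedModule H2); rewrite Rmin_left, Rmax_right by lra; intros t Ht.
      + unfold H2. auto_derive; [lra|]. rewrite <- E by lra. unfold Rminus. field. lra.
      + apply (@ex_derive_continuous R_AbsRing R_NormedModule). auto_derive. lra. }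
  exists ((H1 PI - H1 0) + (H2 (2 * PI) - H2 PI)). split.
  - exact (is_RInt_Chasles _ _ _ _ _ _ I1 I2).
  - unfold H1, H2. replace (d + (PI - PI)) with d by ring.
    assert (Q : 0 <= K / (c - 1)) by (apply Rdiv_le_0_compat; lra).
    pose proof (Rmult_le_pos _ _ Q (Rlt_le _ _ (exp_pos ((1 - c) * ln (d + (PI - 0)))))).
    pose proof (Rmult_le_pos _ _ Q (Rlt_le _ _ (exp_pos ((1 - c) * ln (d + (2 * PI - PI)))))).
    replace (2 * K / (c - 1) * exp ((1 - c) * ln d)) with
      (K / (c - 1) * exp ((1 - c) * ln d) + K / (c - 1) * exp ((1 - c) * ln d)) by (field; lra).
    lra.
Qed.

(* Cauchy's estimate on the circle of relative radius [(n+1)/(n+2)]; [phi] is large only near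
   [s = 0], so averaging over the circle gains a factor [n] over the supremum. *)
Lemma phi_derivative_mean (F : C -> C) (lam A B c : R) :
  0 < lam -> 0 < A -> 0 < B ->
  (forall zeta : C, Delta_lam lam zeta -> @ex_derive C_AbsRing C_NormedModule F zeta) ->
  (forall zeta : C, Delta_lam lam zeta -> Cmod (F zeta) <= A * exp (B * Cmod zeta)) ->
  1 < c -> lam * B <= c ->
  exists M, 0 < M /\ forall n s, 0 < s <= 1 ->
  s ^ n * Cmod (Cderiv_n n (phi F lam) (RtoC s)) <=
    M * (INR (fact n) * exp ((c - 1) * ln (INR n + 2))) * exp (- (lam * B) * ln s).
Proof.
  intros Hl HA HB HF HF2 Hc Hlc. pose proof PI_RGT_0 as Hpi.
  assert (HlB : 0 < lam * B) by (apply Rmult_lt_0_compat; assumption).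
  set (K := exp (c * (2 * ln 2 + ln 6 + 2))). assert (HK : 0 < K) by apply exp_pos.
  exists (exp 1 * A * (2 * K / (c - 1)) / (2 * PI)). split.
  { apply Rdiv_lt_0_compat; [|lra]. apply Rmult_lt_0_compat.
    - apply Rmult_lt_0_compat; [apply exp_pos|assumption].
    - apply Rdiv_lt_0_compat; lra. }
  intros n s Hs. pose proof (pos_INR n) as Hn.
  (* With this radius [(1/al)^n = (1 + 1/(n+1))^n <= e], while [(1 - al)^(1 - c)] becomes
     [(n + 2)^(c - 1)]. *)
  set (al := (INR n + 1) / (INR n + 2)).
  assert (Eal : 1 - al = / (INR n + 2)) by (unfold al; field; lra).
  assert (Hal : 1 / 2 <= al < 1).
  { assert (0 < / (INR n + 2) <= / 2).
    { split; [apply Rinv_0_lt_compat; lra|apply Rinv_le_contravar; lra]. }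
    lra. }
  destruct (mean_bound c K al Hc (Rlt_le _ _ HK) ltac:(lra)) as [m [Hm Hmb]].
  eapply Rle_trans.
  - apply (phi_derivative_bound F lam A B s al m
      (fun t => K * exp (- c * ln (1 - al + Rabs (t - PI))))); try assumption; [lra|].
    intros t Ht. apply exp_Clog_bound; [lra|assumption|assumption].
  - assert (Hpow : (/ al) ^ n <= exp 1).
    { assert (E : / al = 1 + / (INR n + 1)) by (unfold al; field; lra).
      rewrite E. apply Rle_trans with (exp (/ (INR n + 1)) ^ n).
      - apply pow_incr. split; [|apply exp_ineq1_le].
        assert (0 < / (INR n + 1)) by (apply Rinv_0_lt_compat; lra). lra.
      - rewrite exp_pow_INR. apply exp_le_compat.
        apply Rle_trans with (INR n * / (INR n + 1)); [right; ring|].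
        apply Rmult_le_reg_r with (INR n + 1); [lra|]. rewrite Rmult_assoc, Rinv_l by lra. lra. }
    rewrite Eal, ln_Rinv in Hmb by lra.
    replace ((1 - c) * - ln (INR n + 2)) with ((c - 1) * ln (INR n + 2)) in Hmb by ring.
    set (X := exp ((c - 1) * ln (INR n + 2))) in *. set (Y := exp (- (lam * B) * ln s)).
    assert (HY : 0 < Y) by apply exp_pos.
    pose proof (INR_fact_lt_0 n) as Hf.
    assert (Hp0 : 0 <= (/ al) ^ n) by (apply pow_le, Rlt_le, Rinv_0_lt_compat; lra).
    apply Rle_trans with (INR (fact n) * exp 1 * (A * Y) * (2 * K / (c - 1) * X / (2 * PI))).
    + assert (0 < A * Y) by (apply Rmult_lt_0_compat; assumption).
      apply Rle_trans with (INR (fact n) * (/ al) ^ n * (A * Y) * (2 * K / (c - 1) * X / (2 * PI))).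
      * apply Rmult_le_compat_l.
        -- apply Rmult_le_pos; [apply Rmult_le_pos; lra|lra].
        -- apply Rmult_le_compat_r; [apply Rlt_le, Rinv_0_lt_compat; lra|assumption].
      * apply Rmult_le_compat_r.
        -- apply Rdiv_le_0_compat; [|lra]. apply Rmult_le_pos; [apply Rdiv_le_0_compat; lra|apply Rlt_le, exp_pos].
        -- apply Rmult_le_compat_r; [lra|]. apply Rmult_le_compat_l; lra.
    + right. field. lra.
Qed.

(** * Improper integrals *)

Definition CIg (f : R -> C) (Fa Fb : (R -> Prop) -> Prop) (l : C) : Prop :=
  @is_RInt_gen C_R_NormedModule f Fa Fb l.

Lemma C_ball_Cmod (x y : C) (e : R) : Cmod (y - x)%C < e -> @ball C_R_NormedModule x e y.
Proof. intros H. apply (C_NormedModule_mixin_compat1 x y e H). Qed.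

Lemma Cmod_C_ball (x y : C) (e : posreal) : @ball C_R_NormedModule x e y -> Cmod (y - x)%C < 2 * e.
Proof.
  intros H. pose proof (C_NormedModule_mixin_compat2 x y e H) as K.
  eapply Rlt_le_trans; [exact K|]. apply Rmult_le_compat_r; [apply Rlt_le, cond_pos|].
  replace 2 with (sqrt (2 * 2)) at 2 by (apply sqrt_square; lra). apply sqrt_le_1_alt. lra.
Qed.

Section Improper.

Variables Fa Fb : (R -> Prop) -> Prop.
Context {PFa : ProperFilter Fa} {PFb : ProperFilter Fb}.

Lemma CIg_eps f l : CIg f Fa Fb l <->
  (forall e, 0 < e -> filter_prod Fa Fb (fun ab => exists I, CI f (fst ab) (snd ab) I /\ Cmod (I - l)%C < e)).
Proof.
  split.
  (* The ball of the product space controls the modulus only up to the factor [sqrt 2], rounded up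
     to 2; hence the half. *)
  - intros H e He. assert (He2 : 0 < e / 2) by lra.
    specialize (H (fun y => @ball C_R_NormedModule l (e / 2) y)).
    assert (L : locally (T := C_R_NormedModule) l (fun y => @ball C_R_NormedModule l (e / 2) y)).
    { exists (mkposreal _ He2). intros y Hy. exact Hy. }
    specialize (H L). unfold filtermapi in H.
    eapply filter_imp; [|exact H]. intros [x y] [I [H1 H2]]. exists I. split; [exact H1|].
    pose proof (Cmod_C_ball l I (mkposreal _ He2) H2) as K. simpl in K. lra.
  - intros H P [e HP]. specialize (H e (cond_pos e)). unfold filtermapi.
    eapply filter_imp; [|exact H]. intros [x y] [I [H1 H2]]. exists I. split; [exact H1|].
    apply HP, C_ball_Cmod, H2.
Qed.

Lemma CIg_unique f l m : CIg f Fa Fb l -> CIg f Fa Fb m -> l = m.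
Proof.
  intros H1 H2.
  rewrite <- (@is_RInt_gen_unique C_R_CompleteNormedModule Fa Fb _ _ f l H1).
  apply (@is_RInt_gen_unique C_R_CompleteNormedModule Fa Fb _ _ f m H2).
Qed.

Lemma CIg_RInt_gen f l : CIg f Fa Fb l -> @RInt_gen C_R_CompleteNormedModule f Fa Fb = l.
Proof. apply (@is_RInt_gen_unique C_R_CompleteNormedModule Fa Fb _ _ f l). Qed.

Lemma CIg_plus f g l m : CIg f Fa Fb l -> CIg g Fa Fb m -> CIg (fun t => f t + g t)%C Fa Fb (l + m)%C.
Proof.
  rewrite !CIg_eps. intros H1 H2 e He.
  assert (He2 : 0 < e / 2) by lra.
  pose proof (filter_and _ _ (H1 _ He2) (H2 _ He2)) as H.
  eapply filter_imp; [|exact H]. intros [x y] [[I [A1 A2]] [J [B1 B2]]].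
  exists (I + J)%C. split; [apply CI_plus; assumption|].
  replace (I + J - (l + m))%C with ((I - l) + (J - m))%C by ring.
  eapply Rle_lt_trans; [apply Cmod_triangle|]. lra.
Qed.

Lemma CIg_scal c f l : CIg f Fa Fb l -> CIg (fun t => c * f t)%C Fa Fb (c * l)%C.
Proof.
  rewrite !CIg_eps. intros H e He. pose proof (Cmod_ge_0 c) as Hc.
  assert (Q : 0 < e / (Cmod c + 1)) by (apply Rdiv_lt_0_compat; lra).
  eapply filter_imp; [|exact (H _ Q)]. intros [x y] [I [A1 A2]].
  exists (c * I)%C. split; [apply CI_scal; assumption|].
  replace (c * I - c * l)%C with (c * (I - l))%C by ring. rewrite Cmod_mult.
  pose proof (Cmod_ge_0 (I - l)%C).
  apply Rle_lt_trans with ((Cmod c + 1) * Cmod (I - l)%C); [nra|].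
  apply Rmult_lt_compat_l with (r := Cmod c + 1) in A2; [|lra].
  replace ((Cmod c + 1) * (e / (Cmod c + 1))) with e in A2 by (field; lra). exact A2.
Qed.

(** A convex set on which the integrands behave well and to which both end filters eventually
    belong: the open half-line for Gamma, the closed one for Laplace integrals. *)
Variable D : R -> Prop.
Hypothesis Dconv : forall x y t, D x -> D y -> x <= t <= y -> D t.
Hypothesis DFa : Fa D.
Hypothesis DFb : Fb D.
Hypothesis Fab : filter_prod Fa Fb (fun ab => fst ab <= snd ab).

Lemma D_interval x y t : D x -> D y -> Rmin x y <= t <= Rmax x y -> D t.
Proof.
  intros Hx Hy. unfold Rmin, Rmax. destruct (Rle_dec x y); intros Ht.
  - apply (Dconv x y); assumption.
  - apply (Dconv y x); assumption.
Qed.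

Lemma filter_prod_D : filter_prod Fa Fb (fun ab => D (fst ab) /\ D (snd ab)).
Proof. apply Filter_prod with D D; auto. Qed.

Lemma CIg_ext f g l : (forall t, D t -> f t = g t) -> CIg f Fa Fb l -> CIg g Fa Fb l.
Proof.
  rewrite !CIg_eps. intros E H e He.
  eapply filter_imp; [|exact (filter_and _ _ filter_prod_D (H e He))].
  intros [x y] [[Dx Dy] [I [A1 A2]]]. exists I. split; [|exact A2].
  eapply CI_ext; [|exact A1]. intros t Ht. apply E. apply (D_interval x y); [assumption..|].
  cbn [fst snd] in Ht. lra.
Qed.

Lemma CIg_Re_le f g l m : (forall t, D t -> Re (f t) <= Re (g t)) ->
  CIg f Fa Fb l -> CIg g Fa Fb m -> Re l <= Re m.
Proof.
  rewrite !CIg_eps. intros E H1 H2. apply Rnot_lt_le. intros Hlt.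
  set (e := (Re l - Re m) / 2). assert (He : 0 < e) by (unfold e; lra).
  destruct (filter_ex _ (filter_and _ _ (filter_and _ _ filter_prod_D Fab) (filter_and _ _ (H1 e He) (H2 e He))))
    as [[x y] [[[Dx Dy] Hxy] [[I [A1 A2]] [J [B1 B2]]]]]. cbn [fst snd] in *.
  assert (K : Re I <= Re J).
  { apply (is_RInt_le (fun t => Re (f t)) (fun t => Re (g t)) x y); [assumption|apply CI_Re, A1|apply CI_Re, B1|].
    intros t Ht. apply E. apply (Dconv x y); [assumption..|lra]. }
  pose proof (Re_le_Cmod (I - l)%C) as K1. pose proof (Re_le_Cmod (J - m)%C) as K2.
  apply Rabs_le_between in K1. apply Rabs_le_between in K2.
  change (Re (I - l)%C) with (Re I - Re l) in K1. change (Re (J - m)%C) with (Re J - Re m) in K2.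
  unfold e in *. lra.
Qed.

Lemma CIg_FTC G f ga gb : (forall t, D t -> cder G t (f t)) -> (forall t, D t -> ccont f t) ->
  (forall e, 0 < e -> Fa (fun t => Cmod (G t - ga)%C < e)) ->
  (forall e, 0 < e -> Fb (fun t => Cmod (G t - gb)%C < e)) ->
  CIg f Fa Fb (gb - ga)%C.
Proof.
  intros H1 H2 Ha Hb. rewrite CIg_eps. intros e He.
  apply Filter_prod with (fun t => D t /\ Cmod (G t - ga)%C < e / 2) (fun t => D t /\ Cmod (G t - gb)%C < e / 2).
  - apply filter_and; [assumption|apply Ha; lra].
  - apply filter_and; [assumption|apply Hb; lra].
  - intros x y [Dx Hx] [Dy Hy]. cbn [fst snd]. exists (G y - G x)%C. split.
    + apply CI_FTC; intros t Ht; [apply H1|apply H2]; apply (D_interval x y); assumption.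
    + replace (G y - G x - (gb - ga))%C with ((G y - gb) + - (G x - ga))%C by ring.
      eapply Rle_lt_trans; [apply Cmod_triangle|]. rewrite Cmod_opp. lra.
Qed.

(** Domination is expressed by a primitive [H] of the majorant with limits at both ends. Changes of
    the truncated integrals are bounded by increments of [H], so the Cauchy criterion applies. *)
Lemma CIg_dominated f g H la lb :
  (forall t, D t -> ccont f t) -> (forall t, D t -> Cmod (f t) <= g t) ->
  (forall t, D t -> is_derive H t (g t) /\ continuous g t) ->
  (forall e, 0 < e -> Fa (fun t => Rabs (H t - la) < e)) ->
  (forall e, 0 < e -> Fb (fun t => Rabs (H t - lb) < e)) ->
  exists l, CIg f Fa Fb l /\ Cmod l <= lb - la.
Proof.
  intros Hf Hfg HH Ha Hb.
  set (I := (fun ab : R * R => @RInt C_R_CompleteNormedModule f (fst ab) (snd ab)) : R * R -> C).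
  assert (HI : forall x y, D x -> D y -> CI f x y (I (x, y))).
  { intros x y Dx Dy. apply (@RInt_correct C_R_CompleteNormedModule).
    destruct (CI_ex f x y) as [l Hl]; [|now exists l].
    intros t Ht. apply Hf. apply (D_interval x y); assumption. }
  assert (BI0 : forall x y, D x -> D y -> x <= y -> Cmod (I (x, y)) <= H y - H x).
  { intros x y Dx Dy Hxy. apply (CI_bound_derive f H g x y); [assumption|..|apply HI; assumption];
    intros t Ht; [apply Hfg|apply HH]; apply (Dconv x y); assumption. }
  assert (BI : forall x y, D x -> D y -> Cmod (I (x, y)) <= Rabs (H y - H x)).
  { intros x y Dx Dy. destruct (Rle_dec x y) as [Hxy|Hxy].
    - eapply Rle_trans; [apply BI0; assumption|apply Rle_abs].
    - replace (I (x, y)) with (- I (y, x))%C.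
      + rewrite Cmod_opp. eapply Rle_trans; [apply BI0; try assumption; lra|].
        rewrite Rabs_minus_sym. apply Rle_abs.
      + eapply CI_unique; [|apply (HI x y Dx Dy)].
        apply (@is_RInt_swap C_R_NormedModule f x y). apply HI; assumption. }
  assert (Hc : exists l : C, filterlim I (filter_prod Fa Fb) (locally (T := C_R_CompleteNormedModule) l)).
  { apply (filterlim_locally_cauchy (U := C_R_CompleteNormedModule)). intros e.
    exists (fun ab => (D (fst ab) /\ Rabs (H (fst ab) - la) < e / 4) /\ (D (snd ab) /\ Rabs (H (snd ab) - lb) < e / 4)).
    pose proof (cond_pos e) as He. split.
    - apply Filter_prod with (fun t => D t /\ Rabs (H t - la) < e / 4) (fun t => D t /\ Rabs (H t - lb) < e / 4).
      + apply filter_and; [assumption|apply Ha; lra].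
      + apply filter_and; [assumption|apply Hb; lra].
      + intros x y Hx Hy. split; assumption.
    - intros [x y] [x' y'] [[Dx Hx] [Dy Hy]] [[Dx' Hx'] [Dy' Hy']]. cbn [fst snd] in *.
      apply C_ball_Cmod.
      (* Two truncated integrals differ by two end pieces; each is below [e / 2], because [H] is
         within [e / 4] of its limit at both of its endpoints. *)
      assert (E : I (x', y') = (I (x', x) + I (x, y) + I (y, y'))%C).
      { eapply CI_unique; [apply HI; assumption|].
        eapply CI_Chasles; [eapply CI_Chasles|]; apply HI; assumption. }
      rewrite E. replace (I (x', x) + I (x, y) + I (y, y') - I (x, y))%C with (I (x', x) + I (y, y'))%C by ring.
      eapply Rle_lt_trans; [apply Cmod_triangle|].
      pose proof (BI x' x Dx' Dx) as B1. pose proof (BI y y' Dy Dy') as B2.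
      assert (Rabs (H x - H x') < e / 2).
      { replace (H x - H x') with ((H x - la) + - (H x' - la)) by ring.
        eapply Rle_lt_trans; [apply Rabs_triang|]. rewrite Rabs_Ropp. lra. }
      assert (Rabs (H y' - H y) < e / 2).
      { replace (H y' - H y) with ((H y' - lb) + - (H y - lb)) by ring.
        eapply Rle_lt_trans; [apply Rabs_triang|]. rewrite Rabs_Ropp. lra. }
      lra. }
  destruct Hc as [l Hl]. exists l.
  assert (HC : CIg f Fa Fb l).
  { intros P HP. specialize (Hl P HP). unfold filtermap in Hl. unfold filtermapi.
    eapply filter_imp; [|exact (filter_and _ _ filter_prod_D Hl)].
    intros [x y] [[Dx Dy] Hxy]. exists (I (x, y)). split; [apply HI; assumption|exact Hxy]. }
  split; [exact HC|].
  apply Rnot_lt_le. intros Hlt. set (e := (Cmod l - (lb - la)) / 4). assert (He : 0 < e) by (unfold e; lra).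
  rewrite CIg_eps in HC.
  assert (HF : filter_prod Fa Fb (fun ab => Rabs (H (fst ab) - la) < e /\ Rabs (H (snd ab) - lb) < e)).
  { apply Filter_prod with (fun t => Rabs (H t - la) < e) (fun t => Rabs (H t - lb) < e); auto. }
  destruct (filter_ex _ (filter_and _ _ (filter_and _ _ filter_prod_D Fab) (filter_and _ _ HF (HC e He))))
    as [[x y] [[[Dx Dy] Hxy] [[A1 A2] [J [B1 B2]]]]]. cbn [fst snd] in *.
  rewrite (CI_unique _ _ _ _ _ B1 (HI x y Dx Dy)) in B2.
  pose proof (BI0 x y Dx Dy Hxy) as B. apply Rabs_def2 in A1. apply Rabs_def2 in A2.
  pose proof (Cmod_triangle (I (x, y)) (- (I (x, y) - l))) as T. rewrite Cmod_opp in T.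
  replace (I (x, y) + - (I (x, y) - l))%C with l in T by ring. unfold e in *. lra.
Qed.

End Improper.

(** * The Gamma function *)

Lemma at_right_0_intro (P : R -> Prop) d : 0 < d -> (forall t, 0 < t < d -> P t) -> at_right 0 P.
Proof.
  intros Hd H. exists (mkposreal d Hd). intros t Ht Ht0. apply H.
  unfold ball in Ht; simpl in Ht. unfold AbsRing_ball, abs, minus, plus, opp in Ht; simpl in Ht.
  apply Rabs_def2 in Ht. lra.
Qed.

Lemma p_infty_intro (P : R -> Prop) M : (forall t, M < t -> P t) -> Rbar_locally p_infty P.
Proof. intros H. now exists M. Qed.

Lemma at_right_0_pos : at_right 0 (fun t => 0 < t).
Proof. apply at_right_0_intro with 1; [lra|intros; lra]. Qed.

Lemma p_infty_pos : Rbar_locally p_infty (fun t => 0 < t).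
Proof. apply p_infty_intro with 0; auto. Qed.

Lemma pos_convex x y t : 0 < x -> 0 < y -> x <= t <= y -> 0 < t.
Proof. lra. Qed.

Lemma at_right_0_le_p_infty : filter_prod (at_right 0) (Rbar_locally p_infty) (fun ab => fst ab <= snd ab).
Proof.
  apply Filter_prod with (fun t => t < 1) (fun t => 1 < t).
  - apply at_right_0_intro with 1; [lra|intros; lra].
  - apply p_infty_intro with 1; auto.
  - simpl; intros; lra.
Qed.

Definition Gint (w : C) (t : R) : C := (Cexp ((w - 1) * RtoC (ln t)) * RtoC (exp (- t)))%C.

Lemma Gint_eq (w : C) (t : R) : Gint w t =
  (exp ((Re w - 1) * ln t - t) * cos (Im w * ln t), exp ((Re w - 1) * ln t - t) * sin (Im w * ln t)).
Proof.
  unfold Gint, Cexp. destruct w as [x y]. cbn [Re Im fst snd].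
  replace ((x - 1) * ln t - t) with ((x - 1) * ln t + - t) by ring. rewrite exp_plus.
  apply injective_projections; simpl.
  - replace ((x + - (1)) * ln t - (y + - 0) * 0) with ((x - 1) * ln t) by ring.
    replace ((x + - (1)) * 0 + (y + - 0) * ln t) with (y * ln t) by ring. ring.
  - replace ((x + - (1)) * ln t - (y + - 0) * 0) with ((x - 1) * ln t) by ring.
    replace ((x + - (1)) * 0 + (y + - 0) * ln t) with (y * ln t) by ring. ring.
Qed.

Lemma Cmod_Gint w t : Cmod (Gint w t) = exp ((Re w - 1) * ln t - t).
Proof. rewrite Gint_eq. apply (Cmod_circ (exp ((Re w - 1) * ln t - t)) (Im w * ln t)). apply Rlt_le, exp_pos. Qed.

Lemma Gint_S w t : 0 < t -> Gint (w + 1)%C t = (RtoC t * Gint w t)%C.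
Proof.
  intros Ht. rewrite !Gint_eq. destruct w as [x y].
  assert (E : exp ((x + 1 - 1) * ln t - t) = t * exp ((x - 1) * ln t - t)).
  { rewrite <- (exp_ln t) at 3 by assumption. rewrite <- exp_plus. f_equal. ring. }
  apply injective_projections; simpl; rewrite Rplus_0_r, E; ring.
Qed.

Lemma cder_Gint w t : 0 < t -> cder (Gint (w + 1)%C) t (w * Gint w t - Gint (w + 1) t)%C.
Proof.
  intros Ht. apply (cder_ext (fun t => (exp ((Re (w + 1)%C - 1) * ln t - t) * cos (Im (w + 1)%C * ln t),
     exp ((Re (w + 1)%C - 1) * ln t - t) * sin (Im (w + 1)%C * ln t)))).
  { intros u. symmetry. apply Gint_eq. }
  rewrite Gint_S by assumption. rewrite Gint_eq. destruct w as [x y].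
  assert (E : exp ((x + 1 - 1) * ln t - t) = t * exp ((x - 1) * ln t - t)).
  { rewrite <- (exp_ln t) at 3 by assumption. rewrite <- exp_plus. f_equal. ring. }
  split; simpl.
  - auto_derive; [repeat split; assumption|].
    replace ((x + 1 - 1) * ln t + - t) with ((x + 1 - 1) * ln t - t) by ring. rewrite E.
    rewrite !Rplus_0_r. field. lra.
  - auto_derive; [repeat split; assumption|].
    replace ((x + 1 - 1) * ln t + - t) with ((x + 1 - 1) * ln t - t) by ring. rewrite E.
    rewrite !Rplus_0_r. field. lra.
Qed.

Lemma ccont_Gint w t : 0 < t -> ccont (Gint w) t.
Proof.
  intros Ht. eapply cder_ccont. eapply cder_ext; [|apply (cder_Gint (w - 1) t Ht)].
  intros u. cbv beta. f_equal. ring.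
Qed.

(* [x ln t <= x (ln (2x) - 1) + t/2], from [ln u <= u - 1] at [u = t/(2x)] *)
Lemma xln_bound x t : 0 < x -> 0 < t -> x * ln t <= x * ln (2 * x) - x + t / 2.
Proof.
  intros Hx Ht.
  assert (K : ln (t / (2 * x)) <= t / (2 * x) - 1).
  { assert (P : 0 < t / (2 * x)) by (apply Rdiv_lt_0_compat; lra).
    pose proof (exp_ineq1_le (ln (t / (2 * x)))) as Q. rewrite exp_ln in Q by assumption. lra. }
  rewrite ln_div in K by lra.
  apply Rmult_le_compat_l with (r := x) in K; [|lra].
  replace (x * (t / (2 * x) - 1)) with (t / 2 - x) in K by (field; lra). lra.
Qed.

Lemma xln_small x e : 0 < x -> 0 < e -> exists d, 0 < d /\ forall t, 0 < t < d -> exp (x * ln t) < e.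
Proof.
  intros Hx He. exists (exp (ln e / x)). split; [apply exp_pos|]. intros t Ht.
  rewrite <- (exp_ln e He). apply exp_increasing.
  assert (L : ln t < ln e / x) by (rewrite <- (ln_exp (ln e / x)); apply ln_increasing; lra).
  apply Rmult_lt_compat_l with (r := x) in L; [|assumption].
  replace (x * (ln e / x)) with (ln e) in L by (field; lra). exact L.
Qed.

Lemma xln_large x M : 0 < x -> 0 < M -> exists d, 0 < d /\ forall t, d < t -> M < exp (x * ln t).
Proof.
  intros Hx He. exists (exp (ln M / x)). split; [apply exp_pos|]. intros t Ht.
  rewrite <- (exp_ln M He). apply exp_increasing.
  assert (L : ln M / x < ln t) by (rewrite <- (ln_exp (ln M / x)); apply ln_increasing; [apply exp_pos|lra]).
  apply Rmult_lt_compat_l with (r := x) in L; [|assumption].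
  replace (x * (ln M / x)) with (ln M) in L by (field; lra). exact L.
Qed.

Lemma Gamma_converges w : 0 < Re w -> exists l, CIg (Gint w) (at_right 0) (Rbar_locally p_infty) l.
Proof.
  intros Hw. set (x := Re w) in *. set (K := exp (x * ln (2 * x) - x)).
  assert (HK : 0 < K) by apply exp_pos.
  (* [K] satisfies [t^x <= K exp(t/2)], so [exp(-t) (1 + t^x)^2 <= (1 + K)^2 = M x]. *)
  set (M := (1 + K) * (1 + K) / x).
  assert (HM : 0 < M) by (unfold M; apply Rdiv_lt_0_compat; nra).
  assert (HT : forall t, 0 < exp (x * ln t)) by (intros; apply exp_pos).
  (* dominated by the derivative of [M t^x / (1 + t^x)] *)
  destruct (CIg_dominated (at_right 0) (Rbar_locally p_infty) (fun t => 0 < t) pos_convex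
    at_right_0_pos p_infty_pos at_right_0_le_p_infty (Gint w)
    (fun t => M * (x * exp ((x - 1) * ln t) / ((1 + exp (x * ln t)) * (1 + exp (x * ln t)))))
    (fun t => M * (1 - / (1 + exp (x * ln t)))) 0 M) as [l [Hl _]]; [..|now exists l].
  - intros t Ht. now apply ccont_Gint.
  - intros t Ht. rewrite Cmod_Gint. fold x. specialize (HT t).
    assert (B : 1 + exp (x * ln t) <= (1 + K) * exp (t / 2)).
    { assert (1 <= exp (t / 2)) by (rewrite <- exp_0; apply exp_le_compat; lra).
      assert (exp (x * ln t) <= K * exp (t / 2)).
      { unfold K. rewrite <- exp_plus. apply exp_le_compat. apply xln_bound; assumption. }
      lra. }
    unfold Rminus at 1. rewrite exp_plus.
    replace (M * (x * exp ((x - 1) * ln t) / ((1 + exp (x * ln t)) * (1 + exp (x * ln t))))) with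
      (exp ((x - 1) * ln t) * (M * x / ((1 + exp (x * ln t)) * (1 + exp (x * ln t))))) by (field; lra).
    apply Rmult_le_compat_l; [apply Rlt_le, exp_pos|].
    replace (M * x) with ((1 + K) * (1 + K)) by (unfold M; field; lra).
    apply Rmult_le_reg_r with ((1 + exp (x * ln t)) * (1 + exp (x * ln t))); [nra|].
    unfold Rdiv. rewrite Rmult_assoc, Rinv_l, Rmult_1_r by nra.
    apply Rle_trans with (exp (- t) * (((1 + K) * exp (t / 2)) * ((1 + K) * exp (t / 2)))).
    + apply Rmult_le_compat_l; [apply Rlt_le, exp_pos|]. apply Rmult_le_compat; lra.
    + right. replace (exp (- t) * ((1 + K) * exp (t / 2) * ((1 + K) * exp (t / 2)))) with
       ((1 + K) * (1 + K) * (exp (- t) * (exp (t / 2) * exp (t / 2)))) by ring.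
      rewrite <- !exp_plus. replace (- t + (t / 2 + t / 2)) with 0 by field. rewrite exp_0. ring.
  - intros t Ht. specialize (HT t). split.
    + auto_derive; [repeat split; [assumption|lra]|].
      assert (E : exp (x * ln t) = t * exp ((x - 1) * ln t)).
      { rewrite <- (exp_ln t) at 2 by assumption. rewrite <- exp_plus. f_equal. ring. }
      rewrite E in *. field. split; lra.
    + apply (@ex_derive_continuous R_AbsRing R_NormedModule). auto_derive. repeat split; try assumption.
      assert (0 < (1 + exp (x * ln t)) * (1 + exp (x * ln t))) by nra. lra.
  - intros e He. destruct (xln_small x (e / M) Hw) as [d [Hd H]]; [apply Rdiv_lt_0_compat; assumption|].
    apply at_right_0_intro with d; [assumption|]. intros t Ht. specialize (H t Ht). specialize (HT t).
    replace (M * (1 - / (1 + exp (x * ln t))) - 0) with (M * (exp (x * ln t) / (1 + exp (x * ln t)))) by (field; lra).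
    rewrite Rabs_pos_eq.
    2: { apply Rmult_le_pos; [lra|]. apply Rdiv_le_0_compat; lra. }
    apply Rmult_lt_compat_l with (r := M) in H; [|assumption].
    replace (M * (e / M)) with e in H by (field; lra). eapply Rle_lt_trans; [|exact H].
    apply Rmult_le_compat_l; [lra|]. apply Rmult_le_reg_r with (1 + exp (x * ln t)); [lra|].
    unfold Rdiv. rewrite Rmult_assoc, Rinv_l by lra. nra.
  - intros e He. destruct (xln_large x (M / e) Hw) as [d [Hd H]]; [apply Rdiv_lt_0_compat; assumption|].
    apply p_infty_intro with d. intros t Ht. specialize (H t Ht). specialize (HT t).
    replace (M * (1 - / (1 + exp (x * ln t))) - M) with (- (M / (1 + exp (x * ln t)))) by (field; lra).
    rewrite Rabs_Ropp, Rabs_pos_eq by (apply Rdiv_le_0_compat; lra).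
    apply Rmult_lt_compat_r with (r := e) in H; [|assumption].
    replace (M / e * e) with M in H by (field; lra).
    apply Rmult_lt_reg_r with (1 + exp (x * ln t)); [lra|].
    unfold Rdiv. rewrite Rmult_assoc, Rinv_l by lra. nra.
Qed.

Lemma Cgamma_correct w : 0 < Re w -> CIg (Gint w) (at_right 0) (Rbar_locally p_infty) (Cgamma w).
Proof.
  intros Hw. destruct (Gamma_converges w Hw) as [l Hl].
  replace (Cgamma w) with l; [exact Hl|]. symmetry. exact (CIg_RInt_gen _ _ _ _ Hl).
Qed.

Lemma Gint_small_0 w e : 0 < Re w -> 0 < e -> at_right 0 (fun t => Cmod (Gint (w + 1) t - 0)%C < e).
Proof.
  intros Hw He. destruct (xln_small (Re w) e Hw He) as [d [Hd H]].
  apply at_right_0_intro with d; [assumption|]. intros t Ht.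
  replace (Gint (w + 1) t - 0)%C with (Gint (w + 1)%C t) by ring. rewrite Cmod_Gint.
  replace (Re (w + 1)%C) with (Re w + 1) by reflexivity.
  eapply Rle_lt_trans; [|apply (H t Ht)]. apply exp_le_compat. lra.
Qed.

Lemma Gint_small_infty w e : 0 < Re w -> 0 < e -> Rbar_locally p_infty (fun t => Cmod (Gint (w + 1) t - 0)%C < e).
Proof.
  intros Hw He. set (x := Re w) in *.
  apply p_infty_intro with (Rmax 0 (2 * (x * ln (2 * x) - x - ln e))). intros t Ht.
  pose proof (Rle_lt_trans _ _ _ (Rmax_l _ _) Ht). pose proof (Rle_lt_trans _ _ _ (Rmax_r _ _) Ht).
  replace (Gint (w + 1) t - 0)%C with (Gint (w + 1)%C t) by ring. rewrite Cmod_Gint.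
  replace (Re (w + 1)%C) with (x + 1) by reflexivity.
  rewrite <- (exp_ln e He). apply exp_increasing. pose proof (xln_bound x t Hw ltac:(assumption)). lra.
Qed.

(** Integration by parts: [t^w exp(-t)] has derivative [w t^(w-1) exp(-t) - t^w exp(-t)] and
    vanishes at both ends. *)
Lemma Cgamma_S w : 0 < Re w -> Cgamma (w + 1)%C = (w * Cgamma w)%C.
Proof.
  intros Hw.
  assert (Hw1 : 0 < Re (w + 1)%C) by (change (Re (w + 1)%C) with (Re w + 1); lra).
  assert (K1 : CIg (fun t => w * Gint w t - Gint (w + 1) t)%C (at_right 0) (Rbar_locally p_infty) (0 - 0)%C).
  { apply (CIg_FTC _ _ (fun t => 0 < t) pos_convex at_right_0_pos p_infty_pos (Gint (w + 1)%C)).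
    - intros t Ht. now apply cder_Gint.
    - intros t Ht. apply ccont_minus; [apply ccont_mult; [apply ccont_const|]|]; now apply ccont_Gint.
    - intros; now apply Gint_small_0.
    - intros; now apply Gint_small_infty. }
  pose proof (CIg_plus _ _ _ _ _ _ K1 (Cgamma_correct _ Hw1)) as K2.
  apply (CIg_ext _ _ (fun t => 0 < t) pos_convex at_right_0_pos p_infty_pos _ (fun t => w * Gint w t)%C) in K2.
  2: { intros t _. ring. }
  pose proof (CIg_unique _ _ _ _ _ K2 (CIg_scal _ _ w _ _ (Cgamma_correct _ Hw))) as E.
  rewrite <- E. ring.
Qed.

Lemma Cgamma_1 : Cgamma 1 = 1.
Proof.
  assert (H : 0 < Re 1) by (simpl; lra).
  assert (K : CIg (Gint 1) (at_right 0) (Rbar_locally p_infty) (0 - - (1))%C).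
  { apply (CIg_FTC _ _ (fun t => 0 < t) pos_convex at_right_0_pos p_infty_pos (fun t => RtoC (- exp (- t)))).
    - intros t Ht. eapply cder_eq; [apply (cder_RtoC (fun t => - exp (- t)) t (exp (- t)))|].
      + auto_derive; [exact I|ring].
      + rewrite Gint_eq. simpl. rewrite Rmult_0_l, cos_0, sin_0.
        apply injective_projections; simpl; [|ring].
        rewrite Rmult_1_r. f_equal. ring.
    - intros t Ht. now apply ccont_Gint.
    - intros e He. apply at_right_0_intro with e; [assumption|]. intros t Ht.
      replace (RtoC (- exp (- t)) - - (1))%C with (RtoC (1 - exp (- t))).
      2: { apply injective_projections; simpl; ring. }
      rewrite Cmod_R. pose proof (exp_ineq1_le (- t)).
      assert (exp (- t) <= 1) by (rewrite <- exp_0; apply exp_le_compat; lra).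
      rewrite Rabs_pos_eq; lra.
    - intros e He. apply p_infty_intro with (- ln e). intros t Ht.
      replace (RtoC (- exp (- t)) - 0)%C with (RtoC (- exp (- t))) by ring.
      rewrite Cmod_R, Rabs_Ropp, Rabs_pos_eq by (apply Rlt_le, exp_pos).
      rewrite <- (exp_ln e He). apply exp_increasing. lra. }
  rewrite (CIg_unique _ _ _ _ _ (Cgamma_correct _ H) K). ring.
Qed.

Lemma Cgamma_nat n : Cgamma (RtoC (INR (S n))) = RtoC (INR (fact n)).
Proof.
  induction n as [|n IH]; [simpl; apply Cgamma_1|].
  rewrite S_INR, RtoC_plus, Cgamma_S, IH, fact_simpl, mult_INR, RtoC_mult; [reflexivity|].
  change (0 < INR (S n)). apply lt_0_INR. lia.
Qed.

(** * Rising factorials and the non-vanishing of Gamma *)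

Fixpoint poch (w : C) (n : nat) : C :=
  match n with O => RtoC 1 | S m => (poch w m * (w + RtoC (INR m)))%C end.

Lemma Cgamma_poch w n : 0 < Re w -> Cgamma (w + RtoC (INR n))%C = (poch w n * Cgamma w)%C.
Proof.
  intros Hw. induction n as [|n IH].
  - simpl. replace (w + 0)%C with w by ring. ring.
  - rewrite S_INR, RtoC_plus, Cplus_assoc, Cgamma_S, IH.
    + simpl. ring.
    + change (Re (w + RtoC (INR n))%C) with (Re w + INR n). pose proof (pos_INR n). lra.
Qed.

Lemma sinh_ge q : 0 <= q -> 2 * q <= exp q - exp (- q).
Proof.
  intros [Hq|<-]; [|rewrite Ropp_0; lra].
  destruct (MVT_cor2 (fun q => exp q - exp (- q) - 2 * q) (fun q => exp q + exp (- q) - 2) 0 q Hq) as [c [E _]].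
  - intros c _. apply is_derive_Reals. auto_derive; [exact I|ring].
  - rewrite Ropp_0, exp_0 in E.
    pose proof (exp_ineq1_le c). pose proof (exp_ineq1_le (- c)). nra.
Qed.

(** With [q = |ln u| / 2], the right side is [(exp q - exp(-q))^2], and [2 sinh q >= 2 q]. *)
Lemma ln_sqr_bound u : 0 < u -> ln u * ln u <= u - 2 + / u.
Proof.
  intros Hu. set (q := Rabs (ln u) / 2).
  assert (Hq : 0 <= q) by (unfold q; pose proof (Rabs_pos (ln u)); lra).
  pose proof (sinh_ge q Hq) as S.
  assert (P : exp q * exp (- q) = 1) by (rewrite <- exp_plus, Rplus_opp_r; apply exp_0).
  assert (E : exp q * exp q + exp (- q) * exp (- q) = u + / u).
  { rewrite <- !exp_plus. replace (q + q) with (Rabs (ln u)) by (unfold q; field).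
    replace (- q + - q) with (- Rabs (ln u)) by (unfold q; field).
    unfold Rabs. destruct Rcase_abs.
    - rewrite Ropp_involutive, exp_Ropp, exp_ln by assumption. ring.
    - rewrite exp_Ropp, exp_ln by assumption. ring. }
  assert (L : ln u * ln u = 4 * (q * q)).
  { unfold q. replace (4 * (Rabs (ln u) / 2 * (Rabs (ln u) / 2))) with (Rsqr (Rabs (ln u))) by (unfold Rsqr; field).
    rewrite <- Rsqr_abs. reflexivity. }
  rewrite L. nra.
Qed.

Lemma cos_ge_quadratic v : 1 - v * v / 2 <= cos v.
Proof.
  replace v with (2 * (v / 2)) at 3 by field. rewrite cos_2a_sin.
  assert (K : sin (v / 2) * sin (v / 2) <= v / 2 * (v / 2)).
  { assert (A : Rabs (sin (v / 2)) <= Rabs (v / 2)).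
    { destruct (Rle_dec 0 (v / 2)) as [H|H].
      - rewrite (Rabs_pos_eq (v / 2)) by assumption. apply Rabs_le. pose proof (SIN_bound (v / 2)).
        destruct (Rle_dec 1 (v / 2)); [lra|].
        destruct H as [H|<-]; [|rewrite sin_0; lra].
        pose proof (sin_lt_x (v / 2) H). pose proof (sin_gt_0 (v / 2) H). pose proof PI2_1. lra.
      - rewrite (Rabs_left (v / 2)) by lra. set (y := - (v / 2)). replace (v / 2) with (- y) by (unfold y; ring).
        rewrite sin_neg. apply Rabs_le. pose proof (SIN_bound y).
        assert (H' : 0 < y) by (unfold y; lra).
        destruct (Rle_dec 1 y); [lra|].
        pose proof (sin_lt_x y H'). pose proof (sin_gt_0 y H'). pose proof PI2_1. lra. }
    pose proof (Rsqr_le_abs_1 _ _ A) as Q. exact Q. }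
  lra.
Qed.

Lemma Gint_RtoC x t : Gint (RtoC x) t = RtoC (exp ((x - 1) * ln t - t)).
Proof.
  rewrite Gint_eq. simpl. rewrite Rmult_0_l, cos_0, sin_0. apply injective_projections; simpl; ring.
Qed.

(** By convexity [t^(x-1) >= (x - 1) t - (x - 2)]; integrating against [exp(-t)] gives
    [(x - 1) Gamma(2) - (x - 2) Gamma(1) = 1]. *)
Lemma Gamma_ge_1 x : 2 <= x -> 1 <= Re (Cgamma (RtoC x)).
Proof.
  intros Hx.
  assert (H1 : 0 < Re 1) by (simpl; lra). assert (H2 : 0 < Re (1 + 1)%C) by (simpl; lra).
  assert (Hx0 : 0 < Re (RtoC x)) by (simpl; lra).
  pose proof (CIg_plus _ _ _ _ _ _ (CIg_scal _ _ (RtoC (x - 1)) _ _ (Cgamma_correct _ H2))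
     (CIg_scal _ _ (RtoC (- (x - 2))) _ _ (Cgamma_correct _ H1))) as K.
  replace 1 with (Re (RtoC (x - 1) * Cgamma (1 + 1) + RtoC (- (x - 2)) * Cgamma 1)%C).
  2: { rewrite Cgamma_S, Cgamma_1 by assumption. simpl. ring. }
  eapply (CIg_Re_le _ _ (fun t => 0 < t) pos_convex at_right_0_pos p_infty_pos at_right_0_le_p_infty);
    [|exact K|apply Cgamma_correct, Hx0].
  intros t Ht. cbv beta. rewrite Gint_S by assumption. rewrite !Gint_RtoC.
  replace ((x - 1) * ln t - t) with ((x - 2) * ln t + ln t + - t) by ring.
  replace ((1 - 1) * ln t - t) with (- t) by ring. rewrite !exp_plus, exp_ln by assumption.
  simpl.
  assert (B : t * (1 + (x - 2)) - (x - 2) <= exp ((x - 2) * ln t) * t).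
  { pose proof (exp_ineq1_le ((x - 2) * ln t)) as Q.
    assert (L : 1 - / t <= ln t).
    { pose proof (exp_ineq1_le (- ln t)) as Q2. rewrite exp_Ropp, exp_ln in Q2 by assumption. lra. }
    apply Rle_trans with ((1 + (x - 2) * (1 - / t)) * t); [right; field; lra|].
    apply Rmult_le_compat_r; [lra|]. nra. }
  apply Rmult_le_compat_l with (r := exp (- t)) in B; [|apply Rlt_le, exp_pos]. lra.
Qed.

(* For [w = x + i y] compare [x^{-iy} Gamma(w)] with [Gamma(x)]: the mass of [t^{x-1} e^{-t}]
   concentrates near [t = x], where [t^{iy}] is close to [x^{iy}]. *)
Lemma Cgamma_neq_0_large w : 2 + Im w * Im w <= Re w -> Cgamma w <> 0.
Proof.
  set (x := Re w). set (y := Im w). intros Hx.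
  assert (Hx2 : 2 <= x) by nra.
  assert (Hw : 0 < Re w) by (fold x; lra).
  (* This is [x^(-i y)]: it turns the phase of the integrand into [y ln(t/x)], which vanishes at
     [t = x]. *)
  set (c := (cos (y * ln x), - sin (y * ln x)) : C).
  assert (P0 : 0 < Re (RtoC x)) by (simpl; lra).
  assert (Pm : 0 < Re (RtoC (x - 1))) by (simpl; lra).
  assert (Pp : 0 < Re (RtoC x + 1)%C) by (simpl; lra).
  set (q := y * y / 2).
  assert (Hq : 0 <= q) by (unfold q; nra).
  pose proof (CIg_plus _ _ _ _ _ _
    (CIg_plus _ _ _ _ _ _ (CIg_scal _ _ (RtoC (1 + 2 * q)) _ _ (Cgamma_correct _ P0))
      (CIg_scal _ _ (RtoC (- (q / x))) _ _ (Cgamma_correct _ Pp)))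
    (CIg_scal _ _ (RtoC (- (q * x))) _ _ (Cgamma_correct _ Pm))) as K.
  pose proof (CIg_scal _ _ c _ _ (Cgamma_correct _ Hw)) as Kw.
  assert (Main : Re (RtoC (1 + 2 * q) * Cgamma (RtoC x) + RtoC (- (q / x)) * Cgamma (RtoC x + 1)
      + RtoC (- (q * x)) * Cgamma (RtoC (x - 1)))%C <= Re (c * Cgamma w)%C).
  { eapply (CIg_Re_le _ _ (fun t => 0 < t) pos_convex at_right_0_pos p_infty_pos at_right_0_le_p_infty);
      [|exact K|exact Kw].
    intros t Ht. cbv beta. rewrite Gint_S by assumption.
    assert (Em : (RtoC t * Gint (RtoC (x - 1)) t)%C = Gint (RtoC x) t).
    { rewrite <- Gint_S by assumption. f_equal. rewrite <- RtoC_plus. f_equal. ring. }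
    assert (Em' : Gint (RtoC (x - 1)) t = (RtoC (/ t) * Gint (RtoC x) t)%C).
    { rewrite <- Em, Cmult_assoc, <- RtoC_mult, Rinv_l by lra. ring. }
    rewrite Em', Gint_RtoC, Gint_eq. fold x y.
    set (e := exp ((x - 1) * ln t - t)). assert (He : 0 < e) by apply exp_pos.
    simpl.
    replace (cos (y * ln x) * (e * cos (y * ln t)) - - sin (y * ln x) * (e * sin (y * ln t)))
      with (e * cos (y * ln t - y * ln x)) by (rewrite cos_minus; ring).
    assert (L : ln (t / x) * ln (t / x) <= t / x - 2 + x / t).
    { replace (x / t) with (/ (t / x)) by (field; lra). apply ln_sqr_bound. apply Rdiv_lt_0_compat; lra. }
    rewrite ln_div in L by lra.
    pose proof (cos_ge_quadratic (y * ln t - y * ln x)) as Cq.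
    (* The cosine of the phase is at least [1 - q ln(t/x)^2], and [ln_sqr_bound] replaces the
       squared logarithm by [t/x - 2 + x/t], whose integral against [t^(x-1) exp(-t)] involves only
       neighbouring Gamma values. *)
    assert (B : 1 + 2 * q - q / x * t - q * x * / t <= cos (y * ln t - y * ln x)).
    { eapply Rle_trans; [|exact Cq].
      replace ((y * ln t - y * ln x) * (y * ln t - y * ln x) / 2) with (q * ((ln t - ln x) * (ln t - ln x)))
        by (unfold q; field).
      apply Rmult_le_compat_l with (r := q) in L; [|assumption].
      replace (1 + 2 * q - q / x * t - q * x * / t) with (1 - q * (t / x - 2 + x / t)) by (field; lra). lra. }
    apply Rmult_le_compat_l with (r := e) in B; [|lra]. eapply Rle_trans; [|exact B]. right. field. lra. }
  pose proof (Gamma_ge_1 x Hx2) as G1.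
  rewrite Cgamma_S in Main by assumption.
  assert (Em : Cgamma (RtoC (x - 1)) = (RtoC (/ (x - 1)) * Cgamma (RtoC x))%C).
  { replace (RtoC x) with (RtoC (x - 1) + 1)%C by (rewrite <- RtoC_plus; f_equal; ring).
    rewrite Cgamma_S by assumption. rewrite Cmult_assoc, <- RtoC_mult, Rinv_l by lra. ring. }
  rewrite Em in Main. intros E. rewrite E, Cmult_0_r in Main.
  set (g := Cgamma (RtoC x)) in *. clearbody g. simpl in Main. unfold Re in G1.
  (* By the functional equation the lower bound collapses to [Gamma(x) (1 - q/(x - 1))], and
     [y^2 <= x - 2] keeps the factor at least [1/2]. *)
  replace ((1 + 2 * q) * fst g - 0 * snd g + (- (q / x) * (x * fst g - 0 * snd g) - 0 * (x * snd g + 0 * fst g))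
    + (- (q * x) * (/ (x - 1) * fst g - 0 * snd g) - 0 * (/ (x - 1) * snd g + 0 * fst g)))
    with (fst g * (1 - q / (x - 1))) in Main by (field; lra).
  assert (q / (x - 1) <= 1 / 2).
  { apply Rmult_le_reg_r with (x - 1); [lra|]. unfold Rdiv. rewrite Rmult_assoc, Rinv_l by lra. unfold q. lra. }
  nra.
Qed.

Lemma poch_neq_0 w n : 0 < Re w -> poch w n <> 0.
Proof.
  intros Hw. induction n as [|n IH]; simpl; [exact C1_nz|].
  apply Cmult_neq_0; [exact IH|]. apply Re_neq_0.
  change (Re (w + RtoC (INR n))%C) with (Re w + INR n). pose proof (pos_INR n). lra.
Qed.

(** A zero at [w] would propagate to every [w + n], and for large [n] the real part exceeds any
    bound while the imaginary part is unchanged. *)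
Lemma Cgamma_neq_0 w : 0 < Re w -> Cgamma w <> 0.
Proof.
  intros Hw E. destruct (INR_unbounded (2 + Im w * Im w)) as [n Hn].
  apply (Cgamma_neq_0_large (w + RtoC (INR n))%C).
  - change (Re (w + RtoC (INR n))%C) with (Re w + INR n).
    change (Im (w + RtoC (INR n))%C) with (Im w + 0). rewrite Rplus_0_r. lra.
  - rewrite Cgamma_poch, E by assumption. ring.
Qed.

(** Non-vanishing is what allows [Cgamma w] to be cancelled here. *)
Lemma Cgamma_ratio w n : 0 < Re w ->
  (Cgamma w * Cgamma (RtoC (INR (S n))) / Cgamma (w + RtoC (INR (S n))))%C
  = (RtoC (INR (fact n)) / poch w (S n))%C.
Proof.
  intros Hw. rewrite Cgamma_nat, Cgamma_poch by assumption.
  field. split; [now apply poch_neq_0|now apply Cgamma_neq_0].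
Qed.

(** * Convergence of the factorial series *)

Fixpoint rpoch (x : R) (n : nat) : R :=
  match n with O => 1 | S m => rpoch x m * (x + INR m) end.

Lemma rpoch_pos x n : 0 < x -> 0 < rpoch x n.
Proof.
  intros Hx. induction n as [|n IH]; simpl; [lra|]. pose proof (pos_INR n).
  apply Rmult_lt_0_compat; lra.
Qed.

Lemma rpoch_le_poch w n : 0 < Re w -> rpoch (Re w) n <= Cmod (poch w n).
Proof.
  intros Hw. induction n as [|n IH]; simpl; [rewrite Cmod_1; lra|].
  rewrite Cmod_mult. pose proof (pos_INR n). apply Rmult_le_compat; [|lra|exact IH|].
  - apply Rlt_le, rpoch_pos, Hw.
  - change (Re w + INR n) with (Re (w + RtoC (INR n))%C). apply Re_le.
Qed.

(** Up to a constant, the size of the remainder after [n] terms; [weight c x n / (x + n)] is that of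
    the term of index [n]. *)
Definition weight (c x : R) (n : nat) : R :=
  INR (fact n) * exp ((c - 1) * ln (INR n + 2)) / rpoch x n.

Lemma weight_pos c x n : 0 < x -> 0 < weight c x n.
Proof.
  intros Hx. unfold weight. apply Rdiv_lt_0_compat; [|now apply rpoch_pos].
  apply Rmult_lt_0_compat; [apply INR_fact_lt_0|apply exp_pos].
Qed.

(* Raabe's test, in telescoping form. *)
Lemma weight_step c x : 1 < c < x -> exists n0, forall n, (n0 <= n)%nat ->
  weight c x (S n) + (x - c) / 2 * (weight c x n / (x + INR n)) <= weight c x n.
Proof.
  intros Hc. set (d := (x - c) / 2).
  destruct (INR_unbounded (Rmax c ((2 + c * x) / d))) as [n0 Hn0].
  assert (Hd : 0 < d) by (unfold d; lra).
  exists n0. intros n Hn. apply le_INR in Hn.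
  pose proof (Rmax_l c ((2 + c * x) / d)) as M1. pose proof (Rmax_r c ((2 + c * x) / d)) as M2.
  set (k := INR n) in *.
  assert (Hk : c < k) by lra.
  assert (Hkd : 2 + c * x <= k * d).
  { apply Rmult_le_reg_r with (/ d); [apply Rinv_0_lt_compat; assumption|].
    rewrite Rmult_assoc, Rinv_r, Rmult_1_r by lra. unfold Rdiv in M2. lra. }
  assert (Hw := weight_pos c x n ltac:(lra)).
  assert (E : weight c x (S n) <= weight c x n * ((k + 1) * (k + 2) / ((x + k) * (k + 3 - c)))).
  { unfold weight. rewrite fact_simpl, mult_INR, S_INR. simpl rpoch. fold k.
    assert (P := rpoch_pos x n ltac:(lra)). pose proof (INR_fact_lt_0 n) as Pf.
    (* [(1 + 1/(k+2))^(c-1) <= exp((c-1)/(k+2)) <= (k+2)/(k+3-c)], the last step from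
       [exp(-u) >= 1 - u]. *)
    assert (X : exp ((c - 1) * ln (k + 1 + 2)) <= exp ((c - 1) * ln (k + 2)) * ((k + 2) / (k + 3 - c))).
    { replace (k + 1 + 2) with ((k + 2) * (1 + / (k + 2))) by (field; lra).
      assert (I2 : 0 < / (k + 2)) by (apply Rinv_0_lt_compat; lra).
      rewrite ln_mult, Rmult_plus_distr_l, exp_plus by lra.
      apply Rmult_le_compat_l; [apply Rlt_le, exp_pos|].
      assert (L : ln (1 + / (k + 2)) <= / (k + 2)).
      { pose proof (exp_ineq1_le (/ (k + 2))). rewrite <- (ln_exp (/ (k + 2))) at 2. apply ln_le_compat; lra. }
      apply Rle_trans with (exp ((c - 1) * / (k + 2))); [apply exp_le_compat, Rmult_le_compat_l; lra|].
      pose proof (exp_ineq1_le (- ((c - 1) * / (k + 2)))) as Q. rewrite exp_Ropp in Q.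
      assert (Q' : (k + 3 - c) / (k + 2) <= / exp ((c - 1) * / (k + 2))).
      { eapply Rle_trans; [|exact Q]. right. field. lra. }
      apply Rinv_le_contravar in Q'; [|apply Rdiv_lt_0_compat; lra].
      rewrite Rinv_inv in Q'. eapply Rle_trans; [exact Q'|]. right. field. lra. }
    apply Rle_trans with ((k + 1) * INR (fact n) * (exp ((c - 1) * ln (k + 2)) * ((k + 2) / (k + 3 - c)))
      / (rpoch x n * (x + k))).
    - apply Rmult_le_compat_r; [apply Rlt_le, Rinv_0_lt_compat, Rmult_lt_0_compat; lra|].
      apply Rmult_le_compat_l; [apply Rmult_le_pos; lra|exact X].
    - right. field. repeat split; lra. }
  apply Rle_trans with (weight c x n * ((k + 1) * (k + 2) / ((x + k) * (k + 3 - c)) + d / (x + k))).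
  - rewrite Rmult_plus_distr_l. apply Rplus_le_compat; [exact E|]. right. field. lra.
  - rewrite <- (Rmult_1_r (weight c x n)) at 2. apply Rmult_le_compat_l; [lra|].
    assert (P : 0 < (x + k) * (k + 3 - c)) by (apply Rmult_lt_0_compat; lra).
    apply Rmult_le_reg_r with ((x + k) * (k + 3 - c)); [assumption|].
    replace (((k + 1) * (k + 2) / ((x + k) * (k + 3 - c)) + d / (x + k)) * ((x + k) * (k + 3 - c)))
      with ((k + 1) * (k + 2) + d * (k + 3 - c)) by (field; split; lra).
    (* With [x = c + 2 d] the terms in [k^2] and the other terms in [k] cancel, so the difference of
       the sides is [d k] plus a constant; the choice of [n0] makes [d k] win. *)
    assert (Ex : x = c + 2 * d) by (unfold d; field). rewrite Ex in *. nra.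
Qed.

Lemma weight_bounded c x : 1 < c < x -> exists K, forall n, weight c x n <= K.
Proof.
  intros Hc. destruct (weight_step c x Hc) as [n0 H].
  assert (Hd : forall n, (n0 <= n)%nat -> weight c x n <= weight c x n0).
  { intros n Hn. induction Hn as [|n Hn IH]; [lra|].
    specialize (H n Hn). pose proof (weight_pos c x n ltac:(lra)). pose proof (pos_INR n).
    assert (0 <= (x - c) / 2 * (weight c x n / (x + INR n))).
    { apply Rmult_le_pos; [lra|]. apply Rdiv_le_0_compat; lra. }
    lra. }
  assert (Hf : forall m, exists K, forall n, (n <= m)%nat -> weight c x n <= K).
  { induction m as [|m [K HK]].
    - exists (weight c x 0). intros n Hn. replace n with 0%nat by lia. lra.
    - exists (Rmax K (weight c x (S m))). intros n Hn.
      destruct (Nat.eq_dec n (S m)) as [->|Hne]; [apply Rmax_r|].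
      eapply Rle_trans; [apply HK; lia|apply Rmax_l]. }
  destruct (Hf n0) as [K HK]. exists K. intros n.
  destruct (le_lt_dec n n0) as [L|L]; [now apply HK|].
  eapply Rle_trans; [apply Hd; lia|apply HK; lia].
Qed.

Lemma ex_series_telescope (v : nat -> R) : (forall n, 0 <= v n) -> (forall n, v (S n) <= v n) ->
  ex_series (fun n => v n - v (S n)).
Proof.
  intros H0 H1.
  destruct (ex_finite_lim_seq_decr v 0 H1 H0) as [l Hl].
  exists (v 0%nat - l).
  assert (K : is_lim_seq (sum_n (fun n => v n - v (S n))) (v 0%nat - l)); [|exact K].
  apply (is_lim_seq_ext (fun n => v 0%nat - v (S n))).
  - induction n as [|n IH]; [now rewrite sum_O|].
    rewrite sum_Sn, <- IH. unfold plus; simpl. ring.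
  - apply is_lim_seq_minus'; [apply is_lim_seq_const|].
    apply is_lim_seq_incr_1 in Hl. exact Hl.
Qed.

Lemma weight_summable c x : 1 < c < x -> ex_series (fun n => weight c x n / (x + INR n)).
Proof.
  intros Hc. destruct (weight_step c x Hc) as [n0 H].
  assert (Hp : forall n, 0 < weight c x n / (x + INR n)).
  { intros n. pose proof (pos_INR n). apply Rdiv_lt_0_compat; [apply weight_pos; lra|lra]. }
  apply (ex_series_incr_n _ n0).
  assert (T : ex_series (fun n => weight c x (n0 + n) - weight c x (n0 + S n))).
  { apply (ex_series_telescope (fun n => weight c x (n0 + n))).
    - intros n. apply Rlt_le, weight_pos. lra.
    - intros n. rewrite Nat.add_succ_r. specialize (H (n0 + n)%nat ltac:(lia)). specialize (Hp (n0 + n)%nat).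
      assert (0 <= (x - c) / 2 * (weight c x (n0 + n) / (x + INR (n0 + n)))) by (apply Rmult_le_pos; lra). lra. }
  apply (@ex_series_le R_AbsRing R_CompleteNormedModule _
    (fun n => scal (2 / (x - c)) (weight c x (n0 + n) - weight c x (n0 + S n)))).
  - intros n. specialize (H (n0 + n)%nat ltac:(lia)). specialize (Hp (n0 + n)%nat).
    unfold norm; simpl. unfold abs; simpl. rewrite Rabs_pos_eq by lra.
    unfold scal; simpl; unfold mult; simpl. rewrite Nat.add_succ_r.
    apply Rmult_le_reg_l with ((x - c) / 2); [lra|].
    replace ((x - c) / 2 * (2 / (x - c) * (weight c x (n0 + n) - weight c x (S (n0 + n)))))
      with (weight c x (n0 + n) - weight c x (S (n0 + n))) by (field; lra). lra.
  - apply (@ex_series_scal R_AbsRing R_NormedModule). exact T.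
Qed.

(** Boundedness for an exponent [c'] strictly between [c] and [x] leaves a factor [(n + 2)^(c - c')]
    to spare. *)
Lemma weight_vanishes c x : 1 < c < x -> forall e, 0 < e -> exists N, forall n, (N <= n)%nat -> weight c x n < e.
Proof.
  intros Hc e He. set (c' := (c + x) / 2).
  destruct (weight_bounded c' x) as [K HK]; [unfold c'; lra|].
  assert (HK0 : 0 < K) by (eapply Rlt_le_trans; [apply (weight_pos c' x 0); lra|apply HK]).
  destruct (xln_large (c' - c) (K / e)) as [d [Hd H]]; [unfold c'; lra|apply Rdiv_lt_0_compat; assumption|].
  destruct (INR_unbounded d) as [N HN]. exists N. intros n Hn. apply le_INR in Hn.
  specialize (H (INR n + 2) ltac:(lra)). specialize (HK n).
  assert (E : weight c' x n = weight c x n * exp ((c' - c) * ln (INR n + 2))).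
  { unfold weight. replace ((c' - 1) * ln (INR n + 2)) with ((c - 1) * ln (INR n + 2) + (c' - c) * ln (INR n + 2)) by ring.
    rewrite exp_plus. field. apply Rgt_not_eq, rpoch_pos. lra. }
  rewrite E in HK. pose proof (weight_pos c x n ltac:(lra)) as Hp.
  apply Rmult_lt_compat_l with (r := weight c x n) in H; [|assumption].
  assert (Q : weight c x n * (K / e) < K) by lra.
  apply Rmult_lt_reg_r with (K / e); [apply Rdiv_lt_0_compat; assumption|].
  replace (e * (K / e)) with K by (field; lra). exact Q.
Qed.

(** * Taylor coefficients and Stirling numbers *)

Lemma nth_padd p q k : nth k (padd p q) 0%Z = (nth k p 0 + nth k q 0)%Z.
Proof.
  revert q k. induction p as [|x p IH]; intros q k; [destruct k; reflexivity|].
  destruct q as [|y q]; [simpl; destruct k; lia|].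
  destruct k as [|k]; simpl; [reflexivity|apply IH].
Qed.

Lemma nth_map_scal c p k : nth k (map (fun x => (- c * x)%Z) p) 0%Z = (- c * nth k p 0)%Z.
Proof.
  replace 0%Z with ((fun x => (- c * x)%Z) 0%Z) at 1 by (simpl; lia).
  apply (map_nth (fun x => (- c * x)%Z)).
Qed.

Lemma stirling1_S_0 n : stirling1 (S n) 0 = (- Z.of_nat n * stirling1 n 0)%Z.
Proof. unfold stirling1. cbn [falling_poly]. unfold mul_X_minus. now rewrite nth_padd, nth_map_scal. Qed.

Lemma stirling1_S_S n k : stirling1 (S n) (S k) = (stirling1 n k - Z.of_nat n * stirling1 n (S k))%Z.
Proof.
  unfold stirling1. cbn [falling_poly]. unfold mul_X_minus. rewrite nth_padd, nth_map_scal.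
  cbn [nth]. lia.
Qed.

Lemma stirling1_out n k : (n < k)%nat -> stirling1 n k = 0%Z.
Proof.
  revert k. induction n as [|n IH]; intros k Hk.
  - destruct k as [|[|k]]; [lia|reflexivity|]. unfold stirling1. simpl. now destruct k.
  - destruct k as [|k]; [lia|]. rewrite stirling1_S_S, !IH by lia. lia.
Qed.

Lemma csum_ext f g n : (forall k, (k <= n)%nat -> f k = g k) -> csum f n = csum g n.
Proof.
  induction n as [|n IH]; intros H; simpl; [apply H; lia|].
  rewrite IH by (intros; apply H; lia). f_equal. apply H; lia.
Qed.

Lemma csum_scal c f n : csum (fun k => c * f k)%C n = (c * csum f n)%C.
Proof. induction n as [|n IH]; simpl; [reflexivity|]. rewrite IH. ring. Qed.

Lemma csum_plus f g n : csum (fun k => f k + g k)%C n = (csum f n + csum g n)%C.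
Proof. induction n as [|n IH]; simpl; [reflexivity|]. rewrite IH. ring. Qed.

Lemma csum_shift f n : csum f (S n) = (f O + csum (fun k => f (S k)) n)%C.
Proof. induction n as [|n IH]; [reflexivity|]. simpl in *. rewrite IH. ring. Qed.

(** With [X k] standing for [D^k f], this is [D (D - 1) ... (D - n + 1)] applied to [f]. *)
Definition stirling_sum (n : nat) (X : nat -> C) : C :=
  csum (fun k => RtoC (IZR (stirling1 n k)) * X k)%C n.

Lemma stirling_sum_S n X :
  stirling_sum (S n) X = (stirling_sum n (fun k => X (S k)) - RtoC (INR n) * stirling_sum n X)%C.
Proof.
  unfold stirling_sum. rewrite csum_shift, stirling1_S_0.
  (* A zero term of index [n + 1] is appended so that the shifted and unshifted sums have the same
     range. *)
  assert (E : csum (fun k => RtoC (IZR (stirling1 n k)) * X k)%C n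
     = csum (fun k => RtoC (IZR (stirling1 n k)) * X k)%C (S n)).
  { simpl. rewrite (stirling1_out n (S n)) by lia. ring. }
  rewrite E, csum_shift. rewrite (csum_ext _ (fun k => RtoC (IZR (stirling1 n k)) * X (S k)
    + - RtoC (INR n) * (RtoC (IZR (stirling1 n (S k))) * X (S k)))%C).
  - rewrite csum_plus, csum_scal. rewrite mult_IZR, opp_IZR, <- INR_IZR_INZ, RtoC_mult, RtoC_opp. ring.
  - intros k _. rewrite stirling1_S_S, minus_IZR, mult_IZR, <- INR_IZR_INZ, RtoC_minus, RtoC_mult. ring.
Qed.

Lemma cder_csum (f : nat -> R -> C) (df : nat -> C) t n : (forall k, cder (f k) t (df k)) ->
  cder (fun u => csum (fun k => f k u) n) t (csum df n).
Proof. intros H. induction n as [|n IH]; simpl; [apply H|]. now apply cder_plus. Qed.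

Lemma cder_stirling_sum n (X : nat -> R -> C) (dX : nat -> C) t : (forall k, cder (X k) t (dX k)) ->
  cder (fun u => stirling_sum n (fun k => X k u)) t (stirling_sum n dX).
Proof.
  intros H. unfold stirling_sum.
  apply (cder_csum (fun k u => RtoC (IZR (stirling1 n k)) * X k u)%C). intros k. apply cder_scal, H.
Qed.

Lemma is_series_Re (u : nat -> C) (l : C) :
  @is_series C_AbsRing C_NormedModule u l -> is_series (fun n => Re (u n)) (Re l).
Proof.
  intros H P HP.
  assert (E : forall n, sum_n (fun n => Re (u n)) n = Re (sum_n (G := C_NormedModule) u n)).
  { induction n as [|n IH]; [now rewrite !sum_O|]. rewrite !sum_Sn, IH. reflexivity. }
  destruct HP as [e He].
  destruct (H (fun y => P (Re y))) as [N HN].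
  { exists e. intros y Hy. apply He. apply Hy. }
  exists N. intros n Hn. rewrite E. now apply HN.
Qed.

Lemma is_series_Im (u : nat -> C) (l : C) :
  @is_series C_AbsRing C_NormedModule u l -> is_series (fun n => Im (u n)) (Im l).
Proof.
  intros H P HP.
  assert (E : forall n, sum_n (fun n => Im (u n)) n = Im (sum_n (G := C_NormedModule) u n)).
  { induction n as [|n IH]; [now rewrite !sum_O|]. rewrite !sum_Sn, IH. reflexivity. }
  destruct HP as [e He].
  destruct (H (fun y => P (Im y))) as [N HN].
  { exists e. intros y Hy. apply He. apply Hy. }
  exists N. intros n Hn. rewrite E. now apply HN.
Qed.

Lemma Cpow_RtoC t n : (RtoC t ^ n)%C = RtoC (t ^ n).
Proof. induction n as [|n IH]; simpl; [reflexivity|]. now rewrite IH, RtoC_mult. Qed.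

(** A radius below [|t'|], with [t'] strictly between [|t|] and [r], would contradict the terms at
    [t'] tending to 0; the midpoint gives the strict inequality. *)
Lemma CV_radius_lower (b : nat -> R) r : (forall t, Rabs t < r -> ex_pseries b t) ->
  forall t, Rabs t < r -> Rbar_lt (Rabs t) (CV_radius b).
Proof.
  intros H t Ht. set (t' := (Rabs t + r) / 2). pose proof (Rabs_pos t).
  apply Rbar_lt_le_trans with (Rabs t').
  { simpl. rewrite (Rabs_pos_eq t'); unfold t'; lra. }
  apply Rbar_not_lt_le. intros K. apply CV_disk_outside in K. apply K.
  apply (is_lim_seq_ext (fun n => scal (pow_n t' n) (b n))).
  { intros n. rewrite pow_n_pow. unfold scal; simpl; unfold mult; simpl. ring. }
  apply ex_series_lim_0. apply H. rewrite (Rabs_pos_eq t'); unfold t'; lra.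
Qed.

Lemma is_derive_PSeries_n k (b : nat -> R) t : Rbar_lt (Rabs t) (CV_radius b) ->
  is_derive (PSeries (PS_derive_n k b)) t (PSeries (PS_derive_n (S k) b) t).
Proof.
  intros H. rewrite (PSeries_ext (PS_derive_n (S k) b) (PS_derive (PS_derive_n k b))).
  - apply is_derive_PSeries. now rewrite CV_radius_derive_n.
  - intros n. unfold PS_derive, PS_derive_n.
    replace (S n + k)%nat with (n + S k)%nat by lia.
    rewrite (fact_simpl n), mult_INR. field. split; [apply INR_fact_neq_0|]. apply not_0_INR. lia.
Qed.

(** * Derivatives of [phi] at 1 and the coefficients [b_n] *)

Section Coefficients.

Variables (F : C -> C) (lam : R).
Hypothesis Hlam : 0 < lam.
Hypothesis HF : forall zeta : C, Delta_lam lam zeta -> @ex_derive C_AbsRing C_NormedModule F zeta.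

(* With [s = exp(-t/lam)] this is [s^n phi^(n)(s)]. *)
Definition euler_deriv (n : nat) (t : R) : C :=
  (RtoC (exp (- (INR n * t / lam))) * Cderiv_n n (phi F lam) (RtoC (exp (- (t / lam)))))%C.

(** The bound on [t] means [s < 2]. Negative times are kept so that [t = 0], where the coefficients
    are read off, is an interior point with two-sided derivatives. *)
Lemma exp_disc t : - (lam * ln 2) < t -> Cmod (RtoC (exp (- (t / lam))) - 1)%C < 1.
Proof.
  intros Ht. rewrite <- RtoC_minus, Cmod_R.
  assert (exp (- (t / lam)) < 2).
  { rewrite <- (exp_ln 2) by lra. apply exp_increasing.
    apply Rmult_lt_reg_l with lam; [assumption|].
    replace (lam * - (t / lam)) with (- t) by (field; lra). lra. }
  pose proof (exp_pos (- (t / lam))). apply Rabs_def1; lra.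
Qed.

Lemma cder_euler_deriv n t : - (lam * ln 2) < t ->
  cder (euler_deriv n) t
    (RtoC (- / lam) * (euler_deriv (S n) t + RtoC (INR n) * euler_deriv n t))%C.
Proof.
  intros Ht. unfold euler_deriv. eapply cder_eq.
  - apply cder_mult.
    + apply (cder_RtoC (fun t => exp (- (INR n * t / lam))) t (- (INR n / lam) * exp (- (INR n * t / lam)))).
      auto_derive; [exact I|]. unfold Rdiv. ring.
    + apply (cder_comp (Cderiv_n n (phi F lam)) (fun t => RtoC (exp (- (t / lam))))).
      * apply (Cderiv_n_diff (phi F lam) 1 1 n); [now apply phi_holo|now apply exp_disc].
      * apply (cder_RtoC (fun t => exp (- (t / lam))) t (- / lam * exp (- (t / lam)))).
        auto_derive; [exact I|]. unfold Rdiv. ring.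
  - cbv beta.
    replace (exp (- (INR (S n) * t / lam))) with (exp (- (INR n * t / lam)) * exp (- (t / lam))).
    2: { rewrite <- exp_plus. f_equal. rewrite S_INR. field. lra. }
    unfold Rdiv. rewrite !RtoC_mult, !RtoC_opp, RtoC_mult. ring.
Qed.

Lemma euler_deriv_0 t : euler_deriv 0 t = F (RtoC t).
Proof.
  unfold euler_deriv. simpl Cderiv_n. unfold phi. rewrite Clog_RtoC, ln_exp by apply exp_pos.
  replace (RtoC lam * - RtoC (- (t / lam)))%C with (RtoC t).
  - simpl INR. replace (- (0 * t / lam)) with 0 by (field; lra). rewrite exp_0. ring.
  - rewrite <- RtoC_opp, <- RtoC_mult. f_equal. field. lra.
Qed.

Lemma euler_deriv_at_0 n : euler_deriv n 0 = Cderiv_n n (phi F lam) 1.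
Proof.
  unfold euler_deriv. replace (- (INR n * 0 / lam)) with 0 by (field; lra).
  replace (- (0 / lam)) with 0 by (field; lra). rewrite exp_0. ring.
Qed.

Variable a : nat -> C.
Variable r : R.
Hypothesis Hr : 0 < r.
Hypothesis Hser : forall zeta : C, Cmod zeta < r ->
  @is_series C_AbsRing C_NormedModule (borel_term a zeta) (F zeta).

(** On the real axis the Borel series splits into two real power series, and termwise
    differentiation of these gives all derivatives of [F] along the axis. *)
Let ra (n : nat) : R := Re (a (S n)) / INR (fact n).
Let ia (n : nat) : R := Im (a (S n)) / INR (fact n).

Let Fk (k : nat) (t : R) : C := (PSeries (PS_derive_n k ra) t, PSeries (PS_derive_n k ia) t).

Let borel_term_R t n : borel_term a (RtoC t) n = (t ^ n * ra n, t ^ n * ia n).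
Proof.
  unfold borel_term, ra, ia. rewrite Cpow_RtoC. pose proof (INR_fact_neq_0 n) as H.
  unfold Cdiv. rewrite <- RtoC_inv by assumption.
  destruct (a (S n)) as [u v]. apply injective_projections; simpl; field; assumption.
Qed.

Let ps_re t : Rabs t < r -> is_pseries ra t (Re (F (RtoC t))).
Proof.
  intros Ht. rewrite <- Cmod_R in Ht. pose proof (is_series_Re _ _ (Hser _ Ht)) as K.
  eapply is_series_ext; [|exact K]. intros n. cbv beta. rewrite borel_term_R. exact (f_equal (fun u => u * ra n) (eq_sym (pow_n_pow t n))).
Qed.

Let ps_im t : Rabs t < r -> is_pseries ia t (Im (F (RtoC t))).
Proof.
  intros Ht. rewrite <- Cmod_R in Ht. pose proof (is_series_Im _ _ (Hser _ Ht)) as K.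
  eapply is_series_ext; [|exact K]. intros n. cbv beta. rewrite borel_term_R. exact (f_equal (fun u => u * ia n) (eq_sym (pow_n_pow t n))).
Qed.

Let cder_Fk k t : Rabs t < r -> cder (Fk k) t (Fk (S k) t).
Proof.
  intros Ht. split; simpl; apply is_derive_PSeries_n; apply (CV_radius_lower _ r); try assumption.
  - intros u Hu. eexists. apply ps_re, Hu.
  - intros u Hu. eexists. apply ps_im, Hu.
Qed.

Let Fk_0 t : Rabs t < r -> Fk 0 t = F (RtoC t).
Proof.
  intros Ht. unfold Fk. apply injective_projections; simpl.
  - rewrite (PSeries_ext _ ra). { apply is_pseries_unique, ps_re, Ht. }
    intros n. unfold PS_derive_n. rewrite Nat.add_0_r. field. apply INR_fact_neq_0.
  - rewrite (PSeries_ext _ ia). { apply is_pseries_unique, ps_im, Ht. }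
    intros n. unfold PS_derive_n. rewrite Nat.add_0_r. field. apply INR_fact_neq_0.
Qed.

Let Fk_at_0 k : Fk k 0 = a (S k).
Proof.
  unfold Fk. rewrite !PSeries_0. unfold PS_derive_n, ra, ia. rewrite Nat.add_0_l.
  pose proof (INR_fact_neq_0 k). destruct (a (S k)) as [u v].
  apply injective_projections; simpl; field; assumption.
Qed.

(** Here [D = - lam d/dt] is [s d/ds], and [(- lam)^k Fk k] is [D^k F]. The recurrence of
    [euler_deriv] reads [E_(n+1) = (D - n) E_n], which is [stirling_sum_S]. *)
Let euler_deriv_stirling n : forall t, Rabs t < r -> - (lam * ln 2) < t ->
  euler_deriv n t = stirling_sum n (fun k => RtoC ((- lam) ^ k) * Fk k t)%C.
Proof.
  induction n as [|n IH]; intros t Ht Ht2.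
  - rewrite euler_deriv_0. unfold stirling_sum. cbn [csum pow]. change (stirling1 0 0) with 1%Z.
    rewrite <- Fk_0 by assumption. ring.
  - assert (D1 : cder (fun u => stirling_sum n (fun k => RtoC ((- lam) ^ k) * Fk k u)%C) t
       (stirling_sum n (fun k => RtoC ((- lam) ^ k) * Fk (S k) t)%C)).
    { apply (cder_stirling_sum n (fun k u => RtoC ((- lam) ^ k) * Fk k u)%C). intros k.
      apply cder_scal, cder_Fk, Ht. }
    assert (D2 := cder_euler_deriv n t Ht2).
    (* The identity at order [n] holds in a neighbourhood of [t], so it may be differentiated
       there. *)
    apply (cder_ext_loc _ (fun u => stirling_sum n (fun k => RtoC ((- lam) ^ k) * Fk k u)%C)) in D2.
    2: { assert (L1 : locally t (fun u => Rabs u < r)).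
         { apply (continuous_Rabs t (fun v => v < r)). now apply open_lt. }
         assert (L2 : locally t (fun u => - (lam * ln 2) < u)) by now apply open_gt.
         eapply filter_imp; [|exact (filter_and _ _ L1 L2)]. intros u [A B]. now apply IH. }
    pose proof (cder_unique _ _ _ _ D2 D1) as E.
    rewrite stirling_sum_S, <- IH by assumption.
    assert (E2 : stirling_sum n (fun k => RtoC ((- lam) ^ S k) * Fk (S k) t)%C
      = (RtoC (- lam) * stirling_sum n (fun k => RtoC ((- lam) ^ k) * Fk (S k) t))%C).
    { unfold stirling_sum. rewrite <- csum_scal. apply csum_ext. intros k _.
      rewrite <- tech_pow_Rmult, RtoC_mult. ring. }
    rewrite E2, <- E, Cmult_assoc, <- RtoC_mult. replace (- lam * - / lam) with 1 by (field; lra). ring.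
Qed.

Lemma b_lam_Cderiv n :
  b_lam lam a n = (RtoC ((-1) ^ n / INR (fact n)) * Cderiv_n n (phi F lam) 1)%C.
Proof.
  rewrite <- euler_deriv_at_0, euler_deriv_stirling.
  2: { rewrite Rabs_R0. assumption. }
  2: { assert (0 < lam * ln 2) by (apply Rmult_lt_0_compat; [assumption|]; rewrite <- ln_1; apply ln_increasing; lra). lra. }
  unfold b_lam, stirling_sum. unfold Rdiv. rewrite Rmult_comm, RtoC_mult, RtoC_inv by apply INR_fact_neq_0.
  rewrite <- Cmult_assoc. f_equal. rewrite <- csum_scal. apply csum_ext. intros k Hk.
  rewrite Fk_at_0, !Cmult_assoc, <- !RtoC_mult. f_equal. f_equal.
  (* Reconciles the signs: [(-1)^n (- lam)^k = (-1)^(n-k) lam^k]. *)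
  assert (E : (-1) ^ n = (-1) ^ (n - k) * (-1) ^ k) by (rewrite <- pow_add; f_equal; lia).
  rewrite E.
  replace ((- lam) ^ k) with ((-1) ^ k * lam ^ k) by (rewrite <- Rpow_mult_distr; f_equal; ring).
  assert (S1 : (-1) ^ k * (-1) ^ k = 1) by (rewrite <- Rpow_mult_distr; replace (-1 * -1) with 1 by ring; apply pow1).
  replace ((-1) ^ (n - k) * (-1) ^ k * IZR (stirling1 n k) * ((-1) ^ k * lam ^ k)) with
    ((-1) ^ (n - k) * IZR (stirling1 n k) * lam ^ k * ((-1) ^ k * (-1) ^ k)) by ring.
  rewrite S1. ring.
Qed.

End Coefficients.

(** * Repeated integration by parts *)

Lemma Cmod_Cexp u : Cmod (Cexp u) = exp (Re u).
Proof. apply (Cmod_circ (exp (Re u)) (Im u)). apply Rlt_le, exp_pos. Qed.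

Lemma cder_Cexp_line z t : cder (fun u => Cexp (- (z * RtoC u))%C) t (- z * Cexp (- (z * RtoC t)))%C.
Proof.
  destruct z as [x y]. unfold Cexp. split; simpl; auto_derive; try exact I; unfold Rminus; rewrite ?Rmult_0_r, ?Ropp_0.
  all: ring.
Qed.

Lemma Re_mult_RtoC z t : Re (- (z * RtoC t))%C = - (Re z * t).
Proof. destruct z; simpl; ring. Qed.

Lemma at_point_0_nonneg : at_point 0 (fun t => 0 <= t).
Proof. unfold at_point. lra. Qed.

Lemma p_infty_nonneg : Rbar_locally p_infty (fun t => 0 <= t).
Proof. apply p_infty_intro with 0. intros; lra. Qed.

Lemma nonneg_convex x y t : 0 <= x -> 0 <= y -> x <= t <= y -> 0 <= t.
Proof. lra. Qed.

Lemma at_point_0_le_p_infty : filter_prod (at_point 0) (Rbar_locally p_infty) (fun ab => fst ab <= snd ab).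
Proof.
  apply Filter_prod with (fun t => t = 0) (fun t => 0 < t).
  - reflexivity.
  - apply p_infty_pos.
  - simpl; intros; lra.
Qed.

Lemma exp_decay K d e : 0 <= K -> 0 < d -> 0 < e -> Rbar_locally p_infty (fun t => K * exp (- (d * t)) < e).
Proof.
  intros HK Hd He. apply p_infty_intro with ((K / e) / d). intros t Ht.
  assert (L : K / e < d * t).
  { apply Rmult_lt_compat_l with (r := d) in Ht; [|assumption].
    replace (d * (K / e / d)) with (K / e) in Ht by (field; lra). exact Ht. }
  assert (P := exp_pos (d * t)).
  rewrite exp_Ropp. apply Rmult_lt_reg_r with (exp (d * t)); [assumption|].
  rewrite Rmult_assoc, Rinv_l, Rmult_1_r by lra.
  apply Rmult_lt_compat_r with (r := e) in L; [|assumption].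
  replace (K / e * e) with K in L by (field; lra).
  pose proof (exp_ineq1_le (d * t)). nra.
Qed.

Section Laplace.

Variables (F : C -> C) (lam A B : R) (z : C).
Hypothesis Hlam : 0 < lam.
Hypothesis HA : 0 < A.
Hypothesis HB : 0 < B.
Hypothesis HF : forall zeta : C, Delta_lam lam zeta -> @ex_derive C_AbsRing C_NormedModule F zeta.
Hypothesis HFb : forall zeta : C, Delta_lam lam zeta -> Cmod (F zeta) <= A * exp (B * Cmod zeta).
Hypothesis Hz : B < Re z.

Let E := euler_deriv F lam.

Lemma euler_deriv_scaled n t : 0 <= t ->
  let s := exp (- (t / lam)) in
  0 < s <= 1 /\ Cmod (E n t) = s ^ n * Cmod (Cderiv_n n (phi F lam) (RtoC s))
  /\ exp (- (lam * B) * ln s) = exp (B * t).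
Proof.
  intros Ht s. assert (Hs : 0 < s) by apply exp_pos.
  assert (0 <= t / lam) by (apply Rdiv_le_0_compat; assumption).
  split; [split; [assumption|]|split].
  - unfold s. rewrite <- exp_0. apply exp_le_compat. lra.
  - unfold E, euler_deriv. rewrite Cmod_mult, Cmod_R, Rabs_pos_eq by (apply Rlt_le, exp_pos).
    fold s. f_equal. unfold s. rewrite exp_pow_INR. f_equal. field. lra.
  - unfold s. rewrite ln_exp. f_equal. field. lra.
Qed.

Lemma euler_deriv_sup n al t : 0 < al < 1 -> 0 <= t ->
  Cmod (E n t) <= INR (fact n) * (/ al) ^ n * A * exp (- (lam * B) * ln (1 - al)) * exp (B * t).
Proof.
  intros Hal Ht. destruct (euler_deriv_scaled n t Ht) as [Hs [-> <-]].
  eapply Rle_trans; [apply (phi_derivative_sup F lam A B _ al); assumption|]. right; ring.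
Qed.

Definition lap (n : nat) (t : R) : C := (E n t * Cexp (- (z * RtoC t)))%C.

Lemma t_domain t : 0 <= t -> - (lam * ln 2) < t.
Proof.
  intros Ht. assert (0 < lam * ln 2); [|lra].
  apply Rmult_lt_0_compat; [assumption|]. rewrite <- ln_1. apply ln_increasing; lra.
Qed.

Lemma cder_lap n t : 0 <= t ->
  cder (lap n) t (RtoC (- / lam) * (lap (S n) t + (RtoC lam * z + RtoC (INR n)) * lap n t))%C.
Proof.
  intros Ht. eapply cder_eq.
  - apply cder_mult; [apply (cder_euler_deriv F lam Hlam HF n t (t_domain t Ht))|apply cder_Cexp_line].
  - cbv beta. fold E. unfold lap.
    replace (- z)%C with (RtoC (- / lam * lam) * z)%C.
    + rewrite RtoC_mult. ring.
    + replace (- / lam * lam) with (- (1)) by (field; lra). rewrite RtoC_opp. ring.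
Qed.

Lemma ccont_lap n t : 0 <= t -> ccont (lap n) t.
Proof. intros Ht. eapply cder_ccont, cder_lap, Ht. Qed.

Lemma Cmod_lap n M t : Cmod (E n t) <= M * exp (B * t) -> Cmod (lap n t) <= M * exp (- ((Re z - B) * t)).
Proof.
  intros H. unfold lap. rewrite Cmod_mult, Cmod_Cexp, Re_mult_RtoC.
  replace (- ((Re z - B) * t)) with (B * t + - (Re z * t)) by ring.
  rewrite exp_plus, <- Rmult_assoc. apply Rmult_le_compat_r; [apply Rlt_le, exp_pos|exact H].
Qed.

Lemma lap_integrable n M : 0 <= M -> (forall t, 0 <= t -> Cmod (E n t) <= M * exp (B * t)) ->
  exists l, CIg (lap n) (at_point 0) (Rbar_locally p_infty) l /\ Cmod l <= M / (Re z - B).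
Proof.
  intros HM H. set (d := Re z - B). assert (Hd : 0 < d) by (unfold d; lra).
  destruct (CIg_dominated (at_point 0) (Rbar_locally p_infty) (fun t => 0 <= t) nonneg_convex
    at_point_0_nonneg p_infty_nonneg at_point_0_le_p_infty (lap n)
    (fun t => M * exp (- (d * t))) (fun t => - (M / d) * exp (- (d * t))) (- (M / d)) 0) as [l [Hl Hb]].
  - intros t Ht. now apply ccont_lap.
  - intros t Ht. apply Cmod_lap. now apply H.
  - intros t _. split.
    + auto_derive; [exact I|]. field. lra.
    + apply (@ex_derive_continuous R_AbsRing R_NormedModule). auto_derive. exact I.
  - intros e He. unfold at_point. rewrite Rmult_0_r, Ropp_0, exp_0, Rmult_1_r, Rminus_diag_eq, Rabs_R0; auto.
  - intros e He. assert (Q : 0 <= M / d) by (apply Rdiv_le_0_compat; assumption).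
    eapply filter_imp; [|exact (exp_decay (M / d) d e Q Hd He)]. intros t Ht. cbv beta in *.
    rewrite Rminus_0_r, Ropp_mult_distr_l_reverse, Rabs_Ropp, Rabs_pos_eq; [assumption|].
    apply Rmult_le_pos; [assumption|apply Rlt_le, exp_pos].
  - exists l. split; [exact Hl|]. fold d. lra.
Qed.

(** The derivative of [lap n] is integrated over the half-line. Its only boundary contribution is
    [phi^(n)(1)] at [t = 0], since [E_n] grows at most like [exp(B t)] and [Re z > B]. *)
Lemma lap_recurrence n l l' :
  CIg (lap n) (at_point 0) (Rbar_locally p_infty) l ->
  CIg (lap (S n)) (at_point 0) (Rbar_locally p_infty) l' ->
  (RtoC lam * Cderiv_n n (phi F lam) 1)%C = (l' + (RtoC lam * z + RtoC (INR n)) * l)%C.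
Proof.
  intros H1 H2.
  pose proof (CIg_scal _ _ (RtoC (- / lam)) _ _
    (CIg_plus _ _ _ _ _ _ H2 (CIg_scal _ _ (RtoC lam * z + RtoC (INR n))%C _ _ H1))) as K1.
  (* The radius [1/2] is arbitrary: only decay at infinity is wanted, not a good constant. *)
  set (M := INR (fact n) * (/ (1 / 2)) ^ n * A * exp (- (lam * B) * ln (1 - 1 / 2))).
  assert (HM : 0 <= M).
  { unfold M. apply Rmult_le_pos; [|apply Rlt_le, exp_pos]. apply Rmult_le_pos; [|lra].
    apply Rmult_le_pos; [apply pos_INR|]. apply pow_le. lra. }
  assert (K2 : CIg (fun t => RtoC (- / lam) * (lap (S n) t + (RtoC lam * z + RtoC (INR n)) * lap n t))%C
    (at_point 0) (Rbar_locally p_infty) (0 - lap n 0)%C).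
  { apply (CIg_FTC _ _ (fun t => 0 <= t) nonneg_convex at_point_0_nonneg p_infty_nonneg (lap n)).
    - intros t Ht. now apply cder_lap.
    - intros t Ht. apply ccont_mult; [apply ccont_const|].
      apply ccont_plus; [now apply ccont_lap|]. apply ccont_mult; [apply ccont_const|now apply ccont_lap].
    - intros e He. unfold at_point. replace (lap n 0 - lap n 0)%C with (RtoC 0) by ring. now rewrite Cmod_0.
    - intros e He. assert (Hd : 0 < Re z - B) by lra.
      eapply filter_imp; [|exact (filter_and _ _ p_infty_nonneg (exp_decay M _ e HM Hd He))].
      intros t [Ht Ht']. replace (lap n t - 0)%C with (lap n t) by ring.
      eapply Rle_lt_trans; [|exact Ht']. apply Cmod_lap. unfold M. apply euler_deriv_sup; [lra|assumption]. }
  pose proof (CIg_unique _ _ _ _ _ K1 K2) as Q.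
  assert (L0 : lap n 0 = Cderiv_n n (phi F lam) 1).
  { unfold lap, E. rewrite euler_deriv_at_0 by assumption. rewrite Cmult_0_r. unfold Cexp. simpl.
    rewrite Ropp_0, exp_0, cos_0, sin_0. apply injective_projections; simpl; ring. }
  rewrite L0 in Q.
  replace (RtoC lam * Cderiv_n n (phi F lam) 1)%C with (- RtoC lam * (0 - Cderiv_n n (phi F lam) 1))%C by ring.
  rewrite <- Q, Cmult_assoc, <- RtoC_opp, <- RtoC_mult. replace (- lam * - / lam) with 1 by (field; lra). ring.
Qed.

Definition lap_transform (n : nat) : C :=
  @RInt_gen C_R_CompleteNormedModule (lap n) (at_point 0) (Rbar_locally p_infty).

Lemma lap_transform_bound n M : 0 <= M -> (forall t, 0 <= t -> Cmod (E n t) <= M * exp (B * t)) ->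
  CIg (lap n) (at_point 0) (Rbar_locally p_infty) (lap_transform n)
  /\ Cmod (lap_transform n) <= M / (Re z - B).
Proof.
  intros HM H. destruct (lap_integrable n M HM H) as [l [H1 H2]].
  unfold lap_transform. rewrite (CIg_RInt_gen _ _ _ _ H1). split; assumption.
Qed.

Lemma sup_const_nonneg n al : 0 < al < 1 ->
  0 <= INR (fact n) * (/ al) ^ n * A * exp (- (lam * B) * ln (1 - al)).
Proof.
  intros Hal. apply Rmult_le_pos; [|apply Rlt_le, exp_pos]. apply Rmult_le_pos; [|lra].
  apply Rmult_le_pos; [apply pos_INR|]. apply pow_le, Rlt_le, Rinv_0_lt_compat. lra.
Qed.

Lemma lap_transform_correct n : CIg (lap n) (at_point 0) (Rbar_locally p_infty) (lap_transform n).
Proof.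
  assert (H : 0 < 1 / 2 < 1) by lra.
  apply (lap_transform_bound n _ (sup_const_nonneg n (1 / 2) H)). intros t Ht. now apply euler_deriv_sup.
Qed.

Lemma laplace_integrand_CIg :
  CIg (laplace_integrand F z) (at_point 0) (Rbar_locally p_infty) (lap_transform 0).
Proof.
  apply (CIg_ext _ _ (fun t => 0 <= t) nonneg_convex at_point_0_nonneg p_infty_nonneg (lap 0));
    [|apply lap_transform_correct].
  intros t _. unfold lap, laplace_integrand, E. now rewrite euler_deriv_0.
Qed.

Variable a : nat -> C.
Hypothesis Hser : exists r : R, 0 < r /\ forall zeta : C, Cmod zeta < r ->
  @is_series C_AbsRing C_NormedModule (borel_term a zeta) (F zeta).

Lemma borel_sum_eq : borel_sum a F z = (a O + lap_transform 0)%C.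
Proof. unfold borel_sum. now rewrite (CIg_RInt_gen _ _ _ _ laplace_integrand_CIg). Qed.

Let w : C := (RtoC lam * z)%C.

Lemma Re_w : Re w = lam * Re z.
Proof. unfold w. destruct z; simpl; ring. Qed.

Lemma Re_w_pos : 0 < Re w.
Proof. rewrite Re_w. apply Rmult_lt_0_compat; lra. Qed.

(** The factor [n!] from [Gamma(n + 1)] cancels the [1/n!] in [b_n], which leaves the boundary term
    of the recurrence over a rising factorial. *)
Lemma fact_term_eq n :
  fact_term lam a z n = (RtoC ((-1) ^ n) * (RtoC lam * Cderiv_n n (phi F lam) 1) / poch w (S n))%C.
Proof.
  destruct Hser as [r [Hr Hs]].
  unfold fact_term. fold w. rewrite (b_lam_Cderiv F lam Hlam HF a r Hr Hs).
  assert (G := Cgamma_ratio w n Re_w_pos).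
  replace (RtoC lam * (Cgamma w * Cgamma (RtoC (INR (S n))) *
     (RtoC ((-1) ^ n / INR (fact n)) * Cderiv_n n (phi F lam) 1)) / Cgamma (w + RtoC (INR (S n))))%C
   with (RtoC lam * (RtoC ((-1) ^ n / INR (fact n)) * Cderiv_n n (phi F lam) 1) *
     (Cgamma w * Cgamma (RtoC (INR (S n))) / Cgamma (w + RtoC (INR (S n)))))%C
   by (unfold Cdiv; ring).
  rewrite G. unfold Rdiv. rewrite RtoC_mult, RtoC_inv by apply INR_fact_neq_0.
  field. split; [apply poch_neq_0, Re_w_pos|apply INR_fact_neq_C].
Qed.

Lemma borel_remainder N :
  (lap_transform 0 - csum (fact_term lam a z) N)%C
  = (RtoC ((-1) ^ S N) * lap_transform (S N) / poch w (S N))%C.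
Proof.
  (* Dividing the recurrence by [w (w+1) ... (w+n)], with alternating signs, turns each term of the
     series into a difference of consecutive values of [Q]. *)
  set (Q := fun n => (RtoC ((-1) ^ n) * lap_transform n / poch w n)%C).
  assert (T : forall n, fact_term lam a z n = (Q n - Q (S n))%C).
  { intros n. rewrite fact_term_eq.
    rewrite (lap_recurrence n _ _ (lap_transform_correct n) (lap_transform_correct (S n))). fold w.
    unfold Q. cbn [poch]. rewrite <- tech_pow_Rmult, RtoC_mult.
    assert (P1 := poch_neq_0 w n Re_w_pos).
    assert (P2 : (w + RtoC (INR n))%C <> 0).
    { apply Re_neq_0. change (Re (w + RtoC (INR n))%C) with (Re w + INR n).
      pose proof Re_w_pos. pose proof (pos_INR n). lra. }
    replace (RtoC (-1)) with (- (1))%C by (rewrite <- RtoC_opp; f_equal; ring).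
    field. split; assumption. }
  assert (S0 : csum (fact_term lam a z) N = (Q 0%nat - Q (S N))%C).
  { induction N as [|N IH]; [apply T|]. cbn [csum]. rewrite IH, T. ring. }
  assert (Q0 : Q 0%nat = lap_transform 0).
  { unfold Q. cbn [poch pow]. field. }
  rewrite S0, Q0. change (RtoC ((-1) ^ S N) * lap_transform (S N) / poch w (S N))%C with (Q (S N)). ring.
Qed.

(** * Size of the remainder *)

Lemma Cmod_remainder N :
  Cmod (lap_transform 0 - csum (fact_term lam a z) N)%C = Cmod (lap_transform (S N)) / Cmod (poch w (S N)).
Proof.
  rewrite borel_remainder, Cmod_div, Cmod_mult, Cmod_R by (apply poch_neq_0, Re_w_pos).
  rewrite pow_1_abs, Rmult_1_l. reflexivity.
Qed.

Lemma remainder_bound N :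
  Cmod (lap_transform 0 - csum (fact_term lam a z) N)%C <= R_fact lam A B N z.
Proof.
  rewrite Cmod_remainder. set (be := lam * B).
  assert (Hbe : 0 < be) by (apply Rmult_lt_0_compat; assumption).
  set (m := INR (S N)). assert (Hm : 1 <= m) by (unfold m; rewrite S_INR; pose proof (pos_INR N); lra).
  (* This [al] minimises [al^(-m) (1 - al)^(-be)] on [(0, 1)]; the derivative involved has order
     [m = N + 1]. *)
  set (q := m + be). set (al := m / q).
  assert (Hal : 0 < al < 1).
  { unfold al, q. split; [apply Rdiv_lt_0_compat; lra|].
    apply Rmult_lt_reg_r with (m + be); [lra|]. unfold Rdiv. rewrite Rmult_assoc, Rinv_l by lra. lra. }
  destruct (lap_transform_bound (S N) _ (sup_const_nonneg (S N) al Hal)) as [_ Bd].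
  { intros t Ht. now apply euler_deriv_sup. }
  fold be in Bd.
  assert (Hp : 0 < Cmod (poch w (S N))) by (apply Cmod_gt_0, poch_neq_0, Re_w_pos).
  apply Rmult_le_compat_r with (r := / Cmod (poch w (S N))) in Bd; [|apply Rlt_le, Rinv_0_lt_compat, Hp].
  (* From here on an equality: for this [al] the bound is exactly [R_fact]. In [(N+1)! (q/m)^(N+1)]
     the factor [N + 1] of the factorial cancels one power of [m], which explains the denominator
     [(N+1)^N]. *)
  eapply Rle_trans; [exact Bd|]. right.
  unfold R_fact. fold w be.
  assert (Hd : RtoC (Re z - B) <> 0) by (intros Q; apply RtoC_inj in Q; lra).
  replace (Cgamma w * Cgamma (RtoC (INR (S N))) / (Cgamma (w + RtoC (INR (S N))) * RtoC (Re z - B)))%C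
    with (RtoC (INR (fact N)) / poch w (S N) / RtoC (Re z - B))%C.
  2: { rewrite <- (Cgamma_ratio w N Re_w_pos). field. split; [assumption|].
       apply Cgamma_neq_0. change (Re (w + RtoC (INR (S N)))%C) with (Re w + INR (S N)).
       pose proof Re_w_pos. pose proof (pos_INR (S N)). lra. }
  rewrite !Cmod_div, !Cmod_R by (try assumption; apply poch_neq_0, Re_w_pos).
  rewrite (Rabs_pos_eq (INR (fact N))) by apply pos_INR. rewrite (Rabs_pos_eq (Re z - B)) by lra.
  replace (INR N + be + 1) with q by (unfold q, m; rewrite S_INR; ring).
  replace (INR N + 1) with m by (unfold m; now rewrite S_INR).
  assert (Hq : 0 < q) by (unfold q; lra).
  replace (1 - al) with (be / q) by (unfold al, q; field; unfold q in Hq; lra).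
  rewrite ln_div by assumption.
  replace (- be * (ln be - ln q)) with (- (be * ln be) + be * ln q) by ring.
  rewrite exp_plus, exp_Ropp.
  unfold Rpower. fold q.
  assert (Eq : exp (q * ln q) = q ^ S N * exp (be * ln q)).
  { unfold q at 1. rewrite Rmult_plus_distr_r, exp_plus. f_equal.
    unfold m. rewrite <- exp_pow_INR, exp_ln by assumption. reflexivity. }
  rewrite Eq.
  replace (/ al) with (q / m) by (unfold al; field; lra).
  replace ((q / m) ^ S N) with (q ^ S N * / m ^ S N) by (unfold Rdiv; now rewrite Rpow_mult_distr, pow_inv).
  rewrite fact_simpl, mult_INR. fold m.
  rewrite <- (tech_pow_Rmult m).
  field. repeat split; try lra; [apply pow_nonzero; lra|].
  apply Rgt_not_eq, exp_pos.
Qed.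

Lemma fact_series : / lam < Re z ->
  ex_series (fun n => Cmod (fact_term lam a z n)) /\
  (forall e, 0 < e -> exists N0, forall N, (N0 <= N)%nat ->
     Cmod (lap_transform 0 - csum (fact_term lam a z) N)%C < e).
Proof.
  intros Hz1. set (x := lam * Re z).
  assert (Hx1 : 1 < x).
  { unfold x. apply Rmult_lt_compat_l with (r := lam) in Hz1; [|assumption]. rewrite Rinv_r in Hz1; lra. }
  assert (HxB : lam * B < x) by (unfold x; apply Rmult_lt_compat_l; assumption).
  (* The domain of (i) is exactly what leaves room for [c] strictly between [max(1, lam B)] and [x]:
     the mean estimate needs the lower bound, the weights the upper one. *)
  set (c := (Rmax 1 (lam * B) + x) / 2).
  assert (Hmax : Rmax 1 (lam * B) < x) by (apply Rmax_lub_lt; assumption).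
  pose proof (Rmax_l 1 (lam * B)). pose proof (Rmax_r 1 (lam * B)).
  assert (Hc : 1 < c < x) by (unfold c; lra).
  assert (HcB : lam * B <= c) by (unfold c; lra).
  destruct (phi_derivative_mean F lam A B c) as [M [HM Hb]]; try assumption; [lra|].
  assert (Ew : Re w = x) by apply Re_w.
  assert (Hpoch : forall n, rpoch x n <= Cmod (poch w n)).
  { intros n. rewrite <- Ew. apply rpoch_le_poch, Re_w_pos. }
  assert (Hrp : forall n, 0 < rpoch x n) by (intros n; apply rpoch_pos; lra).
  split.
  - apply (@ex_series_le R_AbsRing R_CompleteNormedModule _
      (fun n => scal (lam * M) (weight c x n / (x + INR n)))).
    + intros n. unfold norm; simpl. unfold abs; simpl. rewrite Rabs_pos_eq by apply Cmod_ge_0.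
      unfold scal; simpl; unfold mult; simpl.
      rewrite fact_term_eq, Cmod_div, !Cmod_mult, !Cmod_R by (apply poch_neq_0, Re_w_pos).
      rewrite pow_1_abs, Rmult_1_l, (Rabs_pos_eq lam) by lra.
      (* The terms involve [phi^(n)] at [s = 1] only; the remainder below uses the same bound for
         every [s] in [(0, 1]], as its integral requires. *)
      specialize (Hb n 1 ltac:(lra)). rewrite pow1, Rmult_1_l, ln_1, Rmult_0_r, exp_0, Rmult_1_r in Hb.
      pose proof (pos_INR n). pose proof (Hrp n). pose proof (Hrp (S n)) as P. pose proof (Hpoch (S n)) as Q.
      apply Rle_trans with (lam * (M * (INR (fact n) * exp ((c - 1) * ln (INR n + 2)))) * / rpoch x (S n)).
      * apply Rmult_le_compat.
        -- apply Rmult_le_pos; [lra|apply Cmod_ge_0].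
        -- apply Rlt_le, Rinv_0_lt_compat. lra.
        -- apply Rmult_le_compat_l; [lra|exact Hb].
        -- apply Rinv_le_contravar; assumption.
      * right. unfold weight. cbn [rpoch]. field. split; lra.
    + apply (@ex_series_scal R_AbsRing R_NormedModule). apply weight_summable, Hc.
  - intros e He.
    destruct (weight_vanishes c x Hc (e * (Re z - B) / M)) as [N0 HN0].
    { apply Rdiv_lt_0_compat; [apply Rmult_lt_0_compat; lra|assumption]. }
    exists N0. intros N HN. rewrite Cmod_remainder. specialize (HN0 (S N) ltac:(lia)).
    set (K := M * (INR (fact (S N)) * exp ((c - 1) * ln (INR (S N) + 2)))).
    assert (HK : 0 <= K).
    { apply Rmult_le_pos; [lra|]. apply Rmult_le_pos; [apply pos_INR|apply Rlt_le, exp_pos]. }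
    destruct (lap_transform_bound (S N) K HK) as [_ Bd].
    { intros t Ht. destruct (euler_deriv_scaled (S N) t Ht) as [Hs [-> <-]]. apply Hb. exact Hs. }
    apply Rle_lt_trans with (K / (Re z - B) * / rpoch x (S N)).
    + apply Rmult_le_compat; [apply Cmod_ge_0| |exact Bd|].
      * apply Rlt_le, Rinv_0_lt_compat. pose proof (Hrp (S N)). pose proof (Hpoch (S N)). lra.
      * apply Rinv_le_contravar; [apply Hrp|apply Hpoch].
    + replace (K / (Re z - B) * / rpoch x (S N)) with (weight c x (S N) * (M / (Re z - B))).
      2: { unfold K, weight. field. split; [|lra]. pose proof (Hrp (S N)). lra. }
      apply Rmult_lt_compat_r with (r := M / (Re z - B)) in HN0; [|apply Rdiv_lt_0_compat; lra].
      replace (e * (Re z - B) / M * (M / (Re z - B))) with e in HN0 by (field; lra). exact HN0.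
Qed.

End Laplace.

Lemma sum_n_csum (f : nat -> C) n : sum_n (G := C_NormedModule) f n = csum f n.
Proof. induction n as [|n IH]; [now rewrite sum_O|]. rewrite sum_Sn, IH. reflexivity. Qed.

Theorem theorem3p2 (a : nat -> C) (F : C -> C) (lam A B : R) :
  Gevrey1 a ->
  0 < lam -> 0 < A -> 0 < B ->
  (* F is holomorphic on Delta_lambda *)
  (forall zeta : C, Delta_lam lam zeta -> @ex_derive C_AbsRing C_NormedModule F zeta) ->
  (* F extends the Borel transform (agrees with its series near 0) *)
  (exists r : R, 0 < r /\ forall zeta : C, Cmod zeta < r ->
      @is_series C_AbsRing C_NormedModule (borel_term a zeta) (F zeta)) ->
  (* exponential bound on Delta_lambda *)
  (forall zeta : C, Delta_lam lam zeta -> Cmod (F zeta) <= A * exp (B * Cmod zeta)) ->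
  (* (i) *)
  (forall z : C, Rmax B (/ lam) < Re z ->
     @ex_RInt_gen C_R_NormedModule (laplace_integrand F z) (at_point 0) (Rbar_locally p_infty)
     /\ ex_series (fun n => Cmod (fact_term lam a z n))
     /\ @is_series C_AbsRing C_NormedModule (fact_term lam a z) (borel_sum a F z - a O)%C)
  /\
  (* (ii) *)
  (forall (N : nat) (z : C), B < Re z ->
     @ex_RInt_gen C_R_NormedModule (laplace_integrand F z) (at_point 0) (Rbar_locally p_infty)
     /\ Cmod (borel_sum a F z - (a O + csum (fact_term lam a z) N))%C
          <= R_fact lam A B N z).
Proof.
  intros _ Hlam HA HB HF Hser HFb. split.
  - intros z Hz.
    assert (HzB : B < Re z) by (eapply Rle_lt_trans; [apply Rmax_l|exact Hz]).
    assert (Hzl : / lam < Re z) by (eapply Rle_lt_trans; [apply Rmax_r|exact Hz]).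
    destruct (fact_series F lam A B z Hlam HA HB HF HFb HzB a Hser Hzl) as [S1 S2].
    split; [|split; [exact S1|]].
    + eexists. apply (laplace_integrand_CIg F lam A B z); assumption.
    + rewrite (borel_sum_eq F lam A B z) by assumption.
      replace (a O + lap_transform F lam z 0 - a O)%C with (lap_transform F lam z 0) by ring.
      intros P [e He]. destruct (S2 e (cond_pos e)) as [N0 HN0]. exists N0. intros n Hn.
      apply He. rewrite sum_n_csum. apply C_NormedModule_mixin_compat1.
      specialize (HN0 n Hn). rewrite Cmod_sub_sym in HN0. exact HN0.
  - intros N z Hz. split.
    + eexists. apply (laplace_integrand_CIg F lam A B z); assumption.
    + rewrite (borel_sum_eq F lam A B z) by assumption.
      replace (a O + lap_transform F lam z 0 - (a O + csum (fact_term lam a z) N))%C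
        with (lap_transform F lam z 0 - csum (fact_term lam a z) N)%C by ring.
      apply remainder_bound; assumption.
Qed.
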